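(* For a permutation $\sigma\in\mathfrak{S}_4$ let $u_\sigma\in M_2\otimes M_2\subset\mathcal{O}_2$ be the associated permutation unitary, let $\rho_\sigma=\lambda_{u_\sigma}$ be the unital $*$-endomorphism of $\mathcal{O}_2$ determined by $\rho_\sigma(s_i)=u_\sigma s_i$ for $i=1,2$, and let $\mathrm{Ind}(\rho_\sigma)$ be the minimal index of the inclusion of factors $\pi_\omega(\rho_\sigma(\mathcal{O}_2))''\subset\pi_\omega(\mathcal{O}_2)''$. Then the values of $\mathrm{Ind}(\rho_\sigma)$ for all 24 permutations $\sigma\in\mathfrak{S}_4$ (written in cycle notation) are as follows: (i) $\mathrm{Ind}(\rho_\sigma)=1$ for $\sigma\in\{\mathrm{id},\ (12)(34),\ (13)(24),\ (14)(23)\}$; (ii) $\mathrm{Ind}(\rho_\sigma)=2$ for $\sigma\in\{(12),\ (13),\ (24),\ (34),\ (1234),\ (1324),\ (1423),\ (1432)\}$; (iii) $\mathrm{Ind}(\rho_\sigma)=4$ for $\sigma\in\{(14),\ (23),\ (123),\ (132),\ (124),\ (142),\ (134),\ (143),\ (234),\ (243),\ (1243),\ (1342)\}$.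
   Context: $\mathcal{O}_2=C^*(s_1,s_2)$ is the Cuntz algebra, i.e. the $C^*$-algebra generated by two isometries $s_1,s_2$ with $s_1s_1^*+s_2s_2^*=1$. For a multiindex $\alpha=(\alpha_1,\dots,\alpha_k)\in\{1,2\}^k$ put $s_\alpha=s_{\alpha_1}\cdots s_{\alpha_k}$. For every unitary $u\in\mathcal{O}_2$ there is a unique unital $*$-endomorphism $\lambda_u$ of $\mathcal{O}_2$ with $\lambda_u(s_i)=us_i$, $i=1,2$. The gauge action of $\mathbb{T}$ on $\mathcal{O}_2$ is given by $s_i\mapsto zs_i$ for $z\in\mathbb{T}$. Its fixed point algebra is the core UHF subalgebra $\mathcal{F}_2\simeq\bigotimes_{i=1}^\infty M_2$, the closed span of the elements $s_\alpha s_\beta^*$ with $|\alpha|=|\beta|$. The subalgebra $M_2\otimes M_2\subset\mathcal{F}_2$ is $\mathrm{span}\{s_\alpha s_\beta^*:\alpha,\beta\in\{1,2\}^2\}$. Let $E:\mathcal{O}_2\to\mathcal{F}_2$ be the conditional expectation obtained by averaging over the gauge action, $\tau$ the unique tracial state on $\mathcal{F}_2$, $\omega=\tau\circ E$ the canonical (faithful) KMS state on $\mathcal{O}_2$, and $\pi_\omega$ its GNS representation. Then $\pi_\omega(\mathcal{O}_2)''$ is an approximately finite-dimensional factor of type $III_{1/2}$, and for each unitary $u\in M_2\otimes M_2$ the algebra $\pi_\omega(\lambda_u(\mathcal{O}_2))''$ is a subfactor of it. Permutation unitaries: identify the multiindices $11,12,21,22$ in $\{1,2\}^2$ with $1,2,3,4$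 respectively, so that $\sigma\in\mathfrak{S}_4$ acts on $\{1,2\}^2$. Then $u_\sigma=\sum_{\alpha\in\{1,2\}^2}s_{\sigma(\alpha)}s_\alpha^*$, so $\rho_\sigma(s_i)=\sum_{j=1}^{2}s_{\sigma(ij)}s_j^*$. Cycle notation is the usual one: for instance $(142)$ means $1\mapsto4\mapsto2\mapsto1$, so $\rho_{(142)}(s_1)=s_{22}s_1^*+s_{11}s_2^*$ and $\rho_{(142)}(s_2)=s_{21}s_1^*+s_{12}s_2^*$. Minimal index: for an inclusion of factors $N\subset M$, the minimal index is the minimum of the Kosaki index $\mathrm{Ind}_\varepsilon(N\subset M)$ over all faithful normal conditional expectations $\varepsilon:M\to N$. *)

(* Defs.v *)
From HB Require Import structures.
From mathcomp Require Import all_boot all_order all_algebra all_fingroup.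
From mathcomp Require Import sesquilinear complex.
From mathcomp Require Import all_classical all_reals all_analysis.
Set Implicit Arguments.
Unset Strict Implicit.
Unset Printing Implicit Defensive.
Import Order.TTheory GRing.Theory Num.Theory.
Import numFieldNormedType.Exports.
Local Open Scope classical_set_scope.
Local Open Scope ring_scope.
Local Open Scope complex_scope.

(* The inner product is linear in its first argument. *)
HB.mixin Record isHilbert (R : realType) H of CompleteNormedModule R[i] H := {
  dotp : {dot H for @Num.conj R[i]} ;
  normr_dotp : forall x : H, `|x| ^+ 2 = dotp x x }.

#[short(type="hilbertType")]
HB.structure Definition Hilbert (R : realType) :=
  {H of isHilbert R H & CompleteNormedModule R[i] H}.

(* The norm is a field of its own because the library has no structure that
   joins its normed modules with its rings. *)
HB.mixin Record isCStarAlgebra (R : realType) A of GRing.Algebra R[i] A := {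
  star : A -> A ;
  cnorm : A -> R ;
  cnorm0_eq0 : forall x : A, cnorm x = 0 -> x = 0 ;
  cnormD_le : forall x y : A, cnorm (x + y) <= cnorm x + cnorm y ;
  cnormZ : forall (a : R[i]) (x : A),
    cnorm (a *: x) = complex.Re `|a| * cnorm x ;
  cnormM_le : forall x y : A, cnorm (x * y) <= cnorm x * cnorm y ;
  cnorm_complete : forall u : nat -> A,
    (forall e : R, 0 < e -> exists N : nat,
       forall m n, (N <= m)%N -> (N <= n)%N -> cnorm (u m - u n) < e) ->
    exists l : A, (fun n => cnorm (u n - l)) @ \oo --> (0 : R) ;
  starK : involutive star ;
  star_antilinear : forall (a : R[i]) (x y : A),
    star (a *: x + y) = Num.conj a *: star x + star y ;
  starM : forall x y : A, star (x * y) = star y * star x ;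
  cstar_identity : forall x : A, cnorm (star x * x) = cnorm x ^+ 2 }.

#[short(type="cstarAlgType")]
HB.structure Definition CStarAlgebra (R : realType) :=
  {A of isCStarAlgebra R A & GRing.Algebra R[i] A}.

Section Operators.
Variables (R : realType) (H : hilbertType R).
Implicit Types (x y z : H -> H) (P N M D : set (H -> H)).

Definition bounded_op x : Prop := linear x /\ continuous x.

Definition adj x : H -> H :=
  xget x [set y | forall xi eta : H, dotp (y xi) eta = dotp xi (x eta)].

Definition commutant P : set (H -> H) :=
  [set x | bounded_op x /\ forall y, P y -> x \o y = y \o x].

(* In R[i], [0 <= c] says that c is real and nonnegative. *)
Definition op_le x y : Prop := forall xi : H, 0 <= dotp (y xi - x xi) xi.

Definition positive_part P : set (H -> H) := [set x | P x /\ op_le 0 x].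

Definition directed D : Prop :=
  D !=set0 /\
  forall x y, D x -> D y -> exists z, [/\ D z, op_le x z & op_le y z].

Definition op_lub D x : Prop :=
  [/\ bounded_op x, forall y, D y -> op_le y x &
      forall z, bounded_op z -> (forall y, D y -> op_le y z) -> op_le x z].

Definition ReE (c : R[i]) : \bar R := (complex.Re c)%:E.

(* Functionals on P are total functions; only their values on P matter. *)
Definition normal_functional P (phi : (H -> H) -> R[i]) : Prop :=
  [/\ forall (a : R[i]) x y, P x -> P y -> phi (a *: x + y) = a * phi x + phi y,
      forall x, positive_part P x -> 0 <= phi x &
      forall D x, D `<=` positive_part P -> directed D -> P x -> op_lub D x ->
        ReE (phi x) = ereal_sup [set ReE (phi y) | y in D]].

Definition faithful_normal_functional P (phi : (H -> H) -> R[i]) : Prop :=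
  normal_functional P phi /\
  forall x, positive_part P x -> phi x = 0 -> x = 0.

Definition fn_conditional_expectation N M (eps : (H -> H) -> (H -> H)) : Prop :=
  [/\ [/\ forall x, M x -> N (eps x),
          forall x, N x -> eps x = x,
          forall (a : R[i]) x y, M x -> M y ->
            eps (a *: x + y) = a *: eps x + eps y &
          forall a x b, N a -> M x -> N b ->
            eps (a \o x \o b) = a \o eps x \o b],
      forall x, positive_part M x -> op_le 0 (eps x),
      forall D x, D `<=` positive_part M -> directed D -> M x -> op_lub D x ->
        op_lub (eps @` D) (eps x) &
      forall x, positive_part M x -> eps x = 0 -> x = 0].

(* Haagerup's extended positive part of P: lower semicontinuous, additive,
   positively homogeneous functions from the positive part of the predual
   to [0, +oo]. *)
Definition extended_positive P (m : ((H -> H) -> R[i]) -> \bar R) : Prop :=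
  [/\ forall psi, normal_functional P psi -> (0 <= m psi)%E,
      forall (r : R) psi chi, 0 <= r ->
        normal_functional P psi -> normal_functional P chi ->
        m (fun x => r%:C * psi x + chi x) = (r%:E * m psi + m chi)%E &
      forall psi (r : R), normal_functional P psi -> (r%:E < m psi)%E ->
        exists2 d : R, 0 < d & forall chi, normal_functional P chi ->
          (forall x, P x -> (forall xi : H, `|x xi| <= `|xi|) ->
             `|chi x - psi x| <= d%:C) ->
          (r%:E < m chi)%E].

(* Normal semifinite faithful operator-valued weights Q -> P, for P a von
   Neumann subalgebra of Q; [T x psi] is the value at psi of the element T(x)
   of the extended positive part of P. *)
Definition nsf_operator_valued_weight (Q P : set (H -> H))
    (T : (H -> H) -> ((H -> H) -> R[i]) -> \bar R) : Prop :=
  let finite := [set x | Q x /\ exists2 b, positive_part P b &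
    forall psi, normal_functional P psi -> T (adj x \o x) psi = ReE (psi b)] in
  [/\ forall x, positive_part Q x -> extended_positive P (T x),
      forall (r : R) x y psi, 0 <= r ->
        positive_part Q x -> positive_part Q y -> normal_functional P psi ->
        T (r%:C *: x + y) psi = (r%:E * T x psi + T y psi)%E,
      forall a x psi, P a -> positive_part Q x -> normal_functional P psi ->
        T (adj a \o x \o a) psi = T x (fun y => psi (adj a \o y \o a)) &
      [/\ forall D x psi, D `<=` positive_part Q -> directed D -> Q x ->
            op_lub D x -> normal_functional P psi ->
            T x psi = ereal_sup [set T y psi | y in D],
          forall x, positive_part Q x ->
            (forall psi, normal_functional P psi -> T x psi = 0%E) -> x = 0 &
          (* sigma-weak density of the set of x with T(x^* x) bounded *)
          forall x (l : seq ((H -> H) -> R[i])) (e : R), Q x -> 0 < e ->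
            (forall phi, phi \in l -> normal_functional Q phi) ->
            exists2 y, finite y &
              forall phi, phi \in l -> `|phi (x - y)| <= e%:C]].

(* For a weight w on P and a vector xi, let R(xi) be the (possibly unbounded)
   operator from the GNS space of w to H sending the class of y to y xi.
   xi is w-bounded when R(xi) is bounded. *)
Definition weight_bounded P (w : (H -> H) -> \bar R) (xi : H) : Prop :=
  exists2 k : R, 0 <= k & forall y, P y -> (w (adj y \o y) < +oo)%E ->
    (ReE (dotp (y xi) (y xi)) <= k%:E * w (adj y \o y))%E.

(* R(xi) R(xi)^*, characterized by its quadratic form: |R(xi)^* zeta|^2 is the
   supremum of |<zeta, y xi>|^2 over the classes of norm at most 1. *)
Definition theta P (w : (H -> H) -> \bar R) (xi : H) : H -> H :=
  xget 0 [set t | bounded_op t /\ forall zeta : H,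
    0 <= dotp (t zeta) zeta /\
    ReE (dotp (t zeta) zeta) =
      ereal_sup [set ReE (`|dotp (y xi) zeta| ^+ 2) | y in
        [set y | P y /\ (w (adj y \o y) <= 1%:E)%E]]].

(* Connes' spatial derivative d phi / d w, for phi a positive normal functional
   on P' and w a weight on P. It is the positive self-adjoint operator attached
   to the closure of xi |-> phi(theta(xi)), xi w-bounded; it is represented
   by its closed form xi |-> |(d phi / d w)^(1/2) xi|^2 in [0, +oo], i.e. by
   the lower semicontinuous envelope. *)
Definition spatial_derivative P (phi : (H -> H) -> R[i])
    (w : (H -> H) -> \bar R) (xi : H) : \bar R :=
  ereal_sup [set ereal_inf [set ReE (phi (theta P w eta)) | eta in
      [set eta | weight_bounded P w eta /\ `|eta - xi| < r%:C]] |
    r in [set r : R | 0 < r]].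

(* Kosaki's T = eps^{-1} : N' -> M', determined by
   d(phi o eps)/d psi = d phi / d(psi o T). Faithful normal functionals, rather
   than weights, suffice for phi and psi on a separable Hilbert space. *)
Definition kosaki_inverse N M (eps : (H -> H) -> (H -> H))
    (T : (H -> H) -> ((H -> H) -> R[i]) -> \bar R) : Prop :=
  nsf_operator_valued_weight (commutant N) (commutant M) T /\
  forall phi psi, faithful_normal_functional N phi ->
    faithful_normal_functional (commutant M) psi ->
    spatial_derivative (commutant M) (phi \o eps) (fun x => ReE (psi x)) =
    spatial_derivative (commutant N) phi (fun x => T x psi).

(* Ind_eps = eps^{-1}(1) is the scalar c in [1, +oo] *)
Definition kosaki_index N M (eps : (H -> H) -> (H -> H)) (c : \bar R) : Prop :=
  exists2 T, kosaki_inverse N M eps T &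
    forall psi, normal_functional (commutant M) psi ->
      T id psi = (c * ReE (psi id))%E.

Definition minimal_index N M (c : \bar R) : Prop :=
  (exists2 eps, fn_conditional_expectation N M eps & kosaki_index N M eps c) /\
  forall eps c', fn_conditional_expectation N M eps ->
    kosaki_index N M eps c' -> (c <= c')%E.

End Operators.

Section Cuntz.
Variables (R : realType) (A : cstarAlgType R).

Definition star_subalgebra (B : set A) : Prop :=
  [/\ B 1, forall (a : R[i]) x y, B x -> B y -> B (a *: x + y),
      forall x y, B x -> B y -> B (x * y) & forall x, B x -> B (star x)].

Definition cnorm_closed (B : set A) : Prop :=
  forall (u : nat -> A) l, (forall n, B (u n)) ->
    (fun n => cnorm (u n - l)) @ \oo --> (0 : R) -> B l.

(* The generators s_1, s_2 are s 0, s 1. *)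
Definition cuntz_generators (s : 'I_2 -> A) : Prop :=
  [/\ forall i, star (s i) * s i = 1,
      \sum_(i < 2) s i * star (s i) = 1 &
      forall B : set A, star_subalgebra B -> cnorm_closed B ->
        (forall i, B (s i)) -> B = setT].

Definition star_morphism (f : {lrmorphism A -> A}) : Prop :=
  forall x, f (star x) = star (f x).

(* Only the values of gamma on the unit circle matter. *)
Definition gauge_action (s : 'I_2 -> A) (gamma : R[i] -> {lrmorphism A -> A}) :=
  forall z : R[i], `|z| = 1 ->
    star_morphism (gamma z) /\ forall i, gamma z (s i) = z *: s i.

Definition gauge_fixed (gamma : R[i] -> {lrmorphism A -> A}) : set A :=
  [set x | forall z : R[i], `|z| = 1 -> gamma z x = x].

(* E(x) is the integral of the norm-continuous function z |-> gamma z x over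
   the circle with normalized Haar measure, as a limit of Riemann sums. *)
Definition gauge_average (gamma : R[i] -> {lrmorphism A -> A}) (E : A -> A) :=
  forall x, (fun n : nat =>
    let root (k : nat) : R[i] :=
      let t : R := 2 * pi * k%:R / n.+1%:R in cos t +i* sin t in
    cnorm (n.+1%:R^-1 *: (\sum_(k < n.+1) gamma (root k) x) - E x))
      @ \oo --> (0 : R).

(* tau is a total function; only its values on F matter. *)
Definition tracial_state (F : set A) (tau : A -> R[i]) : Prop :=
  [/\ forall (a : R[i]) x y, F x -> F y -> tau (a *: x + y) = a * tau x + tau y,
      forall x, F x -> 0 <= tau (star x * x),
      tau 1 = 1 &
      forall x y, F x -> F y -> tau (x * y) = tau (y * x)].

Definition GNS_representation (omega : A -> R[i]) (H : hilbertType R)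
    (pi : A -> H -> H) (Omega : H) : Prop :=
  [/\ forall x, bounded_op (pi x),
      [/\ pi 1 = id,
          forall (a : R[i]) x y, pi (a *: x + y) = a *: pi x + pi y,
          forall x y, pi (x * y) = pi x \o pi y &
          forall x (xi eta : H),
            dotp (pi (star x) xi) eta = dotp xi (pi x eta)],
      closure [set pi x Omega | x in setT] = setT &
      forall x, omega x = dotp (pi x Omega) Omega].

(* 11, 12, 21, 22 are numbered 0, 1, 2, 3. *)
Definition s_pair (s : 'I_2 -> A) (k : 'I_4) : A :=
  s (inord (k %/ 2)) * s (inord (k %% 2)).

Definition perm_unitary (s : 'I_2 -> A) (sigma : 'S_4) : A :=
  \sum_(k < 4) s_pair s (sigma k) * star (s_pair s k).

End Cuntz.

Definition double_commutant (R : realType) (H : hilbertType R)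
  (P : set (H -> H)) : set (H -> H) := commutant (commutant P).

(* [cs] lists the disjoint cycles of sigma, on the points 1, 2, 3, 4;
   [next c x] is the successor of x in the cycle c. *)
Definition has_cycles (cs : seq (seq nat)) (sigma : 'S_4) : bool :=
  [forall i : 'I_4, (sigma i).+1 == foldr next i.+1 cs :> nat].

Definition index_one : seq (seq (seq nat)) :=
  [:: [::]; [:: [:: 1; 2]; [:: 3; 4]]; [:: [:: 1; 3]; [:: 2; 4]];
      [:: [:: 1; 4]; [:: 2; 3]]]%N.

Definition index_two : seq (seq (seq nat)) :=
  [:: [:: [:: 1; 2]]; [:: [:: 1; 3]]; [:: [:: 2; 4]]; [:: [:: 3; 4]];
      [:: [:: 1; 2; 3; 4]]; [:: [:: 1; 3; 2; 4]]; [:: [:: 1; 4; 2; 3]];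
      [:: [:: 1; 4; 3; 2]]]%N.

Definition index_four : seq (seq (seq nat)) :=
  [:: [:: [:: 1; 4]]; [:: [:: 2; 3]];
      [:: [:: 1; 2; 3]]; [:: [:: 1; 3; 2]]; [:: [:: 1; 2; 4]];
      [:: [:: 1; 4; 2]]; [:: [:: 1; 3; 4]]; [:: [:: 1; 4; 3]];
      [:: [:: 2; 3; 4]]; [:: [:: 2; 4; 3]]; [:: [:: 1; 2; 4; 3]];
      [:: [:: 1; 3; 4; 2]]]%N.

(* Main.v *)
(* Let Omega be the GNS vector of the KMS state om, and e the projection onto the closure
   of pi(rho(O_2)) Omega. For each sigma there are finitely many m_j in M_2 with
   s_i m_k = sum_j m_j rho(c_ijk) and om(m_k^* m_l rho(z)) = delta_kl om(rho z); since the
   m_j centralize om, right multiplication by m_j^* on O_2 Omega extends to a bounded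
   operator m'_j of M'. Then sum_j m_j e m_j^* = 1 = sum_j m'_j e m'_j^*, so that
   x |-> sum_j m'_j e x e m'_j^* is a conditional expectation of M onto N, Kosaki's inverse
   of which is y |-> sum_j m_j y m_j^* from N' to M', with index c = sum_j m_j m_j^*.

   For the minimality, take isometries nu_j in N with orthogonal ranges and put
   v = sum_j nu_j m_j^*. Any expectation eps' is of the form x |-> eps(h x) with eps(h) = 1,
   which forces (eps'(v v^* ) v Omega, v Omega) = c. Testing the equation of spatial
   derivatives at v Omega against the functional (. Omega, Omega) + K (. v Omega, v Omega),
   K large, gives c^2 <= c' c for the index c' of eps'. *)

(* No modular theory enters. Put n_p = m'_p e and write T for the inverse. By a Parseval identity
   for the expansion y = sum_p n_p d_p of N' over M', the GNS space of psi o T is a direct sum of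
   copies of that of psi, on which R(xi) acts as n_p R(xi). Hence theta(xi) for psi o T is eps
   applied to theta(xi) for psi. The bounded vectors are the same, so the spatial derivatives agree
   already before lower semicontinuous envelopes are taken. The obstacle in the minimality is that
   eps' and its inverse are arbitrary. The vector v Omega removes it: theta(v Omega) = v v^* for the
   state of Omega, the number c found there does not depend on eps', and the test element 1 of N'
   brings in c' and nothing else about the inverse. The m_j come from the matrix units e_ij = s_i
   s_j^* of M_2: 1 for index 1; sqrt 2 e_11 and sqrt 2 e_22, or 1 and the flip e_12 + e_21, for
   index 2; all sqrt 2 e_ij for index 4. They are orthonormal for om, and c is their number. *)
Require Import Defs.
From HB Require Import structures.
From mathcomp Require Import all_boot all_order all_algebra all_fingroup.
From mathcomp Require Import sesquilinear complex.
From mathcomp Require Import all_classical all_reals all_analysis.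
From mathcomp Require Import ring lra.
Set Implicit Arguments.
Unset Strict Implicit.
Unset Printing Implicit Defensive.
Import Order.TTheory GRing.Theory Num.Theory.
Import numFieldNormedType.Exports.
Local Open Scope classical_set_scope.
Local Open Scope ring_scope.
Local Open Scope complex_scope.

(** * Complex numbers and inner products *)

(* Unlike [complex.Re], not a canonical additive map: [lra] treats it as an atom. *)
Definition re (R : realType) (z : R[i]) : R := complex.Re z.

Section ComplexNumbers.
Variable R : realType.
Implicit Types (z w : R[i]) (r : R).

Lemma conjCE z : Num.conj z = z^*%C.
Proof. by []. Qed.

Lemma ReD z w : re (z + w) = re z + re w.
Proof. by case: z; case: w. Qed.

Lemma ReN z : re (- z) = - re z.
Proof. by case: z. Qed.

Lemma ReB z w : re (z - w) = re z - re w.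
Proof. by rewrite ReD ReN. Qed.

Lemma ReZ r z : re (r%:C * z) = r * re z.
Proof. by case: z => a b /=; rewrite mul0r subr0. Qed.

Lemma Re_conj z : re (Num.conj z) = re z.
Proof. by case: z. Qed.

Lemma Re_sum (I : Type) (s : seq I) (P : pred I) (F : I -> R[i]) :
  re (\sum_(i <- s | P i) F i) = \sum_(i <- s | P i) re (F i).
Proof. exact: (big_morph _ ReD). Qed.

Lemma rcM (r s : R) : (r * s)%:C = r%:C * s%:C.
Proof. exact: rmorphM. Qed.

Lemma rcD (r s : R) : (r + s)%:C = r%:C + s%:C.
Proof. exact: rmorphD. Qed.

Lemma rcB (r s : R) : (r - s)%:C = r%:C - s%:C.
Proof. exact: rmorphB. Qed.

Lemma rcX (r : R) n : (r ^+ n)%:C = r%:C ^+ n.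
Proof. exact: rmorphXn. Qed.

Lemma conj_rc r : Num.conj r%:C = r%:C.
Proof. by rewrite conjCE conjc_real. Qed.

Lemma ge0_rc z : 0 <= z -> z = (re z)%:C.
Proof. by case: z => a b; rewrite lecE /= => /andP[/eqP -> _]. Qed.

Lemma ge0_Re z : 0 <= z -> 0 <= re z.
Proof. by rewrite lecE => /andP[_ ->]. Qed.

End ComplexNumbers.

Definition rn (R : realType) (V : normedZmodType R[i]) (x : V) : R :=
  re `|x|.

Section RealNorm.
Variable R : realType.
Implicit Types V : normedZmodType R[i].

Lemma norm_rn V (x : V) : `|x| = (rn x)%:C.
Proof. exact: ge0_rc. Qed.

Lemma rn_ge0 V (x : V) : 0 <= rn x.
Proof. exact: ge0_Re. Qed.

Lemma rnD V (x y : V) : rn (x + y) <= rn x + rn y.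
Proof. by rewrite -lecR rcD -!norm_rn ler_normD. Qed.

Lemma rnN V (x : V) : rn (- x) = rn x.
Proof. by rewrite /rn normrN. Qed.

Lemma rn_distrC V (x y : V) : rn (x - y) = rn (y - x).
Proof. by rewrite -rnN opprB. Qed.

Lemma rn_triangle V (y x z : V) : rn (x - z) <= rn (x - y) + rn (y - z).
Proof. by rewrite (le_trans _ (rnD _ _)) // addrA subrK. Qed.

Lemma rn0 V : rn (0 : V) = 0.
Proof. by rewrite /rn normr0. Qed.

Lemma rn0_eq0 V (x : V) : rn x = 0 -> x = 0.
Proof. by move=> h; apply/normr0_eq0; rewrite norm_rn h. Qed.

Lemma rn_le0 V (x : V) : rn x <= 0 -> x = 0.
Proof.
by move=> h; apply: rn0_eq0; apply/eqP; rewrite eq_le h rn_ge0.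
Qed.

Lemma rnM (z w : R[i]) : rn (z * w) = rn z * rn w.
Proof. by apply: complexI; rewrite rcM -!norm_rn normrM. Qed.

Lemma rn_rc (r : R) : rn r%:C = `|r|.
Proof. by rewrite /rn normc_def /= expr0n /= addr0 sqrtr_sqr. Qed.

Lemma rn_conj (z : R[i]) : rn (Num.conj z) = rn z.
Proof. by rewrite /rn norm_conjC. Qed.

Lemma rn_sqr (z : R[i]) : rn z ^+ 2 = re z ^+ 2 + complex.Im z ^+ 2.
Proof. by apply: complexI; rewrite add_Re2_Im2 rcX -norm_rn. Qed.

Lemma Re_le_rn (z : R[i]) : `|re z| <= rn z.
Proof. by rewrite -lecR -norm_rn normc_ge_Re. Qed.

Lemma Re_le_rn' (z : R[i]) : re z <= rn z.
Proof. exact: le_trans (ler_norm _) (Re_le_rn _). Qed.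

Lemma Im_le_rn (z : R[i]) : `|complex.Im z| <= rn z.
Proof.
rewrite -(@ler_pXn2r _ 2) ?nnegrE ?rn_ge0 // real_normK ?num_real // rn_sqr.
by rewrite lerDr sqr_ge0.
Qed.

(** The order of [R[i]] also forces reality, so a limit has to control the imaginary part as well as
    the sign of the real part. *)
Lemma ge0_closed (z : R[i]) :
  (forall d : R, 0 < d -> exists2 p : R[i], 0 <= p & rn (p - z) < d) -> 0 <= z.
Proof.
move=> h; rewrite lecE /=; apply/andP; split.
  rewrite -normr_eq0 eq_le normr_ge0 andbT leNgt; apply/negP => z0.
  have [p p0] := h _ z0; have /= := Im_le_rn (p - z).
  move: p0; rewrite lecE; case: p z {h z0} => [a b] [c d] /= /andP[/eqP -> _].
  by rewrite sub0r normrN => /le_lt_trans hh /hh; rewrite ltxx.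
rewrite leNgt; apply/negP => z0; have z1 : 0 < - complex.Re z by rewrite oppr_gt0.
have [p p0] := h _ z1; have := Re_le_rn' (p - z); have := ge0_Re p0.
by rewrite ReB /re; lra.
Qed.

Lemma rn_sqr_conj (z : R[i]) : (rn z ^+ 2)%:C = z * Num.conj z.
Proof. by rewrite rcX -norm_rn sqr_normc. Qed.

(** Rotating by [w] replaces a modulus by a real part, which turns complex Cauchy-Schwarz arguments
    into real quadratic polynomials. *)
Lemma rn_phase (z : R[i]) : exists2 w : R[i], rn w = 1 & w * z = (rn z)%:C.
Proof.
have [->|z0] := eqVneq z 0.
  by exists 1; rewrite ?mulr0 ?rn0 // /rn normr1.
have n0 : (rn z)%:C != 0 by rewrite -norm_rn normr_eq0.
exists (Num.conj z / (rn z)%:C).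
  apply: complexI; rewrite -[LHS]norm_rn normrM norm_conjC normfV !norm_rn.
  by rewrite rn_rc ger0_norm ?rn_ge0 // divff.
by rewrite mulrAC [X in X / _]mulrC -rn_sqr_conj rcX expr2 mulfK.
Qed.

Lemma rn_sum V (I : Type) (s : seq I) (P : pred I) (F : I -> V) :
  rn (\sum_(i <- s | P i) F i) <= \sum_(i <- s | P i) rn (F i).
Proof.
elim/big_rec2: _ => [|i x y _ h]; first by rewrite rn0.
by rewrite (le_trans (rnD _ _)) ?lerD2l.
Qed.
End RealNorm.

Lemma rnZ (R : realType) (H : normedModType R[i]) (a : R[i]) (x : H) :
  rn (a *: x) = rn a * rn x.
Proof. by apply: complexI; rewrite rcM -!norm_rn normrZ. Qed.

Section InnerProduct.
Variables (R : realType) (H : hilbertType R).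
Implicit Types (x y z : H) (a : R[i]).

Lemma ipDl x y z : dotp (x + y) z = dotp x z + dotp y z.
Proof. exact: linearDl. Qed.
Lemma ipZl a x z : dotp (a *: x) z = a * dotp x z.
Proof. exact: linearZl_LR. Qed.
Lemma ipDr x y z : dotp z (x + y) = dotp z x + dotp z y.
Proof. exact: linearDr. Qed.
Lemma ipZr a x z : dotp z (a *: x) = Num.conj a * dotp z x.
Proof. exact: linearZr_LR. Qed.
Lemma ipNr x z : dotp z (- x) = - dotp z x.
Proof. exact: linearNr. Qed.
Lemma ipBl x y z : dotp (x - y) z = dotp x z - dotp y z.
Proof. exact: linearBl. Qed.
Lemma ipBr x y z : dotp z (x - y) = dotp z x - dotp z y.
Proof. exact: linearBr. Qed.
Lemma ip0l z : dotp 0 z = 0 :> R[i].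
Proof. exact: linear0l. Qed.
Lemma ip0r z : dotp z 0 = 0 :> R[i].
Proof. exact: linear0r. Qed.
Lemma ip_suml (I : Type) (s : seq I) (P : pred I) (F : I -> H) z :
  dotp (\sum_(i <- s | P i) F i) z = \sum_(i <- s | P i) dotp (F i) z.
Proof. exact: linear_sumlz. Qed.
Lemma ip_sumr (I : Type) (s : seq I) (P : pred I) (F : I -> H) z :
  dotp z (\sum_(i <- s | P i) F i) = \sum_(i <- s | P i) dotp z (F i).
Proof. exact: linear_sumr. Qed.
Lemma ipC x y : dotp x y = Num.conj (dotp y x).
Proof. by rewrite hermC expr0 mul1r. Qed.

Lemma ipxx x : dotp x x = (rn x ^+ 2)%:C.
Proof. by rewrite -normr_dotp norm_rn rcX. Qed.

Lemma Re_ipxx x : re (dotp x x) = rn x ^+ 2.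
Proof. by rewrite ipxx. Qed.

Lemma ip_ext x y : (forall z, dotp x z = dotp y z) -> x = y.
Proof.
move=> h; apply/eqP; rewrite -subr_eq0; apply/eqP/rn0_eq0/eqP.
by rewrite -sqrf_eq0 -Re_ipxx ipBl h subrr.
Qed.

Lemma rn2D x y :
  rn (x + y) ^+ 2 = rn x ^+ 2 + rn y ^+ 2 + 2 * re (dotp x y).
Proof.
rewrite -!Re_ipxx ipDl !ipDr !ReD (ipC y x) Re_conj.
by rewrite mulr_natl mulr2n; ring.
Qed.

Lemma rn2B x y :
  rn (x - y) ^+ 2 = rn x ^+ 2 + rn y ^+ 2 - 2 * re (dotp x y).
Proof. by rewrite rn2D rnN ipNr ReN mulrN. Qed.
End InnerProduct.

(** * Real estimates, sequential limits and bounded operators *)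

Section RealEstimates.
Variable R : realType.
Implicit Types a b c x y : R.

Lemma discriminant_le a b c : (forall t, 0 <= a + 2 * t * b + t ^+ 2 * c) ->
  b ^+ 2 <= a * c.
Proof.
move=> h; have a0 : 0 <= a by move: (h 0); rewrite mulr0 mul0r expr0n mul0r !addr0.
have [c0|c0|c0] := ltrgt0P c.
- have := h (- b / c); have -> : a + 2 * (- b / c) * b + (- b / c) ^+ 2 * c =
     (a * c - b ^+ 2) / c by field; lra.
  by rewrite pmulr_lge0 ?invr_gt0 // subr_ge0.
- have nc0 : 0 < - c by lra.
  (* A negative [c] is impossible: adding the values at [1 + s] and [- (1 + s)] cancels the linear
     term, and this [s] makes the rest negative. *)
  set s := (a + 1) / - c; have s0 : 0 <= s by rewrite divr_ge0 //; lra.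
  have hs : s * c = - (a + 1) by rewrite /s; field; lra.
  have := h (1 + s); have := h (- (1 + s)).
  have : (1 + s) ^+ 2 * c <= s * c by nra.
  rewrite sqrrN; lra.
- subst c; rewrite mulr0; have [->|b0] := eqVneq b 0; first by rewrite expr0n.
  have := h (- (a + 1) / (2 * b)).
  have -> : a + 2 * (- (a + 1) / (2 * b)) * b + (- (a + 1) / (2 * b)) ^+ 2 * 0
    = -1 by field; rewrite b0.
  lra.
Qed.

Lemma ler_addn_inv x y c : (forall n : nat, x <= y + c / n.+1%:R) -> x <= y.
Proof.
move=> h; rewrite leNgt; apply/negP => yx.
have [c0|c0] := leP c 0; first by have := h 0%N; rewrite divr1; lra.
have := h (Num.truncn (c / (x - y))).
have xy0 : 0 < x - y by rewrite subr_gt0.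
have := truncnS_gt (c / (x - y)); rewrite ltr_pdivrMr // => h1.
rewrite -lerBlDl ler_pdivlMr ?ltr0Sn //; lra.
Qed.

Lemma inv_lt_eps c e : 0 < e -> exists N : nat, forall n, (N <= n)%N ->
  c / n.+1%:R < e.
Proof.
move=> e0; exists (Num.truncn (`|c| / e)) => n hn.
rewrite ltr_pdivrMr ?ltr0Sn // (le_lt_trans (ler_norm c)) //.
have := truncnS_gt (`|c| / e); rewrite ltr_pdivrMr // => /lt_le_trans; apply.
by rewrite mulrC ler_pM2l // ler_nat ltnS.
Qed.
End RealEstimates.

Definition seqlim (R : realType) (V : normedZmodType R[i]) (u : nat -> V) l :=
  forall e : R, 0 < e -> exists N : nat, forall n, (N <= n)%N -> rn (u n - l) < e.

Section SequenceLimits.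
Variables (R : realType) (V : normedZmodType R[i]).
Implicit Types (u v : nat -> V) (x y : V).

Lemma seqlim_of_inv u x (c : R) :
  (forall n, rn (u n - x) ^+ 2 <= c / n.+1%:R) -> seqlim u x.
Proof.
move=> h e e0; have e20 : 0 < e ^+ 2 by rewrite exprn_gt0.
have [N hN] := inv_lt_eps c e20; exists N => n /hN; move: (h n) => h1 h2.
by rewrite -(@ltr_pXn2r _ 2) ?nnegrE ?rn_ge0 ?(ltW e0) // (le_lt_trans h1).
Qed.

Lemma seqlimD u v x y : seqlim u x -> seqlim v y ->
  seqlim (fun n => u n + v n) (x + y).
Proof.
move=> hu hv e e0; have e2 : 0 < e / 2 by lra.
have [N hN] := hu _ e2; have [M hM] := hv _ e2.
exists (maxn N M) => n; rewrite geq_max => /andP[/hN h1 /hM h2].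
by rewrite opprD addrACA (le_lt_trans (rnD _ _)) //; lra.
Qed.

Lemma seqlim_unique u x y : seqlim u x -> seqlim u y -> x = y.
Proof.
move=> hx hy; apply/eqP; rewrite -subr_eq0; apply/eqP/rn_le0.
rewrite leNgt; apply/negP => h; have e2 : 0 < rn (x - y) / 2 by lra.
have [N hN] := hx _ e2; have [M hM] := hy _ e2.
have := hN _ (leq_maxl N M); have := hM _ (leq_maxr N M); set k := maxn N M.
have : rn (x - y) <= rn (u k - y) + rn (u k - x).
  by have := rn_triangle (u k) x y; rewrite (rn_distrC x (u k)); lra.
lra.
Qed.

Lemma seqlim_le u x (c : R) : seqlim u x -> (forall n, rn (u n) <= c) -> rn x <= c.
Proof.
move=> hx h; rewrite leNgt; apply/negP => hc.
have e0 : 0 < rn x - c by lra.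
have [N hN] := hx _ e0; have := hN _ (leqnn N); have := h N.
have : rn x <= rn (u N) + rn (u N - x).
  by have := rn_triangle (u N) x 0; rewrite !subr0 (rn_distrC x (u N)); lra.
lra.
Qed.
End SequenceLimits.

Section HilbertLimits.
Variables (R : realType) (H : hilbertType R).
Implicit Types (u v : nat -> H) (x y : H).

Lemma seqlimZ a u x : seqlim u x -> seqlim (fun n => a *: u n) (a *: x).
Proof.
move=> hu e e0; have a0 : 0 < rn a + 1 by have := rn_ge0 a; lra.
have [N hN] := hu _ (divr_gt0 e0 a0); exists N => n /hN h.
rewrite -scalerBr rnZ; move: h; rewrite ltr_pdivlMr // => h.
have := rn_ge0 (u n - x); nra.
Qed.

Lemma hilbert_complete u :
  (forall e : R, 0 < e -> exists N, forall m n, (N <= m)%N -> (N <= n)%N ->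
     rn (u m - u n) < e) -> exists x, seqlim u x.
Proof.
move=> hu; have : cvg (u @ \oo).
  apply: cauchy_cvg; apply/cauchy_ballP => e e0.
  have eE : e = (re e)%:C by apply: ge0_rc; exact: ltW.
  have re0 : 0 < re e by rewrite -ltcR -eE.
  have [N hN] := hu _ re0; pose tail := [set z | exists2 n, (N <= n)%N & z = u n].
  exists (tail, tail) => [|[a b] /= [[m hm ->] [n hn ->]]].
    by split; exists N => // n hn; exists n.
  by rewrite -ball_normE /= norm_rn eE ltcR; exact: hN.
move=> /cvg_ex[x hx]; exists x => e e0.
have /= := (cvg_ballP _ _).1 hx e%:C; rewrite ltcR => /(_ _ e0)[N _ hN].
exists N => n /hN /=; rewrite -ball_normE /= norm_rn ltcR.
by rewrite rn_distrC.
Qed.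
End HilbertLimits.

Section BoundedOperators.
Variables (R : realType) (H : hilbertType R).
Implicit Types (x y : H -> H) (xi eta : H).

Lemma bounded_opP x : bounded_op x <->
  linear x /\ exists2 k : R, 0 < k & forall xi, rn (x xi) <= k * rn xi.
Proof.
split=> [[lx cx]|[lx [k k0 hk]]]; split=> //.
  pose f : {linear H -> H} := HB.pack x (GRing.isLinear.Build _ _ _ _ x lx).
  have := (linear_bounded_continuous f).2 cx => /linear_boundedP.
  move=> [M [Mr hM]].
  have Mlt : M < (re M + 1)%:C.
    rewrite -[ltLHS](RRe_real Mr) ltcR; lra.
  have := hM _ Mlt; set r := re M + 1 => h.
  exists (`|r| + 1) => [|xi]; first by have := normr_ge0 r; lra.
  rewrite -lecR rcM -!norm_rn (le_trans (h xi)) // ler_wpM2r // lecR.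
  by have := ler_norm r; lra.
pose f : {linear H -> H} := HB.pack x (GRing.isLinear.Build _ _ _ _ x lx).
have : continuous f; last by [].
apply/linear_bounded_continuous/linear_boundedP.
exists k%:C; split=> [|r kr xi]; first by apply/complex_realP; exists k.
rewrite !norm_rn /=.
have -> : r = (re r)%:C by apply: ge0_rc; rewrite (le_trans _ (ltW kr)) // ler0c ltW.
rewrite -rcM lecR (le_trans (hk xi)) // ler_wpM2r ?rn_ge0 //.
by move: kr; rewrite ltcE => /andP[_ /= /ltW].
Qed.

Lemma opP x : bounded_op x -> forall (a : R[i]) xi eta, x (a *: xi + eta) = a *: x xi + x eta.
Proof. by case. Qed.
Lemma op0 x : bounded_op x -> x 0 = 0.
Proof.
by move=> hx; have := opP hx (-1) 0 0; rewrite !scaleN1r !addNr.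
Qed.
Lemma opD x : bounded_op x -> forall xi eta, x (xi + eta) = x xi + x eta.
Proof. by move=> hx xi eta; have := opP hx 1 xi eta; rewrite !scale1r. Qed.
Lemma opZ x : bounded_op x -> forall a xi, x (a *: xi) = a *: x xi.
Proof. by move=> hx a xi; have := opP hx a xi 0; rewrite (op0 hx) !addr0. Qed.
Lemma opN x : bounded_op x -> forall xi, x (- xi) = - x xi.
Proof. by move=> hx xi; rewrite -scaleN1r (opZ hx) scaleN1r. Qed.
Lemma opB x : bounded_op x -> forall xi eta, x (xi - eta) = x xi - x eta.
Proof. by move=> hx xi eta; rewrite (opD hx) (opN hx). Qed.
Lemma op_sum x (I : Type) (s : seq I) (P : pred I) (F : I -> H) : bounded_op x ->
  x (\sum_(i <- s | P i) F i) = \sum_(i <- s | P i) x (F i).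
Proof. move=> hx; apply: big_morph; [exact: opD|exact: op0]. Qed.

Lemma bounded_comp x y : bounded_op x -> bounded_op y -> bounded_op (x \o y).
Proof.
move=> /bounded_opP[lx [k k0 hk]] /bounded_opP[ly [l l0 hl]]; apply/bounded_opP.
split=> [a u v /=|]; first by rewrite ly lx.
exists (k * l) => [|xi /=]; first exact: mulr_gt0.
by rewrite (le_trans (hk _)) // -mulrA ler_pM2l.
Qed.

Lemma bounded_id : bounded_op (id : H -> H).
Proof. by apply/bounded_opP; split=> //; exists 1 => // xi; rewrite mul1r. Qed.

Lemma bounded_lin a x y : bounded_op x -> bounded_op y -> bounded_op (a *: x + y).
Proof.
move=> /bounded_opP[lx [k k0 hk]] /bounded_opP[ly [l l0 hl]]; apply/bounded_opP.
split=> [b u v|].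
  rewrite !fctE lx ly !scalerDr !scalerA [b * a]mulrC -!addrA; congr (_ + _).
  by rewrite addrCA.
exists (rn a * k + l) => [|xi].
  by rewrite ltr_wpDl // mulr_ge0 ?rn_ge0 // ltW.
rewrite !fctE (le_trans (rnD _ _)) // mulrDl lerD // rnZ -mulrA.
by rewrite ler_wpM2l ?rn_ge0.
Qed.

Lemma bounded0 : bounded_op (0 : H -> H).
Proof.
apply/bounded_opP; split=> [a u v|].
  by change (0 = a *: (0 : H) + 0); rewrite scaler0 addr0.
by exists 1 => // xi; change (rn (0 : H) <= 1 * rn xi); rewrite rn0 mul1r rn_ge0.
Qed.

Lemma bounded_sum (I : Type) (s : seq I) (P : pred I) (F : I -> H -> H) :
  (forall i, bounded_op (F i)) -> bounded_op (\sum_(i <- s | P i) F i).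
Proof.
move=> hF; elim/big_rec: _ => [|i x _ hx]; first exact: bounded0.
by rewrite -[F i]scale1r; exact: bounded_lin.
Qed.

Lemma seqlim_op x u xi : bounded_op x -> seqlim u xi -> seqlim (x \o u) (x xi).
Proof.
move=> hx hu e e0; have [_ [k k0 hk]] := (bounded_opP x).1 hx.
have [N hN] := hu _ (divr_gt0 e0 k0); exists N => n /hN.
by rewrite /= -(opB hx) ltr_pdivlMr // mulrC; apply: le_lt_trans.
Qed.
End BoundedOperators.

(** * Operators defined by bounded forms *)

Definition lin_closed (R : realType) (V : lmodType R[i]) (D : set V) : Prop :=
  D 0 /\ forall (a : R[i]) x y, D x -> D y -> D (a *: x + y).

Section LinClosed.
Variables (R : realType) (V : lmodType R[i]) (D : set V).
Hypothesis hD : lin_closed D.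

Lemma lin_closedD x y : D x -> D y -> D (x + y).
Proof. by move=> hx hy; rewrite -[x]scale1r; exact: hD.2. Qed.
Lemma lin_closedZ a x : D x -> D (a *: x).
Proof. by move=> hx; rewrite -[a *: x]addr0; apply: hD.2 => //; exact: hD.1. Qed.
Lemma lin_closedB x y : D x -> D y -> D (x - y).
Proof. by move=> hx hy; rewrite addrC -scaleN1r; exact: hD.2. Qed.
Lemma lin_closed_sum (I : Type) (s : seq I) (P : pred I) (F : I -> V) :
  (forall i, P i -> D (F i)) -> D (\sum_(i <- s | P i) F i).
Proof.
by move=> hF; elim/big_ind: _ => //; [exact: hD.1|exact: lin_closedD].
Qed.
End LinClosed.

(** The domain [D] is explicit because weights and functionals are controlled only on an algebra
    inside [H -> H]. The form may degenerate, so no quotient has to be formed. *)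
Definition semi_ip (R : realType) (V : lmodType R[i]) (D : set V)
    (B : V -> V -> R[i]) : Prop :=
  [/\ forall (a : R[i]) x y z, D x -> D y -> D z ->
        B (a *: x + y) z = a * B x z + B y z,
      forall x y, D x -> D y -> B x y = Num.conj (B y x) &
      forall x, D x -> 0 <= re (B x x)].

Section SemiInnerProduct.
Variables (R : realType) (V : lmodType R[i]) (D : set V) (B : V -> V -> R[i]).
Hypotheses (hD : lin_closed D) (hB : semi_ip D B).
Local Notation q x := (re (B x x)).

Lemma semi_ipl a x y z : D x -> D y -> D z ->
  B (a *: x + y) z = a * B x z + B y z.
Proof. by case: hB => h _ _; exact: h. Qed.

Lemma semi_ipr a x y z : D x -> D y -> D z ->
  B z (a *: x + y) = Num.conj a * B z x + B z y.
Proof.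
case: hB => hl hh _ hx hy hz; rewrite hh ?hl //; last exact: hD.2.
by rewrite rmorphD rmorphM /= -!hh.
Qed.

Lemma semi_ip0l y : D y -> B 0 y = 0.
Proof.
move=> hy; have := semi_ipl (-1) hD.1 hD.1 hy.
by rewrite scaler0 addr0 mulN1r addNr.
Qed.

Lemma semi_ip0r y : D y -> B y 0 = 0.
Proof.
move=> hy; have := semi_ipr (-1) hD.1 hD.1 hy.
by rewrite scaler0 addr0 rmorphN1 mulN1r addNr.
Qed.

Lemma semi_ipZl a x y : D x -> D y -> B (a *: x) y = a * B x y.
Proof.
move=> hx hy; have := semi_ipl a hx hD.1 hy.
by rewrite (semi_ip0l hy) !addr0.
Qed.

Lemma semi_ipZr a x y : D x -> D y -> B y (a *: x) = Num.conj a * B y x.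
Proof.
move=> hx hy; have := semi_ipr a hx hD.1 hy.
by rewrite (semi_ip0r hy) !addr0.
Qed.

Lemma semi_ip_quad (t : R) (w : R[i]) x y : rn w = 1 -> D x -> D y ->
  q ((t%:C * w) *: y + x) =
  q x + 2 * t * re (w * B y x) + t ^+ 2 * q y.
Proof.
move=> hw hx hy; case: (hB) => _ hh _.
have hz : D ((t%:C * w) *: y + x) by exact: hD.2.
rewrite semi_ipl // !semi_ipr // rmorphM /= conj_rc.
have ww : w * Num.conj w = 1 by rewrite -rn_sqr_conj hw expr1n.
set c := w * B y x.
have cc : Num.conj w * B x y = Num.conj c by rewrite /c rmorphM /= -hh.
rewrite mulrDr !ReD.
have -> : t%:C * w * (t%:C * Num.conj w * B y y) =
   (t ^+ 2)%:C * (w * Num.conj w * B y y) by rewrite rcX; ring.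
rewrite ww mul1r ReZ -!mulrA ReZ cc ReZ Re_conj; ring.
Qed.

Lemma semi_ip_CS x y : D x -> D y -> rn (B x y) ^+ 2 <= q x * q y.
Proof.
move=> hx hy; have [w hw hwB] := rn_phase (B y x).
have -> : rn (B x y) = rn (B y x) by case: (hB) => _ -> // _; rewrite rn_conj.
apply: discriminant_le => t; case: (hB) => _ _ pos.
have -> : rn (B y x) = re (w * B y x) by rewrite hwB.
by rewrite -semi_ip_quad //; apply: pos; exact: hD.2.
Qed.

Variables (g : V -> R[i]) (k : R).
Hypotheses (k_ge0 : 0 <= k) (g_lin : forall (a : R[i]) x y, D x -> D y ->
             g (a *: x + y) = a * g x + g y)
           (g_bound : forall x, D x -> rn (g x) ^+ 2 <= k * q x).

(* The Riesz minimisation of q v - 2 Re (g v), in a space that need not be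
   complete. *)
Lemma riesz_approx (n : nat) : exists2 u, D u &
  forall v, D v -> rn (B v u - g v) ^+ 2 <= q v / n.+1%:R.
Proof.
case: (hB) => _ _ pos.
pose J v := q v - 2 * re (g v).
have J_ge v : D v -> - k <= J v.
  move=> hv; have h1 := g_bound hv; have h2 := pos _ hv; 
  have h3 := Re_le_rn' (g v); have h4 := rn_ge0 (g v).
  rewrite /J; rewrite leNgt; apply/negP => h.
  (* If [J v < - k], then (q v + k)^2 < 4 |g v|^2 <= 4 k q v, against (q v - k)^2 >= 0. *)
  have : (q v + k) ^+ 2 < (2 * rn (g v)) ^+ 2.
    by rewrite ltr_pXn2r ?nnegrE ?addr_ge0 ?mulr_ge0 //; lra.
  have := sqr_ge0 (q v - k); move: h1; move: (q v) (rn _) => a b; nra.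
pose S := [set J v | v in D].
have infS : has_inf S.
  split; first by exists (J 0); exists 0 => //; exact: hD.1.
  by exists (- k) => _ [v hv <-]; exact: J_ge.
have n0 : 0 < n.+1%:R^-1 :> R by rewrite invr_gt0 ltr0Sn.
have [_ [u hu <-] hJu] := inf_adherent n0 infS.
exists u => // v hv; have [w hw hwg] := rn_phase (B v u - g v).
(* As [u] minimizes [J] up to 1/(n+1), moving from [u] by t w v gives 0 <= 1/(n+1) + 2 t |B v u - g
   v| + t^2 q v for every real t. *)
rewrite [q v / _]mulrC; apply: discriminant_le => t.
have hz : D ((t%:C * w) *: v + u) by exact: hD.2.
have : inf S <= J ((t%:C * w) *: v + u).
  by apply: ge_inf; [exact: infS.2|exists ((t%:C * w) *: v + u)].
rewrite /J semi_ip_quad //.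
have -> : re (g ((t%:C * w) *: v + u)) =
    t * re (w * g v) + re (g u) by rewrite g_lin // ReD -mulrA ReZ.
have -> : rn (B v u - g v) = re (w * B v u) - re (w * g v).
  by rewrite -ReB -mulrBr hwg.
move: hJu; rewrite /J; move: (_^-1) => N; lra.
Qed.
End SemiInnerProduct.

Section CauchySchwarz.
Variables (R : realType) (H : hilbertType R).

Lemma ip_CS (x y : H) : rn (dotp x y) <= rn x * rn y.
Proof.
have hT : lin_closed (@setT H) by [].
have hd : semi_ip (@setT H) (fun x y => dotp x y).
  split=> [a u v z _ _ _|u v _ _|u _]; first by rewrite ipDl ipZl.
  - exact: ipC.
  - by rewrite Re_ipxx sqr_ge0.
have := semi_ip_CS hT hd (x := x) (y := y) I I; rewrite !Re_ipxx -exprMn.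
by rewrite ler_pXn2r // ?nnegrE ?mulr_ge0 ?rn_ge0.
Qed.

Lemma seqlim_ipl (u : nat -> H) x y : seqlim u x ->
  seqlim (fun n => dotp (u n) y) (dotp x y).
Proof.
move=> hu e e0; have y0 : 0 < rn y + 1 by have := rn_ge0 y; lra.
have [N hN] := hu _ (divr_gt0 e0 y0); exists N => n /hN h.
rewrite -ipBl (le_lt_trans (ip_CS _ _)) //; move: h; rewrite ltr_pdivlMr // => h.
have := rn_ge0 (u n - x); nra.
Qed.

Lemma seqlim_ipr (u : nat -> H) x y : seqlim u x ->
  seqlim (fun n => dotp y (u n)) (dotp y x).
Proof.
move=> /(@seqlim_ipl _ _ y) h e /h[N hN]; exists N => n /hN.
by rewrite (ipC y) (ipC y x) -rmorphB rn_conj.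
Qed.
End CauchySchwarz.

Lemma rn2D_le (R : realType) (W : normedZmodType R[i]) (x y : W) :
  rn (x + y) ^+ 2 <= 2 * (rn x ^+ 2 + rn y ^+ 2).
Proof.
have := rnD x y; have := rn_ge0 (x + y); have := rn_ge0 x; have := rn_ge0 y.
move: (rn _) (rn _) (rn _) => a b c *.
have : a ^+ 2 <= (b + c) ^+ 2 by nra.
have := sqr_ge0 (b - c); nra.
Qed.

Section RepresentingOperator.
Variables (R : realType) (H : hilbertType R) (V : lmodType R[i]) (D : set V).
Variables (B : V -> V -> R[i]) (f1 f2 : V -> H) (k : R).
Hypotheses (hD : lin_closed D) (hB : semi_ip D B).
Hypotheses
  (f1_lin : forall (a : R[i]) x y, D x -> D y -> f1 (a *: x + y) = a *: f1 x + f1 y)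
  (f2_lin : forall (a : R[i]) x y, D x -> D y -> f2 (a *: x + y) = a *: f2 x + f2 y)
  (k_ge0 : 0 <= k)
  (f1_bound : forall x, D x -> rn (f1 x) ^+ 2 <= k * re (B x x))
  (f2_bound : forall x, D x -> rn (f2 x) ^+ 2 <= k * re (B x x)).
Local Notation q x := (re (B x x)).

(** A stand-in for the vector $f_1^*\zeta$ of the completion: [u n] represents the functional $v
    \mapsto \langle f_1 v, \zeta\rangle$ up to an error of dual norm at most $(n+1)^{-1/2}$. *)
Definition riesz_seq (zeta : H) (u : nat -> V) : Prop :=
  (forall n, D (u n)) /\
  forall n v, D v ->
    rn (B v (u n) - dotp (f1 v) zeta) ^+ 2 <= q v / n.+1%:R.

Lemma riesz_seq_ex zeta : exists u, riesz_seq zeta u.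
Proof.
have glin (a : R[i]) x y : D x -> D y -> dotp (f1 (a *: x + y)) zeta =
    a * dotp (f1 x) zeta + dotp (f1 y) zeta.
  by move=> hx hy; rewrite f1_lin // ipDl ipZl.
have gb x : D x -> rn (dotp (f1 x) zeta) ^+ 2 <= (k * rn zeta ^+ 2) * q x.
  move=> hx; rewrite mulrAC (le_trans _ (ler_wpM2r _ (f1_bound hx))) ?sqr_ge0 //.
  by rewrite -exprMn ler_pXn2r ?nnegrE ?mulr_ge0 ?rn_ge0 // ip_CS.
have k0 : 0 <= k * rn zeta ^+ 2 by rewrite mulr_ge0 ?sqr_ge0.
have h n := riesz_approx hD hB k0 glin gb n.
have /choice[u hu] : forall n, exists u, D u /\ forall v, D v ->
    rn (B v u - dotp (f1 v) zeta) ^+ 2 <= q v / n.+1%:R.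
  by move=> n; have [u ? ?] := h n; exists u.
by exists u; split=> [n|n v hv]; have [? ?] := hu n; auto.
Qed.

Lemma q_le_of_bound w (e : R) : D w -> 0 <= e ->
  (forall v, D v -> rn (B v w) ^+ 2 <= q v * e) -> q w <= e.
Proof.
move=> hw e0 /(_ _ hw) h; case: hB => _ _ /(_ _ hw) => q0.
rewrite leNgt; apply/negP => lt.
have := Re_le_rn' (B w w) => h1.
have := rn_ge0 (B w w); nra.
Qed.

Lemma f2B x y : D x -> D y -> f2 (x - y) = f2 x - f2 y.
Proof.
move=> hx hy; have := f2_lin (-1) hy hx; rewrite !scaleN1r.
by rewrite (addrC (- y)) (addrC (- f2 y)).
Qed.

(** Serves twice: for [a = 1] and [z2 = 0] it shows that [f2 \o u] is Cauchy, in general that its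
    limit is linear in [zeta]. The constants come from two uses of |x + y|^2 <= 2 (|x|^2 +
    |y|^2). *)
Lemma riesz_seq_lin (a : R[i]) z1 z2 u1 u2 u3 :
  riesz_seq z1 u1 -> riesz_seq z2 u2 -> riesz_seq (a *: z1 + z2) u3 ->
  forall m n, rn (a *: f2 (u1 m) + f2 (u2 m) - f2 (u3 n)) ^+ 2 <=
    k * ((4 * rn a ^+ 2 + 4) / m.+1%:R + 2 / n.+1%:R).
Proof.
move=> [D1 h1] [D2 h2] [D3 h3] m n; have [_ _ pos] := hB.
have Dw1 : D (a *: u1 m + u2 m) by apply: hD.2.
have Dw : D ((a *: u1 m + u2 m) - u3 n) by apply: lin_closedB.
have -> : a *: f2 (u1 m) + f2 (u2 m) - f2 (u3 n) =
    f2 ((a *: u1 m + u2 m) - u3 n).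
  by rewrite -f2_lin // f2B.
apply: (le_trans (f2_bound Dw)); apply: ler_wpM2l => //.
apply: q_le_of_bound => // [|v hv].
  by rewrite addr_ge0 ?divr_ge0 ?addr_ge0 ?mulr_ge0 ?rn_ge0.
have q0 := pos _ hv.
have -> : B v ((a *: u1 m + u2 m) - u3 n) =
   Num.conj a * (B v (u1 m) - dotp (f1 v) z1) +
   (B v (u2 m) - dotp (f1 v) z2) -
   (B v (u3 n) - dotp (f1 v) (a *: z1 + z2)).
  rewrite [X in B v X]addrC -scaleN1r !(semi_ipr hD hB) //.
  by rewrite ipDr ipZr rmorphN1; ring.
rewrite (le_trans (rn2D_le _ _)) // rnN.
have H3 := h3 n v hv; have H1 := h1 m v hv; have H2 := h2 m v hv.
have := rn2D_le (Num.conj a * (B v (u1 m) - dotp (f1 v) z1))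
   (B v (u2 m) - dotp (f1 v) z2).
rewrite rnM rn_conj exprMn.
have : rn a ^+ 2 * rn (B v (u1 m) - dotp (f1 v) z1) ^+ 2 <=
   rn a ^+ 2 * (q v / m.+1%:R) by rewrite ler_wpM2l ?sqr_ge0.
move: H3 H1 H2; move: (rn a ^+ 2) (n.+1%:R^-1 : R) (m.+1%:R^-1 : R) => A N M.
by lra.
Qed.

Lemma riesz_seq_cvg zeta u : riesz_seq zeta u -> exists x, seqlim (f2 \o u) x.
Proof.
move=> hu; apply: hilbert_complete => e e0.
have e20 : 0 < e ^+ 2 / 2 by rewrite divr_gt0 ?exprn_gt0.
have [N hN] := inv_lt_eps (k * 8) e20; exists N => m n hm hn /=.
have h0 : riesz_seq 0 (fun=> 0).
  split=> [_|j v hv]; first exact: hD.1.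
  rewrite (semi_ip0r hD hB hv) ip0r subr0 rn0 expr0n /= divr_ge0 //; case: hB => _ _; exact.
have hu1 : riesz_seq (1 *: zeta + 0) u by rewrite scale1r addr0.
have f20 : f2 0 = 0.
  by have := f2_lin (-1) hD.1 hD.1; rewrite !scaleN1r !addNr.
have := riesz_seq_lin hu h0 hu1 m n; rewrite scale1r f20 addr0.
have := hN m hm; have := hN n hn; have r1 : rn (1 : R[i]) = 1 by rewrite /rn normr1.
rewrite r1 => h1 h2 h3.
rewrite -(@ltr_pXn2r _ 2) ?nnegrE ?rn_ge0 ?(ltW e0) // (le_lt_trans h3) //.
have : 0 <= k * n.+1%:R^-1 by rewrite mulr_ge0.
by move: h1 h2; move: (n.+1%:R^-1) (m.+1%:R^-1) => n' m'; lra.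
Qed.

(** Test the approximation against [u n] itself: q^2 <= 2 q / (n+1) + 2 k q |zeta|^2, then divide by
    q. *)
Lemma riesz_q_bound zeta u : riesz_seq zeta u ->
  forall n, q (u n) <= 2 * k * rn zeta ^+ 2 + 2 / n.+1%:R.
Proof.
move=> [Du hu] n; have [_ _ pos] := hB; have k0 := k_ge0.
have q0 := pos _ (Du n).
have h1 := hu n _ (Du n).
have h2 : q (u n) ^+ 2 <= rn (B (u n) (u n)) ^+ 2.
  by rewrite ler_pXn2r ?nnegrE ?rn_ge0 // Re_le_rn'.
have h3 := rn2D_le (B (u n) (u n) - dotp (f1 (u n)) zeta) (dotp (f1 (u n)) zeta).
rewrite subrK in h3.
have h4 : rn (dotp (f1 (u n)) zeta) ^+ 2 <= k * q (u n) * rn zeta ^+ 2.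
  rewrite (le_trans _ (ler_wpM2r _ (f1_bound (Du n)))) ?sqr_ge0 //.
  by rewrite -exprMn ler_pXn2r ?nnegrE ?mulr_ge0 ?rn_ge0 // ip_CS.
have [->|qn] := eqVneq (q (u n)) 0.
  by rewrite addr_ge0 ?divr_ge0 ?mulr_ge0 ?rn_ge0.
have qp : 0 < q (u n) by rewrite lt0r qn.
rewrite -(ler_pM2l qp) -expr2; move: h1; move: (_^-1) => N; lra.
Qed.

(* [t] is [f2 f1^*], for the extensions of [f1] and [f2] to the completion of [(D, B)];
   the minimising sequences [u] replace that completion. *)
Lemma representing_operator : exists2 t, bounded_op t &
  forall zeta, exists2 u, riesz_seq zeta u & seqlim (f2 \o u) (t zeta).
Proof.
have /choice[t ht] : forall zeta, exists x, exists2 u, riesz_seq zeta u &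
    seqlim (f2 \o u) x.
  move=> zeta; have [u hu] := riesz_seq_ex zeta.
  by have [x hx] := riesz_seq_cvg hu; exists x, u.
exists t => //; apply/bounded_opP; split=> [a z1 z2|].
  have [u1 h1 l1] := ht z1; have [u2 h2 l2] := ht z2.
  have [u3 h3 l3] := ht (a *: z1 + z2).
  apply/esym; apply: seqlim_unique (seqlimD (seqlimZ a l1) l2) _.
  rewrite -[t _]add0r.
  have -> : (fun n => a *: (f2 \o u1) n + (f2 \o u2) n) = (fun n =>
    (a *: f2 (u1 n) + f2 (u2 n) - f2 (u3 n)) + (f2 \o u3) n).
    by apply/funext => n /=; rewrite subrK.
  apply: seqlimD => //.
  apply: (seqlim_of_inv (c := k * (4 * rn a ^+ 2 + 4 + 2))) => n.
  by rewrite subr0 (le_trans (riesz_seq_lin h1 h2 h3 n n)) // -mulrDl mulrA.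
have [_ _ pos] := hB; have k0 := k_ge0.
(* The limit of [riesz_q_bound] gives |t zeta|^2 <= 2 k^2 |zeta|^2; this constant dominates it and
   stays positive when [k = 0]. *)
exists (2 * k + 1) => [|zeta]; first by lra.
have [u [Du hu] l] := ht zeta.
have zz := rn_ge0 zeta.
rewrite -(@ler_pXn2r _ 2) ?nnegrE ?rn_ge0 ?mulr_ge0 ?rn_ge0 //; last by lra.
suff : rn (t zeta) ^+ 2 <= 2 * k ^+ 2 * rn zeta ^+ 2.
  have := sqr_ge0 (rn zeta); rewrite exprMn; nra.
have hq := riesz_q_bound (conj Du hu).
apply: (ler_addn_inv (c := 2 * k)) => n.
apply: contrapT => /negP; rewrite -ltNge => hlt.
have hb m : (n <= m)%N -> rn (f2 (u m)) ^+ 2 <=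
    2 * k ^+ 2 * rn zeta ^+ 2 + 2 * k / n.+1%:R.
  move=> nm; rewrite (le_trans (f2_bound (Du m))) //.
  rewrite (le_trans (ler_wpM2l k_ge0 (hq m))) // mulrDr lerD //.
    by rewrite le_eqVlt; apply/orP; left; apply/eqP; ring.
  rewrite mulrA [k * 2]mulrC ler_wpM2l ?mulr_ge0 //.
  by rewrite lef_pV2 ?posrE ?ltr0Sn // ler_nat ltnS.
set c := (X in X < _) in hlt; have c0 : 0 <= c.
  by rewrite /c addr_ge0 ?divr_ge0 ?mulr_ge0 ?sqr_ge0.
have : rn (t zeta) <= Num.sqrt c.
  apply: (seqlim_le (u := fun m => f2 (u (n + m)%N))).
    move=> e /l[N hN]; exists N => m hm; apply: hN.
    by rewrite (leq_trans hm) // leq_addl.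
  move=> m; rewrite -(@ler_pXn2r _ 2) ?nnegrE ?rn_ge0 ?sqrtr_ge0 //.
  by rewrite sqr_sqrtr // hb // leq_addr.
rewrite -(@ler_pXn2r _ 2) ?nnegrE ?rn_ge0 ?sqrtr_ge0 // sqr_sqrtr //.
by rewrite leNgt hlt.
Qed.
End RepresentingOperator.

Section QuadraticOperator.
Variables (R : realType) (H : hilbertType R) (V : lmodType R[i]) (D : set V).
Variables (B : V -> V -> R[i]) (f : V -> H) (k : R).
Hypotheses (hD : lin_closed D) (hB : semi_ip D B).
Hypotheses
  (f_lin : forall (a : R[i]) x y, D x -> D y -> f (a *: x + y) = a *: f x + f y)
  (k_ge0 : 0 <= k)
  (f_bound : forall x, D x -> rn (f x) ^+ 2 <= k * re (B x x)).
Local Notation q x := (re (B x x)).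

(** The case f1 = f2 = f, where t = f f^* and <t zeta, zeta> = |f^* zeta|^2. The last two clauses
    say that this is the supremum of |<f v, zeta>|^2 over the unit ball of the form, which is how
    [theta] is characterized. *)
Lemma quadratic_operator : exists2 t, bounded_op t & forall zeta : H,
  [/\ 0 <= dotp (t zeta) zeta,
      forall v, D v -> rn (dotp (f v) zeta) ^+ 2 <= q v * re (dotp (t zeta) zeta) &
      forall e, 0 < e -> exists v, [/\ D v, q v <= 1 &
        re (dotp (t zeta) zeta) < rn (dotp (f v) zeta) ^+ 2 + e]].
Proof.
have [_ herm pos] := hB; have k0 := k_ge0.
have [t bt ht] := representing_operator hD hB f_lin f_lin k0 f_bound f_bound.
exists t => // zeta; have [u hu lu] := ht zeta.
set s := dotp (t zeta) zeta.
have Bq v : D v -> B v v = (q v)%:C.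
  move=> hv; have := herm v v hv hv; case: (B v v) => a b; rewrite conjCE /=.
  by case=> h; congr (_ +i* _); lra.
(* Along the minimizing sequence q (u n) and <f (u n), zeta> both tend to s, since each approximates
   |f^* zeta|^2. *)
have lim d : 0 < d -> exists n, [/\ rn ((q (u n))%:C - s) < d,
    rn (dotp (f (u n)) zeta - s) < d & n.+1%:R^-1 <= d ^+ 2].
  move=> d0; have d2 : 0 < d / 2 by lra.
  have [N1 h1] := seqlim_ipl zeta lu d2.
  have dd0 : 0 < (d / 2) ^+ 2 by rewrite exprn_gt0.
  have [N2 h2] := inv_lt_eps (2 * k * rn zeta ^+ 2 + 2) dd0.
  have d20 : 0 < d ^+ 2 by rewrite exprn_gt0.
  have [N3 h3] := inv_lt_eps 1 d20.
  pose n := maxn N1 (maxn N2 N3); exists n.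
  have /h1 /= g1 : (N1 <= n)%N by rewrite leq_maxl.
  have /h2 g2 : (N2 <= n)%N by rewrite leq_max leq_maxl orbT.
  have /h3 g3 : (N3 <= n)%N by rewrite !leq_max leqnn !orbT.
  have Du := hu.1 n.
  have qb := riesz_q_bound hB k0 f_bound hu n.
  have n1 : n.+1%:R^-1 <= 1 :> R by rewrite invf_le1 ?ltr0Sn // ler1n.
  have n0 : 0 <= n.+1%:R^-1 :> R by rewrite invr_ge0.
  have b2 := hu.2 n _ Du; rewrite Bq // in b2.
  have : rn ((q (u n))%:C - dotp (f (u n)) zeta) < d / 2.
    rewrite -(@ltr_pXn2r _ 2) ?nnegrE ?rn_ge0 ?(ltW d2) // (le_lt_trans b2) //.
    rewrite (le_lt_trans _ g2) // ler_wpM2r // (le_trans qb) // lerD2l.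
    by rewrite -[leRHS]mulr1 ler_wpM2l.
  have := rn_triangle (dotp (f (u n)) zeta) (q (u n))%:C s.
  move=> tr h; split; [lra|lra|].
  by rewrite mul1r in g3; exact: ltW.
have s0 : 0 <= s.
  apply: ge0_closed => d /lim[n [h _ _]]; exists (q (u n))%:C => //.
  by rewrite ler0c; exact: pos (hu.1 n).
have sE := ge0_rc s0; have rs0 := ge0_Re s0.
set sr := re s in sE rs0 *.
have qlim d n : rn ((q (u n))%:C - s) < d -> q (u n) <= sr + d.
  rewrite sE -rcB rn_rc => h.
  by have := le_lt_trans (ler_norm _) h; lra.
split=> // [v hv|e e0].
  have q0 := pos v hv; apply/ler_addgt0Pr => e e0.
  (* With a^2 <= q v (sr + d), a b <= q v (sr + 2) d and b^2 <= q v d^2, the square (a + b)^2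
     exceeds q v sr by at most q v d (2 sr + 6). The added 1 keeps [C] positive. *)
  set C := q v * (2 * sr + 6) + 1.
  have C0 : 0 < C by rewrite ltr_wpDl ?ltr01 ?mulr_ge0 ?addr_ge0 ?mulr_ge0.
  set d := Num.min 1 (e / C).
  have d0 : 0 < d by rewrite lt_min ltr01 divr_gt0.
  have d1 : d <= 1 by rewrite ge_min lexx.
  have dC : d * C <= e by rewrite -ler_pdivlMr // ge_min lexx orbT.
  have [n [/qlim h1 _ h3]] := lim d d0.
  have ha := semi_ip_CS hD hB hv (hu.1 n).
  have hb := hu.2 n v hv.
  have tr := rn_triangle (B v (u n)) (dotp (f v) zeta) 0.
  rewrite !subr0 rn_distrC in tr.
  move: ha hb tr h3; move: (_^-1) (q (u n)) h1 => N Q h1.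
  move: (rn (B v (u n) - _)) (rn (B v (u n))) (rn_ge0 (B v (u n) - dotp (f v) zeta))
     (rn_ge0 (B v (u n))) (rn_ge0 (dotp (f v) zeta)) => b a b0 a0.
  move: (rn (dotp _ _)) => g g0 ha hb tr hN.
  have a2 : a ^+ 2 <= q v * (sr + d) by rewrite (le_trans ha) // ler_wpM2l.
  have b2 : b ^+ 2 <= q v * d ^+ 2 by rewrite (le_trans hb) // ler_wpM2l.
  have ab : a * b <= q v * ((sr + 2) * d).
    rewrite -(@ler_pXn2r _ 2) ?nnegrE ?mulr_ge0 ?addr_ge0 ?(ltW d0) //.
    rewrite exprMn (le_trans (ler_pM _ _ a2 b2)) ?sqr_ge0 //.
    have -> : q v * (sr + d) * (q v * d ^+ 2) = (q v * d) ^+ 2 * (sr + d) by ring.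
    have -> : (q v * ((sr + 2) * d)) ^+ 2 = (q v * d) ^+ 2 * (sr + 2) ^+ 2 by ring.
    rewrite ler_wpM2l ?sqr_ge0 //; nra.
  have : g ^+ 2 <= (b + a) ^+ 2 by rewrite ler_pXn2r ?nnegrE ?addr_ge0.
  have : q v * d ^+ 2 <= q v * d by rewrite ler_wpM2l // expr2; nra.
  have : d * C = q v * d * (2 * sr + 6) + d by rewrite /C; ring.
  nra.
(* Below e the zero vector does. Otherwise w = u n, rescaled by (sr + d)^(-1/2) to enter the unit
   ball, reaches at least (sr - d)^2 / (sr + d) > sr - 4 d. *)
have [se|es] := ltP sr e.
  exists 0; split; first exact: hD.1.
    by rewrite (semi_ip0l hD hB hD.1) /re /= ler01.
  have -> : f 0 = 0 by have := f_lin (-1) hD.1 hD.1; rewrite !scaleN1r !addNr.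
  by rewrite ip0l rn0 expr0n add0r.
set d := e / 4; have d0 : 0 < d by rewrite /d; lra.
have ed : e = 4 * d by rewrite /d; lra.
have [n [/qlim h1 h2 _]] := lim d d0; set w := u n in h1 h2.
have sd : 0 < sr + d by lra.
set a := (Num.sqrt (sr + d))^-1.
have a2 : a ^+ 2 = (sr + d)^-1 by rewrite exprVn sqr_sqrtr // ltW.
have Dw : D w by exact: hu.1.
have w0 : (a%:C *: w) = a%:C *: w + 0 by rewrite addr0.
exists (a%:C *: w); split; first exact: lin_closedZ.
  have -> : B (a%:C *: w) (a%:C *: w) = (a ^+ 2)%:C * B w w.
    have Daw : D (a%:C *: w) by exact: lin_closedZ.
    by rewrite (semi_ipZl hD hB) // (semi_ipZr hD hB) // conj_rc mulrA rcX expr2.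
  by rewrite ReZ a2 mulrC ler_pdivrMr // mul1r.
have fa : f (a%:C *: w) = a%:C *: f w.
  have f0 : f 0 = 0 by have := f_lin (-1) hD.1 hD.1; rewrite !scaleN1r !addNr.
  by rewrite w0 f_lin ?f0 ?addr0 //; exact: hD.1.
rewrite fa ipZl rnM exprMn rn_rc real_normK ?num_real // a2.
have h3 : sr - d <= rn (dotp (f w) zeta).
  have := rn_triangle (dotp (f w) zeta) s 0; rewrite !subr0 (rn_distrC s).
  have : rn s = sr by rewrite sE rn_rc ger0_norm.
  by move=> ->; lra.
rewrite mulrC -ltrBlDr ltr_pdivlMr //.
have : (sr - d) ^+ 2 <= rn (dotp (f w) zeta) ^+ 2.
  by rewrite ler_pXn2r ?nnegrE ?rn_ge0 //; lra.
have : 0 < d ^+ 2 by rewrite exprn_gt0.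
rewrite ed; nra.
Qed.
End QuadraticOperator.

(** * Adjoints, commutants and positive operators *)

Section Adjoints.
Variables (R : realType) (H : hilbertType R).
Implicit Types (x y : H -> H) (xi eta : H).

Definition is_adjoint x y : Prop := forall xi eta, dotp (y xi) eta = dotp xi (x eta).

Lemma is_adjoint_sym x y : is_adjoint x y -> is_adjoint y x.
Proof. by move=> h xi eta; rewrite ipC -h -ipC. Qed.

(** [representing_operator] with f1 = x and f2 = id on all of H, where f2 f1^* is the adjoint of
    x. *)
Lemma adjoint_ex x : bounded_op x -> exists2 y, bounded_op y & is_adjoint x y.
Proof.
move=> /bounded_opP[lx [k k0 hk]].
have hT : lin_closed (@setT H) by [].
have hd : semi_ip (@setT H) (fun u v => dotp u v).
  split=> [a u v z _ _ _|u v _ _|u _]; first by rewrite ipDl ipZl.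
  - exact: ipC.
  - by rewrite Re_ipxx sqr_ge0.
have K0 : 0 <= k ^+ 2 + 1 by rewrite addr_ge0 ?sqr_ge0.
have h1 u : setT u -> rn (x u) ^+ 2 <= (k ^+ 2 + 1) * re (dotp u u).
  move=> _; rewrite Re_ipxx (@le_trans _ _ ((k * rn u) ^+ 2)) //.
    by rewrite ler_pXn2r ?nnegrE ?mulr_ge0 ?rn_ge0 // ltW.
  by rewrite exprMn ler_wpM2r ?sqr_ge0 // lerDl.
have h2 (u : H) : setT u -> rn (id u) ^+ 2 <= (k ^+ 2 + 1) * re (dotp u u).
  by move=> _; rewrite Re_ipxx ler_peMl ?sqr_ge0 // lerDr sqr_ge0.
have lx' (a : R[i]) u v : setT u -> setT v -> x (a *: u + v) = a *: x u + x v by rewrite lx.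
have li (a : R[i]) (u v : H) : setT u -> setT v -> id (a *: u + v) = a *: id u + id v by [].
have [t bt ht] := representing_operator hT hd lx' li K0 h1 h2.
exists t => // xi eta; have [u [_ hu] lu] := ht xi.
rewrite [LHS]ipC [RHS]ipC; congr (Num.conj _).
apply: (seqlim_unique (seqlim_ipr eta lu)).
apply: (seqlim_of_inv (c := re (dotp eta eta))) => n.
exact: hu n eta I.
Qed.

Lemma adjP x : bounded_op x -> is_adjoint x (adj x).
Proof.
move=> /adjoint_ex[y _ hy]; rewrite /adj; case: xgetP => [z -> //|h].
by have := h y.
Qed.

Lemma adj_eq x y : is_adjoint x y -> adj x = y.
Proof.
move=> hy; rewrite /adj; case: xgetP => [z -> hz|/(_ y) //].
by apply/funext => xi; apply: ip_ext => eta; rewrite hz hy.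
Qed.

Lemma bounded_adj x : bounded_op x -> bounded_op (adj x).
Proof. by move=> /adjoint_ex[y hy /adj_eq ->]. Qed.

Lemma ip_adjl x : bounded_op x -> forall xi eta, dotp (adj x xi) eta = dotp xi (x eta).
Proof. exact: adjP. Qed.

Lemma ip_adjr x : bounded_op x -> forall xi eta, dotp (x xi) eta = dotp xi (adj x eta).
Proof. by move=> /adjP/is_adjoint_sym. Qed.

Lemma adjK x : bounded_op x -> adj (adj x) = x.
Proof. by move=> /adjP/is_adjoint_sym/adj_eq. Qed.

Lemma adj_comp x y : bounded_op x -> bounded_op y -> adj (x \o y) = adj y \o adj x.
Proof. by move=> hx hy; apply: adj_eq => xi eta /=; rewrite !ip_adjl. Qed.

Lemma adj_lin a x y : bounded_op x -> bounded_op y ->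
  adj (a *: x + y) = Num.conj a *: adj x + adj y.
Proof.
move=> hx hy; apply: adj_eq => xi eta.
by rewrite !fctE ipDl ipDr ipZl ipZr !ip_adjl.
Qed.

Lemma adj_id : adj (id : H -> H) = id.
Proof. exact: adj_eq. Qed.

(** Polarization at xi + eta and xi + i eta. Operators given only by their quadratic form, such as
    [theta], are unique for this reason. *)
Lemma op_ext x y : bounded_op x -> bounded_op y ->
  (forall xi, dotp (x xi) xi = dotp (y xi) xi) -> x = y.
Proof.
move=> hx hy h; apply/funext => xi; apply: ip_ext => eta.
have e1 := h (xi + eta); have e2 := h (xi + 'i%C *: eta).
move: e1 e2; rewrite !(opD hx) !(opD hy) !(opZ hx) !(opZ hy).
rewrite !ipDl !ipDr !ipZl !ipZr !h.
move: (dotp (x xi) eta) (dotp (x eta) xi) (dotp (y xi) eta) (dotp (y eta) xi).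
move: (dotp (y xi) xi) (dotp (y eta) eta) => p q a b c d.
have ci : Num.conj 'i%C = - 'i%C :> R[i] by apply/eqP; rewrite eq_complex /= oppr0 !eqxx.
have i0 : 'i%C != 0 :> R[i] by rewrite eq_complex /= oner_eq0 andbF.
rewrite ci => e1 e2.
have f1 : a + b = c + d.
  apply: (addrI (p + q)).
  have -> : p + q + (a + b) = p + a + (b + q) by ring.
  by rewrite e1; ring.
have f2 : b - a = d - c.
  apply: (mulfI i0); apply: (addrI (p - 'i%C * 'i%C * q)).
  have -> : p - 'i%C * 'i%C * q + 'i%C * (b - a) =
      p + - 'i%C * a + ('i%C * b + 'i%C * (- 'i%C * q)) by ring.
  by rewrite e2; ring.
have : (a + b) - (b - a) = (c + d) - (d - c) by rewrite f1 f2.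
have -> : (a + b) - (b - a) = 2 * a by ring.
have -> : (c + d) - (d - c) = 2 * c by ring.
by apply: mulfI; rewrite pnatr_eq0.
Qed.
End Adjoints.

Definition star_closed (R : realType) (H : hilbertType R) (P : set (H -> H)) : Prop :=
  forall y, P y -> bounded_op y /\ P (adj y).

Section Commutants.
Variables (R : realType) (H : hilbertType R) (P : set (H -> H)).
Hypothesis hP : star_closed P.
Implicit Types (x y : H -> H).

Lemma commutant_lin : lin_closed (commutant P).
Proof.
split=> [|a x y [hx cx] [hy cy]]; split.
- exact: bounded0.
- by move=> y /hP[hy _]; apply/funext => xi; rewrite /= -[LHS]/(0 : H) -[RHS]/(y 0) (op0 hy).
- exact: bounded_lin.
- move=> z Pz; have [hz _] := hP Pz; apply/funext => xi; rewrite /= !fctE.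
  have /= ex := f_equal (@^~ xi) (cx z Pz); have /= ey := f_equal (@^~ xi) (cy z Pz).
  by rewrite (opD hz) (opZ hz) ex ey.
Qed.

Lemma commutant_comp x y : commutant P x -> commutant P y -> commutant P (x \o y).
Proof.
move=> [hx cx] [hy cy]; split; first exact: bounded_comp.
by move=> z Pz; rewrite -compA cy // compA cx // compA.
Qed.

Lemma commutant_id : commutant P id.
Proof. by split; [exact: bounded_id|]. Qed.

Lemma commutant_adj x : commutant P x -> commutant P (adj x).
Proof.
move=> [hx cx]; split; first exact: bounded_adj.
move=> z Pz; have [hz Pz'] := hP Pz.
have /= e eta := f_equal (@^~ eta) (cx _ Pz').
apply/funext => xi; apply: ip_ext => eta /=.
by rewrite (ip_adjl hx) (ip_adjr hz) -e -(ip_adjl hx) -(ip_adjr hz).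
Qed.

Lemma commutant_star : star_closed (commutant P).
Proof. by move=> x hx; split; [case: hx|exact: commutant_adj]. Qed.

Lemma commutant_double : P `<=` commutant (commutant P).
Proof.
move=> x Px; split; first by case: (hP Px).
by move=> y [_ cy]; rewrite cy.
Qed.
End Commutants.

Lemma commutant_sub (R : realType) (H : hilbertType R) (P Q : set (H -> H)) :
  P `<=` Q -> commutant Q `<=` commutant P.
Proof. by move=> PQ x [hx cx]; split=> // y /PQ; exact: cx. Qed.

Lemma commutant_triple (R : realType) (H : hilbertType R) (P : set (H -> H)) :
  star_closed P -> commutant (commutant (commutant P)) = commutant P.
Proof.
move=> hP; apply/seteqP; split.
  exact/commutant_sub/commutant_double.
exact: (commutant_double (commutant_star hP)).
Qed.

Section PositiveOperators.
Variables (R : realType) (H : hilbertType R).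
Implicit Types (x y : H -> H) (xi eta : H).

Lemma op_le0P x : op_le 0 x <-> forall xi, 0 <= dotp (x xi) xi.
Proof.
by split=> h xi; have := h xi; rewrite [(0 : H -> H) xi]/(0 : H) subr0.
Qed.

Lemma op_leP x y : op_le x y <-> forall xi, 0 <= dotp (y xi) xi - dotp (x xi) xi.
Proof. by split=> h xi; have := h xi; rewrite ipBl. Qed.

Lemma pos_dotpE x : op_le 0 x -> forall xi, dotp (x xi) xi = (re (dotp (x xi) xi))%:C.
Proof. by move=> /op_le0P h xi; exact: ge0_rc. Qed.

Lemma op_le_re x y : op_le x y -> forall xi, re (dotp (x xi) xi) <= re (dotp (y xi) xi).
Proof. by move=> /op_leP h xi; have := ge0_Re (h xi); rewrite ReB subr_ge0. Qed.

Lemma op_le_of_re x y : op_le 0 x -> op_le 0 y ->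
  (forall xi, re (dotp (x xi) xi) <= re (dotp (y xi) xi)) -> op_le x y.
Proof.
move=> hx hy h; apply/op_leP => xi; rewrite (pos_dotpE hx) (pos_dotpE hy) -rcB ler0c.
by rewrite subr_ge0.
Qed.

Lemma op_le_trans y x z : op_le x y -> op_le y z -> op_le x z.
Proof.
move=> /op_leP h1 /op_leP h2; apply/op_leP => xi.
by rewrite -(subrKA (dotp (y xi) xi)) addr_ge0.
Qed.

Lemma op_le_sub0 x y : op_le x y <-> op_le 0 (y - x).
Proof.
split=> [/op_leP h|/op_le0P h]; [apply/op_le0P|apply/op_leP] => xi.
  by rewrite !fctE ipBl.
by have := h xi; rewrite !fctE ipBl.
Qed.

Lemma adj_self_pos x : bounded_op x -> op_le 0 (adj x \o x).
Proof.
by move=> hx; apply/op_le0P => xi /=; rewrite ip_adjl // ipxx ler0c sqr_ge0.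
Qed.

Lemma dotp_adj_self x xi : bounded_op x -> dotp ((adj x \o x) xi) xi = (rn (x xi) ^+ 2)%:C.
Proof. by move=> hx; rewrite /= ip_adjl // ipxx. Qed.

Lemma pos_semi_ip x : bounded_op x -> op_le 0 x ->
  semi_ip (@setT H) (fun xi eta => dotp (x xi) eta).
Proof.
move=> hx px; split=> [a u v z _ _ _|u v _ _|u _].
- by rewrite (opP hx) ipDl ipZl.
- rewrite -ipC.
  suff e : x = adj x by rewrite {1}e ip_adjl.
  apply: op_ext => //; first exact: bounded_adj.
  move=> xi; rewrite ip_adjl // [RHS]ipC (pos_dotpE px) /=.
  by rewrite conjCE conjc_real.
- by have := ge0_Re ((op_le0P x).1 px u).
Qed.

Lemma pos_CS x xi eta : bounded_op x -> op_le 0 x ->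
  rn (dotp (x xi) eta) ^+ 2 <= re (dotp (x xi) xi) * re (dotp (x eta) eta).
Proof.
by move=> hx px; exact: (semi_ip_CS (D := setT) _ (pos_semi_ip hx px)).
Qed.

Lemma pos_ker x xi : bounded_op x -> op_le 0 x -> dotp (x xi) xi = 0 -> x xi = 0.
Proof.
move=> hx px h; have := pos_CS xi (x xi) hx px; rewrite h mul0r ipxx.
rewrite rn_rc => h2; apply: rn0_eq0; apply/eqP.
rewrite -sqrf_eq0 -normr_eq0 -sqrf_eq0 eq_le sqr_ge0 andbT.
exact: h2.
Qed.

Lemma bounded_le_scalar x : bounded_op x -> exists2 k : R, 0 < k &
  forall xi, re (dotp (x xi) xi) <= k * rn xi ^+ 2.
Proof.
move=> /bounded_opP[_ [k k0 hk]]; exists k => // xi.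
rewrite (le_trans (Re_le_rn' _)) // (le_trans (ip_CS _ _)) //.
by rewrite expr2 mulrA ler_wpM2r ?rn_ge0.
Qed.

(** This is a^2 <= k a for 0 <= a <= x <= k, without square roots: Cauchy-Schwarz for the form of a
    at xi and a xi gives |a xi|^4 <= <a xi, xi> k |a xi|^2. *)
Lemma pos_le_sqr a x k : 0 <= k -> bounded_op a -> op_le 0 a ->
  (forall xi, re (dotp (a xi) xi) <= re (dotp (x xi) xi)) ->
  (forall xi, re (dotp (x xi) xi) <= k * rn xi ^+ 2) ->
  forall xi, rn (a xi) ^+ 2 <= k * re (dotp (a xi) xi).
Proof.
move=> k0 ba pa ax xk xi; have := pos_CS xi (a xi) ba pa.
rewrite ipxx rn_rc ger0_norm ?sqr_ge0 // => h.
have h2 := le_trans (ax (a xi)) (xk (a xi)).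
have q0 := ge0_Re ((op_le0P a).1 pa xi).
have [->|r0] := eqVneq (rn (a xi) ^+ 2) 0.
  by rewrite mulr_ge0.
have rp : 0 < rn (a xi) ^+ 2 by rewrite lt0r r0 sqr_ge0.
rewrite -(ler_pM2r rp) -expr2 (le_trans h) // [leRHS]mulrAC mulrC.
by rewrite ler_wpM2r.
Qed.
End PositiveOperators.

(** * Directed suprema, conjugation sums and normal functionals *)

Section DirectedSuprema.
Variables (R : realType) (H : hilbertType R) (D : set (H -> H)) (x : H -> H).
Hypotheses (D_pos : forall y, D y -> bounded_op y /\ op_le 0 y)
  (D_dir : directed D) (x_lub : op_lub D x).

(* A bounded directed set of positive operators converges strongly, and its
   limit is an upper bound. *)
Lemma lub_approx xi (e : R) : 0 < e ->
  exists2 y, D y & re (dotp (x xi) xi) < re (dotp (y xi) xi) + e.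
Proof.
move=> e0; have [bx x_ub x_min] := x_lub; have [D0 D2] := D_dir.
have [k k0 xk] := bounded_le_scalar bx.
have k0' := ltW k0.
(* [pos_le_sqr] applied to 0 <= z - y <= x <= k: convergence of the quadratic forms controls the
   vectors. *)
have diff y z : D y -> D z -> op_le y z -> forall eta,
    rn (z eta - y eta) ^+ 2 <= k * (re (dotp (z eta) eta) - re (dotp (y eta) eta)).
  move=> Dy Dz yz eta; have [by_ py] := D_pos Dy; have [bz _] := D_pos Dz.
  have bzy : bounded_op (z - y).
    by rewrite addrC -scaleN1r; exact: bounded_lin.
  have /op_le_sub0 pzy := yz.
  have zyx u : re (dotp ((z - y) u) u) <= re (dotp (x u) u).
    rewrite !fctE ipBl ReB; have := op_le_re (x_ub _ Dz) u.
    have := op_le_re py u; rewrite [(0 : H -> H) u]/(0 : H) ip0l /re /=; lra.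
  by have := pos_le_sqr k0' bzy pzy zyx xk eta; rewrite !fctE ipBl ReB.
have dsmall eta (d : R) : 0 < d -> exists2 y, D y & forall z, D z -> op_le y z ->
    rn (z eta - y eta) < d.
  move=> d0; pose S := [set re (dotp (y eta) eta) | y in D].
  have hS : has_sup S.
    split; first by have [y Dy] := D0; exists (re (dotp (y eta) eta)), y.
    exists (k * rn eta ^+ 2) => _ [y Dy <-].
    by rewrite (le_trans (op_le_re (x_ub _ Dy) eta)).
  have d2 : 0 < d ^+ 2 / k by rewrite divr_gt0 ?exprn_gt0.
  have [_ [y Dy <-] hy] := sup_adherent d2 hS; exists y => // z Dz yz.
  rewrite -(@ltr_pXn2r _ 2) ?nnegrE ?rn_ge0 ?(ltW d0) //.
  rewrite (le_lt_trans (diff _ _ Dy Dz yz eta)) // mulrC -ltr_pdivlMr //.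
  have : re (dotp (z eta) eta) <= sup S.
    by apply: ub_le_sup; [exact: hS.2|exists z].
  by move: hy; move: (d ^+ 2 / k) (sup S) => ? ?; lra.
(* [D] need not have a cofinal sequence. For each vector, take elements beyond which the values vary
   by less than 1/(n+1); their values form a Cauchy sequence, as common upper bounds show. *)
have /choice[t ht] : forall eta, exists l, forall d : R, 0 < d ->
    exists2 y, D y & forall z, D z -> op_le y z -> rn (z eta - l) < d.
  move=> eta.
  have inv0 (n : nat) : 0 < n.+1%:R^-1 :> R by rewrite invr_gt0 ltr0Sn.
  have /choice[y hy] : forall n : nat, exists y, D y /\
      forall z, D z -> op_le y z -> rn (z eta - y eta) < n.+1%:R^-1.
    by move=> n; have [y Dy hy] := dsmall eta _ (inv0 n); exists y.
  have [l hl] : exists l, seqlim (fun n => y n eta) l.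
    apply: hilbert_complete => d d0; have d2 : 0 < d / 2 by lra.
    have [N hN] := inv_lt_eps 1 d2; exists N => m n hm hn.
    have [z [Dz ymz ynz]] := D2 _ _ (hy m).1 (hy n).1.
    have := (hy m).2 z Dz ymz; have := (hy n).2 z Dz ynz.
    have := hN m hm; have := hN n hn; rewrite !mul1r.
    have := rn_triangle (z eta) (y m eta) (y n eta); rewrite (rn_distrC (y m eta) (z eta)).
    by move: (n.+1%:R^-1) (m.+1%:R^-1) => ? ?; lra.
  exists l => d d0; have d2 : 0 < d / 2 by lra.
  have [N1 h1] := inv_lt_eps 1 d2; have [N2 h2] := hl _ d2.
  pose n := maxn N1 N2; exists (y n); first exact: (hy n).1.
  move=> z Dz yz; have := (hy n).2 z Dz yz.
  have := h1 n (leq_maxl _ _); have := h2 n (leq_maxr _ _); rewrite mul1r.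
  have := rn_triangle (y n eta) (z eta) l.
  by move: (n.+1%:R^-1) => ?; lra.
have common (d : R) u v : 0 < d -> D u -> exists z, [/\ D z, op_le u z,
    rn (z v - t v) < d & forall w, D w -> op_le z w -> rn (w v - t v) < d].
  move=> d0 Du; have [y Dy hy] := ht v d d0.
  have [z [Dz uz yz]] := D2 _ _ Du Dy; exists z; split=> //; first exact: hy.
  by move=> w Dw zw; apply: hy => //; exact: op_le_trans zw.
have bt : bounded_op t.
  apply/bounded_opP; split=> [a u v|].
    apply/eqP; rewrite -subr_eq0; apply/eqP/rn_le0/ler_addgt0Pr => d d0.
    rewrite add0r; have [y0 Dy0] := D0.
    have a0 : 0 < rn a + 2 by have := rn_ge0 a; lra.
    have d1 : 0 < d / (rn a + 2) by rewrite divr_gt0.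
    have [z1 [Dz1 _ _ h1]] := common _ _ u d1 Dy0.
    have [z2 [Dz2 z12 _ h2]] := common _ _ v d1 Dz1.
    have [z3 [Dz3 z23 h3 _]] := common _ _ (a *: u + v) d1 Dz2.
    have {}h1 := h1 _ Dz3 (op_le_trans z12 z23).
    have {}h2 := h2 _ Dz3 z23.
    have [bz _] := D_pos Dz3; rewrite (opP bz) in h3.
    have -> : t (a *: u + v) - (a *: t u + t v) =
       - (a *: z3 u + z3 v - t (a *: u + v)) + (a *: (z3 u - t u) + (z3 v - t v)).
      by rewrite scalerBr opprB (addrACA (a *: z3 u)) -opprD addrA subrK.
    rewrite (le_trans (rnD _ _)) // rnN.
    have := rnD (a *: (z3 u - t u)) (z3 v - t v); rewrite rnZ.
    have : rn a * rn (z3 u - t u) <= rn a * (d / (rn a + 2)).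
      by rewrite ler_wpM2l ?rn_ge0 // ltW.
    have : d = rn a * (d / (rn a + 2)) + 2 * (d / (rn a + 2)) by field; lra.
    lra.
  exists (k + 1) => [|u]; first by lra.
  have zk z : D z -> rn (z u) <= k * rn u.
    move=> Dz; have [bz pz] := D_pos Dz.
    have h1 := pos_le_sqr k0' bz pz (op_le_re (x_ub _ Dz)) xk u.
    rewrite -(@ler_pXn2r _ 2) ?nnegrE ?rn_ge0 ?mulr_ge0 ?rn_ge0 //.
    rewrite (le_trans h1) // exprMn expr2 -mulrA ler_wpM2l //.
    by rewrite (le_trans (op_le_re (x_ub _ Dz) u)).
  apply/ler_addgt0Pr => d d0; have [y0 Dy0] := D0.
  have [z [Dz _ h _]] := common _ _ u d0 Dy0.
  have := rn_triangle (z u) (t u) 0; rewrite !subr0 (rn_distrC (t u) (z u)).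
  have := zk z Dz; have := rn_ge0 u; lra.
have pt y : D y -> op_le y t.
  move=> Dy; apply/op_leP => u; apply: ge0_closed => d d0.
  have u0 : 0 < rn u + 1 by have := rn_ge0 u; lra.
  have [z [Dz yz h _]] := common _ _ u (divr_gt0 d0 u0) Dy.
  exists (dotp (z u) u - dotp (y u) u); first exact: (op_leP _ _).1 yz u.
  have -> : dotp (z u) u - dotp (y u) u - (dotp (t u) u - dotp (y u) u) =
    dotp (z u - t u) u by rewrite ipBl; ring.
  rewrite (le_lt_trans (ip_CS _ _)) //.
  move: h; rewrite ltr_pdivlMr // => h; have := rn_ge0 (z u - t u); lra.
(* The strong limit [t] is an upper bound, so the least one lies below it, and elements of [D] close
   to [t] at xi almost reach [x]. *)
have xt : op_le x t by exact: x_min.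
have [y0 Dy0] := D0.
have u0 : 0 < rn xi + 1 by have := rn_ge0 xi; lra.
have [z [Dz _ h _]] := common _ _ xi (divr_gt0 e0 u0) Dy0.
exists z => //; rewrite (le_lt_trans (op_le_re xt xi)) //.
have : re (dotp (t xi) xi) - re (dotp (z xi) xi) <= rn (z xi - t xi) * rn xi.
  rewrite -ReB -ipBl (le_trans (Re_le_rn' _)) // (le_trans (ip_CS _ _)) //.
  by rewrite rn_distrC.
move: h; rewrite ltr_pdivlMr // => h; have := rn_ge0 (z xi - t xi); lra.
Qed.

Lemma lub_approx_seq (s : seq H) (e : R) : 0 < e -> exists2 y, D y &
  forall xi, xi \in s -> re (dotp (x xi) xi) < re (dotp (y xi) xi) + e.
Proof.
move=> e0; elim: s => [|xi s [y Dy hy]].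
  by have [[y Dy] _] := D_dir; exists y.
have [z Dz hz] := lub_approx xi e0.
have [w [Dw yw zw]] := D_dir.2 _ _ Dy Dz.
exists w => // eta; rewrite inE => /orP[/eqP ->|/hy h].
  by rewrite (lt_le_trans hz) // lerD2r op_le_re.
by rewrite (lt_le_trans h) // lerD2r op_le_re.
Qed.

Lemma lub_ge xi y : D y -> re (dotp (y xi) xi) <= re (dotp (x xi) xi).
Proof. by case: x_lub => _ h _ /h /op_le_re; exact. Qed.
End DirectedSuprema.

Lemma ereal_sup_approx (R : realType) (T : Type) (D : set T) (f : T -> R) (c : R) :
  (forall y, D y -> f y <= c) ->
  (forall e : R, 0 < e -> exists2 y, D y & c < f y + e) ->
  ereal_sup [set (f y)%:E | y in D] = c%:E.
Proof.
move=> h1 h2; apply/eqP; rewrite eq_le; apply/andP; split.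
  by apply: ge_ereal_sup => _ [y Dy <-]; rewrite lee_fin h1.
apply/lee_addgt0Pr => e /h2[y Dy hy].
apply: (@le_trans _ _ ((f y)%:E + e%:E)%E).
  by rewrite -EFinD lee_fin ltW.
by rewrite leeD2r //; apply: ereal_sup_ubound; exists y.
Qed.

Section ConjugationSums.
Variables (R : realType) (H : hilbertType R) (I : finType).
Implicit Types (b : I -> H -> H) (x y : H -> H) (xi : H).

(** The common shape of the expectation and of its inverse: positivity and normality are proved once
    for both. *)
Definition conj_sum b x : H -> H := \sum_i (b i \o x \o adj (b i)).

Variable b : I -> H -> H.
Hypothesis hb : forall i, bounded_op (b i).

Lemma conj_sumE x xi : conj_sum b x xi = \sum_i b i (x (adj (b i) xi)).
Proof. by rewrite /conj_sum fct_sumE. Qed.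

Lemma conj_sum_form x xi eta : dotp (conj_sum b x xi) eta =
  \sum_i dotp (x (adj (b i) xi)) (adj (b i) eta).
Proof.
by rewrite conj_sumE ip_suml; apply: eq_bigr => i _; rewrite (ip_adjr (hb i)).
Qed.

Lemma bounded_conj_sum x : bounded_op x -> bounded_op (conj_sum b x).
Proof.
move=> hx; apply: bounded_sum => i; apply: bounded_comp; last exact: bounded_adj.
exact: bounded_comp.
Qed.

Lemma conj_sum_lin a x y : conj_sum b (a *: x + y) = a *: conj_sum b x + conj_sum b y.
Proof.
apply/funext => xi; rewrite !fctE !conj_sumE scaler_sumr -big_split /=.
by apply: eq_bigr => i _; rewrite (opP (hb i)).
Qed.

Lemma conj_sum_pos x : op_le 0 x -> op_le 0 (conj_sum b x).
Proof.
move=> /op_le0P px; apply/op_le0P => xi; rewrite conj_sum_form.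
by apply: sumr_ge0.
Qed.

Lemma conj_sum_le x y : op_le x y -> op_le (conj_sum b x) (conj_sum b y).
Proof.
move=> /op_leP xy; apply/op_leP => xi; rewrite !conj_sum_form -sumrB.
by apply: sumr_ge0.
Qed.

Lemma conj_sum_adj x : bounded_op x -> adj (conj_sum b x) = conj_sum b (adj x).
Proof.
move=> hx; apply: adj_eq => xi eta; rewrite conj_sum_form.
rewrite [RHS]ipC conj_sum_form rmorph_sum /=; apply: eq_bigr => i _.
by rewrite -ipC (ip_adjl hx).
Qed.

Lemma conj_sum_directed (D : set (H -> H)) : directed D -> directed (conj_sum b @` D).
Proof.
move=> [[y Dy] h]; split; first by exists (conj_sum b y), y.
move=> _ _ [u Du <-] [v Dv <-]; have [z [Dz uz vz]] := h _ _ Du Dv.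
by exists (conj_sum b z); split; [exists z|exact: conj_sum_le|exact: conj_sum_le].
Qed.

Lemma conj_sum_lub (D : set (H -> H)) x :
  (forall y, D y -> bounded_op y /\ op_le 0 y) -> directed D -> op_lub D x ->
  op_lub (conj_sum b @` D) (conj_sum b x).
Proof.
move=> hD dD lx; have [bx ux _] := lx; split.
- exact: bounded_conj_sum.
- by move=> _ [y Dy <-]; apply: conj_sum_le; exact: ux.
have [[y0 Dy0] _] := dD; have [_ p0] := hD _ Dy0.
have px : op_le 0 x by apply: op_le_trans p0 (ux _ Dy0).
move=> z bz hz; apply: op_le_of_re; first exact: conj_sum_pos.
  by apply: op_le_trans (hz _ (imageP _ Dy0)); exact: conj_sum_pos.
move=> xi; apply/ler_addgt0Pr => e e0.
have [c c0 hc] : exists2 c : R, 0 < c & \sum_(i : I) c <= e.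
  (* The successor avoids a division by zero when [I] is empty. *)
  exists (e / (#|I|.+1)%:R); first by rewrite divr_gt0 ?ltr0Sn.
  rewrite big_const iter_addr_0 -(mulr_natr (e / _)) mulrAC ler_pdivrMr ?ltr0Sn //.
  by apply: ler_wpM2l; [exact: ltW|rewrite ler_nat; exact: leqnSn].
have [y Dy hy] := lub_approx_seq hD dD lx [seq adj (b i) xi | i <- enum I] c0.
apply: (@le_trans _ _ (re (dotp (conj_sum b y xi) xi) + e)).
  rewrite !conj_sum_form !Re_sum (le_trans _ (lerD (lexx _) hc)) // -big_split /=.
  by apply: ler_sum => i _; apply/ltW/hy/mapP; exists i; rewrite ?mem_enum.
by rewrite lerD2r; apply: op_le_re; apply: hz; exists y.
Qed.
End ConjugationSums.

Section NormalFunctionals.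
Variables (R : realType) (H : hilbertType R) (P : set (H -> H)).
Hypothesis bP : forall x, P x -> bounded_op x.

Definition vector_functional (xi : H) (x : H -> H) : R[i] := dotp (x xi) xi.

Lemma vector_functional_normal xi : normal_functional P (vector_functional xi).
Proof.
split=> [a x y _ _|x [_ px]|D x DP dD _ lx].
- by rewrite /vector_functional !fctE ipDl ipZl.
- exact: (op_le0P x).1.
have hD y : D y -> bounded_op y /\ op_le 0 y by move=> /DP[/bP].
apply/esym; apply: (@ereal_sup_approx _ _ _ (fun y => re (dotp (y xi) xi))) => [y Dy|e e0].
  exact: (lub_ge lx).
exact: (lub_approx hD dD lx).
Qed.

(** Covers the test functional of the minimality argument, whose large constant is absorbed into the
    second vector. *)
Lemma vector_functional2_normal xi eta :
  normal_functional P (fun x => vector_functional xi x + vector_functional eta x).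
Proof.
split=> [a x y Px Py|x [_ px]|D x DP dD _ lx].
- by rewrite /vector_functional !fctE !ipDl !ipZl; ring.
- by rewrite addr_ge0 //; exact: (op_le0P x).1.
have hD y : D y -> bounded_op y /\ op_le 0 y by move=> /DP[/bP].
apply/esym.
apply: (@ereal_sup_approx _ _ _ (fun y => re (dotp (y xi) xi + dotp (y eta) eta))).
  by move=> y Dy; rewrite [leRHS]ReD ReD lerD // (lub_ge lx).
move=> e e0; have e2 : 0 < e / 2 by lra.
have [y Dy hy] := lub_approx_seq hD dD lx [:: xi; eta] e2.
exists y => //; have := hy xi; have := hy eta; rewrite !inE !eqxx orbT.
by move=> /(_ isT) h1 /(_ isT) h2; rewrite [ltLHS]ReD ReD /vector_functional; lra.
Qed.
End NormalFunctionals.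

(** * Weights and bounded vectors *)

Definition star_algebra (R : realType) (H : hilbertType R) (P : set (H -> H)) : Prop :=
  [/\ lin_closed P, star_closed P, forall x y, P x -> P y -> P (x \o y) & P id].

Lemma commutant_star_algebra (R : realType) (H : hilbertType R) (P : set (H -> H)) :
  star_closed P -> star_algebra (commutant P).
Proof.
move=> hP; split; [exact: commutant_lin|exact: commutant_star|exact: commutant_comp|].
exact: commutant_id.
Qed.

(** The weights met here, psi and psi o T, are finite on every positive element, which allows
    computing with real values. *)
Definition finite_weight (R : realType) (H : hilbertType R) (P : set (H -> H))
    (w : (H -> H) -> \bar R) : Prop :=
  (forall x, positive_part P x -> exists2 r : R, 0 <= r & w x = r%:E) /\
  forall (r : R) x y, 0 <= r -> positive_part P x -> positive_part P y ->
    w (r%:C *: x + y) = (r%:E * w x + w y)%E.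

(** R(xi) R(xi)^* with its supremum unfolded into a bound and an approximation, the form that can be
    transported from M' to N'. *)
Definition theta_spec (R : realType) (H : hilbertType R) (P : set (H -> H))
    (w : (H -> H) -> \bar R) (xi : H) (t : H -> H) : Prop :=
  bounded_op t /\ forall zeta,
  [/\ 0 <= dotp (t zeta) zeta,
      forall v, P v -> rn (dotp (v xi) zeta) ^+ 2 <=
        fine (w (adj v \o v)) * re (dotp (t zeta) zeta) &
      forall e : R, 0 < e -> exists2 v, P v /\ (w (adj v \o v) <= 1%:E)%E &
        re (dotp (t zeta) zeta) < rn (dotp (v xi) zeta) ^+ 2 + e].

Section Theta.
Variables (R : realType) (H : hilbertType R) (P : set (H -> H)).
Variable w : (H -> H) -> \bar R.

Hypotheses (hP : star_algebra P) (hw : finite_weight P w).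
Let W x := fine (w x).

Lemma sq_pos y : P y -> positive_part P (adj y \o y).
Proof.
have [_ st cm _] := hP => Py; have [by_ Py'] := st _ Py.
by split; [exact: cm|exact: adj_self_pos].
Qed.

Lemma wE x : positive_part P x -> w x = (W x)%:E.
Proof. by move=> /(hw.1)[r _ e]; rewrite /W e. Qed.

Lemma theta_specE xi t : theta_spec P w xi t -> theta P w xi = t.
Proof.
move=> [bt ht].
have ReE_sqr (z : R[i]) : Defs.ReE (`|z| ^+ 2) = (rn z ^+ 2)%:E by rewrite /Defs.ReE norm_rn -rcX.
have sup zeta : Defs.ReE (dotp (t zeta) zeta) =
    ereal_sup [set Defs.ReE (`|dotp (y xi) zeta| ^+ 2) | y in
      [set y | P y /\ (w (adj y \o y) <= 1%:E)%E]].
  have [_ h1 h2] := ht zeta.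
  under eq_imagel do rewrite ReE_sqr.
  apply/esym; apply: (ereal_sup_approx (f := fun y => rn (dotp (y xi) zeta) ^+ 2)).
    move=> y [Py wy]; rewrite (le_trans (h1 y Py)) // ler_piMl //.
      by have [h _ _] := ht zeta; exact: ge0_Re.
    by move: wy; rewrite wE ?lee_fin //; exact: sq_pos.
  by move=> e /h2[v]; exists v.
rewrite /theta; case: xgetP => [t' -> [bt' ht']|/(_ t) []]; last first.
  by split=> // zeta; have [h _ _] := ht zeta.
apply: op_ext => // zeta; have [p' s'] := ht' zeta; have [p _ _] := ht zeta.
rewrite (ge0_rc p') (ge0_rc p); congr (_%:C).
by have := sup zeta; rewrite -s' => -[].
Qed.

Lemma W_ge0 x : positive_part P x -> 0 <= W x.
Proof. by move=> /(hw.1)[r r0 e]; rewrite /W e. Qed.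

Lemma W_lin (r : R) x y : 0 <= r -> positive_part P x -> positive_part P y ->
  W (r%:C *: x + y) = r * W x + W y.
Proof. by move=> r0 px py; rewrite /W hw.2 // !wE. Qed.

Lemma pos0 : positive_part P 0.
Proof.
have [ln _ _ _] := hP; split; first exact: ln.1.
by apply/op_le0P => xi; rewrite [(0 : H -> H) xi]/(0 : H) ip0l.
Qed.

Lemma W0 : W 0 = 0.
Proof.
have := W_lin ler01 pos0 pos0.
by rewrite scaler0 addr0 mul1r => /(f_equal (fun z => z - W 0)); rewrite subrr addrK.
Qed.

Definition sq_sum (l : seq (R * (H -> H))) : H -> H :=
  \sum_(p <- l) p.1%:C *: (adj p.2 \o p.2).

Definition sq_list (l : seq (R * (H -> H))) : Prop :=
  forall p, p \in l -> 0 <= p.1 /\ P p.2.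

Lemma sq_sum_pos l : sq_list l -> positive_part P (sq_sum l).
Proof.
have [ln _ _ _] := hP.
rewrite /sq_sum; elim: l => [|p l IH] hl; first by rewrite big_nil; exact: pos0.
have [r0 Pp] : 0 <= p.1 /\ P p.2 by apply: hl; rewrite inE eqxx.
have [IH1 /op_le0P IH2] : positive_part P (\sum_(q <- l) q.1%:C *: (adj q.2 \o q.2)).
  by apply: IH => q ql; apply: hl; rewrite inE ql orbT.
have [h1 /op_le0P h2] := sq_pos Pp.
rewrite big_cons; split; first exact: ln.2.
apply/op_le0P => xi; rewrite !fctE ipDl ipZl addr_ge0 // mulr_ge0 ?ler0c //.
exact: h2.
Qed.

Lemma W_sq_sum l : sq_list l ->
  W (sq_sum l) = \sum_(p <- l) p.1 * W (adj p.2 \o p.2).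
Proof.
elim: l => [|p l IH] hl; first by rewrite /sq_sum !big_nil W0.
have [r0 Pp] : 0 <= p.1 /\ P p.2 by apply: hl; rewrite inE eqxx.
have hl' : sq_list l by move=> q ql; apply: hl; rewrite inE ql orbT.
by rewrite /sq_sum !big_cons W_lin ?IH //; [exact: sq_pos|exact: sq_sum_pos].
Qed.

(** A weight is additive only on positive elements. An identity between its values is therefore
    written with nonnegative coefficients on both sides, and then follows from the same identity
    between squared norms at each vector. *)
Lemma W_sq_sum_eq l1 l2 : sq_list l1 -> sq_list l2 ->
  (forall xi : H, \sum_(p <- l1) p.1 * rn (p.2 xi) ^+ 2 =
              \sum_(p <- l2) p.1 * rn (p.2 xi) ^+ 2) ->
  \sum_(p <- l1) p.1 * W (adj p.2 \o p.2) = \sum_(p <- l2) p.1 * W (adj p.2 \o p.2).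
Proof.
move=> h1 h2 e; rewrite -!W_sq_sum //; congr W.
have [_ st _ _] := hP.
have form l xi : sq_list l ->
    dotp (sq_sum l xi) xi = (\sum_(p <- l) p.1 * rn (p.2 xi) ^+ 2)%:C.
  move=> hl; rewrite /sq_sum fct_sumE ip_suml rmorph_sum /=.
  rewrite big_seq [RHS]big_seq; apply: eq_bigr => p /hl[_ /st[bp _]].
  by rewrite !fctE ipZl dotp_adj_self // -rcM.
apply: op_ext => [||xi]; last by rewrite !form // e.
- by have [/st[]] := sq_sum_pos h1.
- by have [/st[]] := sq_sum_pos h2.
Qed.

(** The real part of w(y^* x), obtained by polarization because w is given on positive elements
    only; [Bw] adds the imaginary part. *)
Definition bw (x y : H -> H) : R :=
  (W (adj (x + y) \o (x + y)) - W (adj (x - y) \o (x - y))) / 4.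
Definition Bw (x y : H -> H) : R[i] := bw x y +i* bw x ('i%C *: y).

Let ln := let: And4 h _ _ _ := hP in h.

Lemma sq_list_cons p l : 0 <= p.1 -> P p.2 -> sq_list l -> sq_list (p :: l).
Proof. by move=> h1 h2 h q; rewrite inE => /orP[/eqP ->|/h]. Qed.

Lemma bw_sym x y : P x -> P y -> bw x y = bw y x.
Proof.
move=> Px Py; rewrite /bw [y + x]addrC; congr ((_ - _) / 4).
have := @W_sq_sum_eq [:: (1, x - y)] [:: (1, y - x)]; rewrite !big_cons !big_nil !addr0 !mul1r.
apply=> [||xi]; do ?by apply: sq_list_cons => //=; exact: lin_closedB.
by rewrite !big_cons !big_nil !addr0 !mul1r /= !fctE rn_distrC.
Qed.

Lemma bwD x x' y : P x -> P x' -> P y -> bw (x + x') y = bw x y + bw x' y.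
Proof.
move=> Px Px' Py.
have D := lin_closedD ln; have B := lin_closedB ln.
have := @W_sq_sum_eq [:: (1, x + x' + y); (1, x - y); (1, x' - y)]
  [:: (1, x + x' - y); (1, x + y); (1, x' + y)].
rewrite !big_cons !big_nil !addr0 !mul1r => h.
suff : W (adj (x + x' + y) \o (x + x' + y)) +
    (W (adj (x - y) \o (x - y)) + W (adj (x' - y) \o (x' - y))) =
  W (adj (x + x' - y) \o (x + x' - y)) +
    (W (adj (x + y) \o (x + y)) + W (adj (x' + y) \o (x' + y))).
  by rewrite /bw; lra.
apply: h => [||xi].
- by do 3?[apply: sq_list_cons => //=]; auto.
- by do 3?[apply: sq_list_cons => //=]; auto.
rewrite !big_cons !big_nil !addr0 !mul1r /= !fctE.
by rewrite !(rn2B, rn2D) !ipDl !ReD; lra.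
Qed.

Lemma bwZ (r : R) x y : P x -> P y -> bw (r%:C *: x) y = r * bw x y.
Proof.
move=> Px Py.
have D := lin_closedD ln; have B := lin_closedB ln; have Z a := lin_closedZ ln a Px.
have bwN : bw (- x) y = - bw x y.
  have h1 := @W_sq_sum_eq [:: (1, - x + y)] [:: (1, x - y)].
  have h2 := @W_sq_sum_eq [:: (1, - x - y)] [:: (1, x + y)].
  move: h1 h2; rewrite !big_cons !big_nil !addr0 !mul1r => h1 h2.
  have PN : P (- x) by rewrite -scaleN1r.
  rewrite /bw h1 ?h2; first by lra.
  - by apply: sq_list_cons => //=; auto.
  - by apply: sq_list_cons => //=; auto.
  - by move=> xi; rewrite !big_cons !big_nil !addr0 !mul1r /= !fctE -opprD rnN.
  - by apply: sq_list_cons => //=; auto.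
  - by apply: sq_list_cons => //=; auto.
  - move=> xi; rewrite !big_cons !big_nil !addr0 !mul1r /= !fctE.
    by rewrite addrC rn_distrC.
(* Homogeneity of the weight covers nonnegative factors; negative ones go through [bwN]. *)
have pos (s : R) u : 0 <= s -> P u -> bw (s%:C *: u) y = s * bw u y.
  move=> s0 Pu; have Zu a := lin_closedZ ln a Pu.
  have := @W_sq_sum_eq [:: (1, s%:C *: u + y); (s, u - y)]
    [:: (1, s%:C *: u - y); (s, u + y)].
  rewrite !big_cons !big_nil !addr0 !mul1r => h.
  suff : W (adj (s%:C *: u + y) \o (s%:C *: u + y)) + s * W (adj (u - y) \o (u - y)) =
    W (adj (s%:C *: u - y) \o (s%:C *: u - y)) + s * W (adj (u + y) \o (u + y)).
    by rewrite /bw; lra.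
  apply: h => [||xi].
  - by do 2?[apply: sq_list_cons => //=]; auto.
  - by do 2?[apply: sq_list_cons => //=]; auto.
  rewrite !big_cons !big_nil !addr0 !mul1r /= !fctE.
  by rewrite !(rn2B, rn2D) ipZl ReZ; lra.
have [r0|r0] := leP 0 r; first exact: pos.
have -> : r%:C *: x = (- r)%:C *: (- x).
  by rewrite scalerN -scaleNr -rmorphN opprK.
rewrite pos ?bwN ?mulrNN //; first by rewrite oppr_ge0 ltW.
by rewrite -scaleN1r.
Qed.

Lemma bw_i x y : P x -> P y -> bw ('i%C *: x) ('i%C *: y) = bw x y.
Proof.
move=> Px Py.
have D := lin_closedD ln; have B := lin_closedB ln.
have Zx := lin_closedZ ln 'i%C Px; have Zy := lin_closedZ ln 'i%C Py.
have h1 := @W_sq_sum_eq [:: (1, 'i%C *: x + 'i%C *: y)] [:: (1, x + y)].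
have h2 := @W_sq_sum_eq [:: (1, 'i%C *: x - 'i%C *: y)] [:: (1, x - y)].
have i1 : rn ('i%C : R[i]) = 1.
  by rewrite /rn normc_def /re /= expr0n expr1n add0r sqrtr1.
move: h1 h2; rewrite !big_cons !big_nil !addr0 !mul1r => h1 h2.
rewrite /bw h1 ?h2 //.
- by apply: sq_list_cons => //=; auto.
- by apply: sq_list_cons => //=; auto.
- by move=> xi; rewrite !big_cons !big_nil !addr0 !mul1r /= !fctE -scalerBr rnZ i1 mul1r.
- by apply: sq_list_cons => //=; auto.
- by apply: sq_list_cons => //=; auto.
- by move=> xi; rewrite !big_cons !big_nil !addr0 !mul1r /= !fctE -scalerDr rnZ i1 mul1r.
Qed.

Lemma bw_il x y : P x -> P y -> bw ('i%C *: x) y = - bw x ('i%C *: y).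
Proof.
move=> Px Py; have Z a u (h : P u) := lin_closedZ ln a h.
have ii : ('i%C * 'i%C : R[i]) = (-1)%:C by rewrite -expr2 sqr_i rmorphN1.
rewrite -(bw_i (Z 'i%C _ Px) Py) scalerA ii bwZ //; last exact: Z.
by rewrite mulN1r.
Qed.

Lemma bw_ll (a : R[i]) x y z : P x -> P y -> P z ->
  bw (a *: x + y) z = complex.Re a * bw x z - complex.Im a * bw x ('i%C *: z) + bw y z.
Proof.
move=> Px Py Pz; have Z c u (h : P u) := lin_closedZ ln c h.
rewrite bwD //; last exact: Z.
have -> : a *: x = (complex.Re a)%:C *: x + (complex.Im a)%:C *: ('i%C *: x).
  by rewrite scalerA -scalerDl [(complex.Im a)%:C * _]mulrC -complexE.
by rewrite (bwD (Z _ _ Px) (Z _ _ (Z _ _ Px)) Pz) (bwZ _ Px Pz)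
  (bwZ _ (Z _ _ Px) Pz) (bw_il Px Pz) mulrN.
Qed.

Lemma re_Bw x : P x -> re (Bw x x) = W (adj x \o x).
Proof.
move=> Px; rewrite /re /= /bw subrr.
have z : adj (0 : H -> H) \o (0 : H -> H) = 0.
  apply/funext => xi; rewrite /= [(0 : H -> H) xi]/(0 : H).
  by rewrite (op0 (bounded_adj (bounded0 H))).
rewrite z W0 subr0.
have := @W_sq_sum_eq [:: (1, x + x)] [:: (4, x)].
rewrite !big_cons !big_nil !addr0 !mul1r => ->; first by field.
- by apply: sq_list_cons => //=; exact: lin_closedD.
- by apply: sq_list_cons => //=; rewrite ler0n.
- move=> xi; rewrite !big_cons !big_nil !addr0 !mul1r /= !fctE rn2D Re_ipxx; lra.
Qed.

Lemma Bw_semi_ip : semi_ip P Bw.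
Proof.
have Z c u (h : P u) := lin_closedZ ln c h.
split=> [a x y z Px Py Pz|x y Px Py|x Px].
- rewrite /Bw !bw_ll //; last exact: Z.
  rewrite scalerA.
  have ii : ('i%C * 'i%C : R[i]) = (-1)%:C by rewrite -expr2 sqr_i rmorphN1.
  have e u : P u -> bw u ('i%C * 'i%C *: z) = - bw u z.
    by move=> Pu; rewrite ii bw_sym ?bwZ ?mulN1r ?(bw_sym Pz) //; exact: Z.
  rewrite e //; case: a => a1 a2 /=; apply/eqP; rewrite eq_complex /=.
  by apply/andP; split; apply/eqP; ring.
- rewrite /Bw conjCE /= (bw_sym Px Py); congr (_ +i* _).
  by rewrite -bw_il // bw_sym //; exact: Z.
- by rewrite re_Bw // W_ge0 //; exact: sq_pos.
Qed.

(** [quadratic_operator] for y |-> y xi with the form of the weight; its boundedness hypothesis is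
    exactly that xi is w-bounded. *)
Lemma theta_exists xi (k : R) : 0 <= k ->
  (forall y, P y -> rn (y xi) ^+ 2 <= k * W (adj y \o y)) ->
  exists t, theta_spec P w xi t.
Proof.
move=> k0 hk.
have fl (a : R[i]) (x y : H -> H) : P x -> P y ->
    (a *: x + y) xi = a *: x xi + y xi by [].
have fb x : P x -> rn (x xi) ^+ 2 <= k * re (Bw x x) by move=> Px; rewrite re_Bw ?hk.
have [t bt ht] := quadratic_operator (f := fun y => y xi) ln Bw_semi_ip fl k0 fb.
exists t; split=> // zeta; have [h1 h2 h3] := ht zeta; split=> // [v Pv|e e0].
  by rewrite (le_trans (h2 v Pv)) // re_Bw.
have [v [Pv qv hv]] := h3 e e0; exists v => //; split=> //.
by rewrite wE ?lee_fin -?re_Bw //; exact: sq_pos.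
Qed.

Lemma weight_boundedP xi : weight_bounded P w xi <-> exists2 k : R, 0 <= k &
  forall y, P y -> rn (y xi) ^+ 2 <= k * W (adj y \o y).
Proof.
split=> -[k k0 hk]; exists k => // y Py.
  have := hk y Py; rewrite wE ?ltry; last exact: sq_pos.
  by move=> /(_ isT); rewrite -EFinM lee_fin [complex.Re _]Re_ipxx.
move=> _; rewrite wE; last exact: sq_pos.
by rewrite -EFinM lee_fin [complex.Re _]Re_ipxx hk.
Qed.

Lemma theta_specP xi : weight_bounded P w xi -> theta_spec P w xi (theta P w xi).
Proof.
move=> /weight_boundedP[k k0 hk]; have [t ht] := theta_exists k0 hk.
by rewrite (theta_specE ht).
Qed.
End Theta.

(** * Inclusions with a finite basis *)

Lemma sum_CS (R : realType) (I : finType) (g al be : I -> R) :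
  (forall i, 0 <= al i) -> (forall i, 0 <= be i) ->
  (forall i, g i ^+ 2 <= al i * be i) ->
  (\sum_i g i) ^+ 2 <= (\sum_i al i) * (\sum_i be i).
Proof.
move=> ha hb hg; apply: discriminant_le => t.
rewrite !mulr_sumr -!big_split /=; apply: sumr_ge0 => i _.
have [a0|a0] := eqVneq (al i) 0.
  have := hg i; rewrite a0 mul0r => g0.
  have : g i = 0 by apply/eqP; rewrite -sqrf_eq0 eq_le g0 sqr_ge0.
  by move=> ->; rewrite mulr0 !add0r mulr_ge0 ?sqr_ge0.
have a1 : 0 < al i by rewrite lt0r a0 ha.
rewrite -(pmulr_rge0 _ a1).
have -> : al i * (al i + 2 * t * g i + t ^+ 2 * be i) =
   (al i + t * g i) ^+ 2 + t ^+ 2 * (al i * be i - g i ^+ 2) by ring.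
by rewrite addr_ge0 ?sqr_ge0 // mulr_ge0 ?sqr_ge0 // subr_ge0.
Qed.

Section JonesData.
Variables (R : realType) (H : hilbertType R) (M N : set (H -> H)).
Local Notation M' := (commutant M).
Local Notation N' := (commutant N).
Hypotheses (aM : star_algebra M) (aN : star_algebra N).
Hypothesis N_double : commutant N' = N.
Hypothesis NM : N `<=` M.
(** Two dual systems: [m] is a basis of M over N relative to the projection [e], and the operators
    m'_p e are a basis of N' over M'. The scalars [a j] are the compressions by [e] of the m_j and
    of the adjoints of the m'_j. *)
Variables (I : finType) (m m' : I -> H -> H) (e : H -> H) (a : I -> R[i]) (c : R).
Hypotheses (Mm : forall j, M (m j)) (M'm : forall j, M' (m' j)) (N'e : N' e).
Hypotheses (adj_e : adj e = e) (e_idem : forall xi, e (e xi) = e xi).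
Hypothesis T0_M' : forall y, N' y -> M' (conj_sum m y).
Hypothesis sum_m_e : forall xi, \sum_j m j (e (adj (m j) xi)) = xi.
Hypothesis sum_m'_e : forall xi, \sum_j m' j (e (adj (m' j) xi)) = xi.
Hypothesis orth_m' : forall k l xi,
  e (adj (m' k) (m' l (e xi))) = (k == l)%:R *: e xi.
Hypothesis e_m_e : forall j xi, e (m j (e xi)) = a j *: e xi.
Hypothesis sum_a_m : forall xi, \sum_j a j *: adj (m j) xi = xi.
Hypothesis sum_a_m' : forall xi, \sum_j Num.conj (a j) *: adj (m' j) xi = xi.
Hypothesis sum_m_m : forall xi, \sum_j m j (adj (m j) xi) = c%:C *: xi.

Let stM : star_closed M. Proof. by case: aM. Qed.
Let stN : star_closed N. Proof. by case: aN. Qed.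
Let aM' : star_algebra M'. Proof. exact: commutant_star_algebra. Qed.
Let aN' : star_algebra N'. Proof. exact: commutant_star_algebra. Qed.
Let stM' : star_closed M'. Proof. by case: aM'. Qed.
Let stN' : star_closed N'. Proof. by case: aN'. Qed.
Let M'N' : M' `<=` N'. Proof. exact: commutant_sub. Qed.
Let bM x : M x -> bounded_op x. Proof. by move=> /stM[]. Qed.
Let bM' x : M' x -> bounded_op x. Proof. by case. Qed.
Let bN' x : N' x -> bounded_op x. Proof. by case. Qed.
Let bm j : bounded_op (m j). Proof. exact: bM. Qed.
Let bm' j : bounded_op (m' j). Proof. exact: bM'. Qed.
Let be : bounded_op e. Proof. exact: bN'. Qed.

Let compM x y : M x -> M y -> M (x \o y). Proof. by case: aM => _ _ h _; exact: h. Qed.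
Let compM' x y : M' x -> M' y -> M' (x \o y). Proof. by case: aM' => _ _ h _; exact: h. Qed.
Let compN' x y : N' x -> N' y -> N' (x \o y). Proof. by case: aN' => _ _ h _; exact: h. Qed.
Let adjM x : M x -> M (adj x). Proof. by case/stM. Qed.
Let adjM' x : M' x -> M' (adj x). Proof. by case/stM'. Qed.
Let adjN' x : N' x -> N' (adj x). Proof. by case/stN'. Qed.

Lemma comm_MM' x y : M x -> M' y -> forall xi, y (x xi) = x (y xi).
Proof. by move=> Mx [_ h] xi; have /= := f_equal (@^~ xi) (h _ Mx). Qed.

Lemma comm_NN' x y : N x -> N' y -> forall xi, y (x xi) = x (y xi).
Proof. by move=> Nx [_ h] xi; have /= := f_equal (@^~ xi) (h _ Nx). Qed.

(* [jeps] is the expectation of M onto N, [jT0] its inverse from N' to M'. *)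
Definition jn k : H -> H := m' k \o e.
Definition jeps : (H -> H) -> H -> H := conj_sum jn.
Definition jT0 : (H -> H) -> H -> H := conj_sum m.

Lemma N'n k : N' (jn k).
Proof. by apply: compN' => //; exact: M'N'. Qed.

Lemma bn k : bounded_op (jn k).
Proof. exact/bN'/N'n. Qed.

Lemma adj_jn k : adj (jn k) = e \o adj (m' k).
Proof. by rewrite /jn adj_comp // adj_e. Qed.

Lemma jepsE x xi : jeps x xi = \sum_k m' k (e (x (e (adj (m' k) xi)))).
Proof. by rewrite /jeps conj_sumE; apply: eq_bigr => k _; rewrite adj_jn. Qed.

Lemma jT0E y xi : jT0 y xi = \sum_j m j (y (adj (m j) xi)).
Proof. exact: conj_sumE. Qed.

(** Write y = sum_j a_j y m_j^*, insert sum_p m'_p e m'_p^* = 1 on the left of y, and absorb a_j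
    through e m_j e = a_j e. *)
Lemma N'_expand y : N' y -> forall xi,
  \sum_p jn p (jT0 (adj (jn p) \o y) xi) = y xi.
Proof.
move=> N'y xi; rewrite -[in RHS](sum_a_m xi) (op_sum _ _ _ (bN' N'y)).
under eq_bigr => p _ do rewrite jT0E (op_sum _ _ _ (bn p)).
rewrite exchange_big /=; apply: eq_bigr => j _.
rewrite (opZ (bN' N'y)) -[in RHS](sum_m'_e (y (adj (m j) xi))) scaler_sumr.
by apply: eq_bigr => p _; rewrite /= adj_jn /jn /= e_m_e (opZ (bm' p)).
Qed.

Lemma jT0_adj y : N' y -> adj (jT0 y) = jT0 (adj y).
Proof. by move=> N'y; rewrite /jT0 conj_sum_adj //; exact: bN'. Qed.

Let b y p k := jT0 (adj (jn p) \o y \o jn k).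

Lemma N'b y p k : N' y -> M' (b y p k).
Proof.
move=> N'y; apply: T0_M'; apply: compN'; last exact: N'n.
by apply: compN' => //; exact/adjN'/N'n.
Qed.

Lemma N'_n y k : N' y -> forall xi, y (jn k xi) = \sum_p jn p (b y p k xi).
Proof.
by move=> N'y xi; rewrite -[LHS]/((y \o jn k) xi) -(N'_expand (compN' N'y (N'n k))).
Qed.

Lemma b_adj y p k : N' y -> adj (b y p k) = b (adj y) k p.
Proof.
move=> N'y; have bnp := bounded_adj (bn p); have by_ := bN' N'y.
have N'z : N' (adj (jn p) \o y \o jn k).
  by apply: compN'; [apply: compN' => //; exact/adjN'/N'n|exact: N'n].
rewrite /b jT0_adj // adj_comp; [|exact: bounded_comp|exact: bn].
by rewrite adj_comp // adjK //; exact: bn.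
Qed.

Lemma N'_n_adj y p : N' y -> forall xi,
  adj (jn p) (y xi) = \sum_k b y p k (adj (jn k) xi).
Proof.
move=> N'y xi; apply: ip_ext => eta.
rewrite (ip_adjl (bn p)) (ip_adjr (bN' N'y)) (N'_n _ (adjN' N'y)) ip_sumr ip_suml.
apply: eq_bigr => k _.
rewrite (ip_adjr (bM' (N'b p k N'y))) (ip_adjl (bn k)) b_adj //.
Qed.

(** As N = N'', it suffices to commute with y in N'. There y n_k = sum_p n_p b_pk and n_p^* y =
    sum_k b_pk n_k^* with entries b_pk in M', which pass through x. *)
Lemma jeps_N x : M x -> N (jeps x).
Proof.
move=> Mx; rewrite -N_double; split.
  by apply: bounded_conj_sum; [exact: bn|exact: bM].
move=> y N'y; apply/funext => xi /=; rewrite /jeps !conj_sumE.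
rewrite (op_sum _ _ _ (bN' N'y)).
under [RHS]eq_bigr => k _ do rewrite (N'_n k N'y).
rewrite [RHS]exchange_big /=; apply: eq_bigr => p _.
rewrite (N'_n_adj p N'y) (op_sum _ _ _ (bM Mx)) (op_sum _ _ _ (bn p)).
by apply: eq_bigr => k _; rewrite (comm_MM' Mx (N'b p k N'y)).
Qed.

Lemma jeps_id x : N x -> jeps x = x.
Proof.
move=> Nx; apply/funext => xi; rewrite jepsE -[in RHS](sum_m'_e xi).
have bx : bounded_op x by have [] := stN Nx.
rewrite (op_sum _ _ _ bx); apply: eq_bigr => k _.
by rewrite (comm_NN' Nx N'e) e_idem (comm_MM' (NM Nx) (M'm k)).
Qed.

Lemma jeps_bimod u x v : N u -> M x -> N v -> jeps (u \o x \o v) = u \o jeps x \o v.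
Proof.
move=> Nu Mx Nv; apply/funext => xi /=; rewrite /jeps !conj_sumE.
have bu : bounded_op u by have [] := stN Nu.
rewrite (op_sum _ _ _ bu); apply: eq_bigr => k _ /=.
by rewrite -(comm_NN' Nv (adjN' (N'n k))) (comm_NN' Nu (N'n k)).
Qed.

Lemma M_expandl x : M x -> forall xi, \sum_j m j (jeps (adj (m j) \o x) xi) = x xi.
Proof.
move=> Mx xi; rewrite -[in RHS](sum_m'_e xi) (op_sum _ _ _ (bM Mx)).
under eq_bigr => j _ do rewrite jepsE (op_sum _ _ _ (bm j)).
rewrite exchange_big /=; apply: eq_bigr => k _.
rewrite -[in RHS](comm_MM' Mx (M'm k)) -[in RHS](sum_m_e (x _)) (op_sum _ _ _ (bm' k)).
by apply: eq_bigr => j _; rewrite (comm_MM' (Mm j) (M'm k)).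
Qed.

Lemma M_expandr x : M x -> forall xi, \sum_j jeps (x \o m j) (adj (m j) xi) = x xi.
Proof.
move=> Mx xi; rewrite -[RHS]sum_m'_e.
under eq_bigr => j _ do rewrite jepsE.
rewrite exchange_big /=; apply: eq_bigr => k _.
rewrite -(op_sum _ _ _ (bm' k)) -(op_sum _ _ _ be).
rewrite (comm_MM' Mx (adjM' (M'm k))) -[in RHS](sum_m_e (adj (m' k) xi)).
rewrite (op_sum _ _ _ (bM Mx)); congr (m' k (e _)); apply: eq_bigr => j _ /=.
by rewrite (comm_MM' (adjM (Mm j)) (adjM' (M'm k))).
Qed.

Lemma sum_a_m'_adj xi : \sum_l a l *: m' l xi = xi.
Proof.
apply: ip_ext => eta; rewrite -[in RHS](sum_a_m' eta) ip_suml ip_sumr.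
by apply: eq_bigr => l _; rewrite ipZl ipZr conjCK (ip_adjr (bm' l)).
Qed.

Lemma e_m'_e k xi : e (adj (m' k) (e xi)) = a k *: e xi.
Proof.
rewrite -{1}(sum_a_m'_adj (e xi)) (op_sum _ _ _ (bounded_adj (bm' k))) (op_sum _ _ _ be).
rewrite (bigD1 k) //= big1 ?addr0 => [|l lk].
  by rewrite (opZ (bounded_adj (bm' k))) (opZ be) orth_m' eqxx scale1r.
rewrite (opZ (bounded_adj (bm' k))) (opZ be) orth_m' eq_sym (negPf lk).
by rewrite scale0r scaler0.
Qed.

(** The Jones relation. With e Omega = Omega it makes the vector state of Omega invariant under the
    expectation. *)
Lemma jeps_e x : M x -> forall xi, jeps x (e xi) = e (x (e xi)).
Proof.
move=> Mx xi; rewrite jepsE -[RHS]sum_a_m'_adj; apply: eq_bigr => k _.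
by rewrite e_m'_e (opZ (bM Mx)) (opZ be) (opZ (bm' k)).
Qed.

Variable Omega : H.
Hypotheses (e_Omega : e Omega = Omega).
Hypothesis M'_dense : forall zeta (d : R), 0 < d ->
  exists2 y, M' y & rn (y Omega - zeta) < d.

Lemma separating x : M x -> x Omega = 0 -> x = 0.
Proof.
move=> Mx x0; apply/funext => xi; apply/rn_le0/ler_addgt0Pr => d d0; rewrite add0r.
have [_ [k k0 hk]] := (bounded_opP x).1 (bM Mx).
have [y M'y hy] := M'_dense xi (divr_gt0 d0 k0).
have : x (y Omega) = 0 by rewrite -(comm_MM' Mx M'y) x0 (op0 (bM' M'y)).
move=> xy; rewrite -[x xi]subr0 -xy -(opB (bM Mx)) (le_trans (hk _)) //.
by rewrite rn_distrC mulrC -ler_pdivlMr // ltW.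
Qed.

Lemma jeps_faithful x : positive_part M x -> jeps x = 0 -> x = 0.
Proof.
move=> [Mx px] h; apply: separating => //.
have z xi k : x (adj (jn k) xi) = 0.
  have : dotp (jeps x xi) xi = 0 by rewrite h [(0 : H -> H) xi]/(0 : H) ip0l.
  rewrite /jeps (conj_sum_form bn) => /eqP.
  rewrite psumr_eq0 => [/allP/(_ k)|j _]; last exact: (op_le0P x).1.
  rewrite mem_index_enum => /(_ isT)/eqP; exact: pos_ker (bM Mx) px.
(* Omega is a combination of the vectors n_k^* Omega, each of which x kills. *)
rewrite -e_Omega -(sum_a_m' Omega) !(op_sum _ _ _ be) (op_sum _ _ _ (bM Mx)).
apply: big1 => k _; rewrite (opZ be) (opZ (bM Mx)).
by have := z Omega k; rewrite adj_jn /= => ->; rewrite scaler0.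
Qed.

Lemma jeps_expectation : fn_conditional_expectation N M jeps.
Proof.
split; [split|..].
- exact: jeps_N.
- exact: jeps_id.
- by move=> r x y _ _; rewrite /jeps (conj_sum_lin bn).
- by move=> u x v; exact: jeps_bimod.
- by move=> x [_ px]; exact: conj_sum_pos bn x px.
- move=> D x DM dD _ lx; apply: (conj_sum_lub bn) => // y /DM[My py].
  by split=> //; exact: bM.
- exact: jeps_faithful.
Qed.

(** * The inverse operator-valued weight and the spatial derivatives *)

Definition jT (x : H -> H) (psi : (H -> H) -> R[i]) : \bar R := Defs.ReE (psi (jT0 x)).

Lemma jT0_pos x : positive_part N' x -> positive_part M' (jT0 x).
Proof. by move=> [N'x px]; split; [exact: T0_M'|exact: conj_sum_pos bm x px]. Qed.

Lemma jT0_lin r x y : jT0 (r *: x + y) = r *: jT0 x + jT0 y.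
Proof. exact: conj_sum_lin. Qed.

Lemma jT0_bimod u x v : M' u -> M' v -> bounded_op x ->
  jT0 (u \o x \o v) = u \o jT0 x \o v.
Proof.
move=> M'u M'v bx; apply/funext => xi /=; rewrite !jT0E (op_sum _ _ _ (bM' M'u)).
apply: eq_bigr => j _ /=.
by rewrite (comm_MM' (adjM (Mm j)) M'v) (comm_MM' (Mm j) M'u).
Qed.

Lemma jT_weight : nsf_operator_valued_weight N' M' jT.
Proof.
split; [|..|split].
- move=> x px; split=> [psi [_ ps _]|r psi chi r0 _ _|psi r npsi].
  + by rewrite lee_fin; apply/ge0_Re/ps/jT0_pos.
  + by rewrite /jT /Defs.ReE -EFinM -EFinD; congr (_%:E); rewrite -/(re _) ReD ReZ.
  + rewrite lte_fin -/(re _) => hr.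
    have [N'x _] := px; have [M'T _] := jT0_pos px.
    have /bounded_opP[_ [k k0 hk]] := bM' M'T.
    have dd : 0 < (re (psi (jT0 x)) - r) / (2 * k).
      by rewrite divr_gt0 ?subr_gt0 // mulr_gt0.
    (* With k bounding the norm of [jT0 x], a perturbation of this size changes the value at [jT0 x]
       by at most half of the gap above r. *)
    exists ((re (psi (jT0 x)) - r) / (2 * k)) => // chi nchi h.
    pose z := (k^-1)%:C *: jT0 x.
    have M'z : M' z by apply: lin_closedZ => //; case: aM'.
    have := h z M'z.
    have zk xi : `|z xi| <= `|xi|.
      rewrite !norm_rn lecR /z !fctE rnZ rn_rc gtr0_norm ?invr_gt0 //.
      by rewrite ler_pdivrMl.
    have zE (f : (H -> H) -> R[i]) : normal_functional M' f -> f z = (k^-1)%:C * f (jT0 x).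
      move=> [fl _ _]; have f0 : f 0 = 0.
        have M0 : M' 0 by have [[]] := aM'.
        have := fl (-1) 0 0 M0 M0; rewrite scaler0 addr0 mulN1r addNr.
        by [].
      have M0 : M' 0 by have [[]] := aM'.
      by have := fl (k^-1)%:C _ 0 M'T M0; rewrite addr0 f0 addr0.
    move=> /(_ zk); rewrite !zE // -mulrBr normrM !norm_rn rn_rc.
    rewrite gtr0_norm ?invr_gt0 // -rcM lecR ler_pdivrMl //.
    have -> : k * ((re (psi (jT0 x)) - r) / (2 * k)) = (re (psi (jT0 x)) - r) / 2.
      by field; rewrite gt_eqF.
    move=> h2; rewrite lte_fin -/(re _).
    have := Re_le_rn (chi (jT0 x) - psi (jT0 x)); rewrite ler_norml ReB.
    by move=> /andP[h3 _]; lra.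
- move=> r x y psi r0 px py [ln _ _]; rewrite /jT jT0_lin ln; first last.
  + by have [] := jT0_pos py.
  + by have [] := jT0_pos px.
  by rewrite /Defs.ReE -EFinM -EFinD; congr (_%:E); rewrite -/(re _) ReD ReZ.
- move=> u x psi M'u [N'x _] _; rewrite /jT jT0_bimod //; last exact: bN'.
  exact: adjM'.
- move=> D x psi DN dD N'x lx [_ _ sup].
  have bD y : D y -> bounded_op y /\ op_le 0 y.
    by move=> /DN[N'y py]; split=> //; exact: bN'.
  have := sup (jT0 @` D) (jT0 x); rewrite /jT => ->.
  + by congr ereal_sup; apply/seteqP; split=> z [y];
      [move=> [u Du <-] <-; exists u|move=> Dy <-; exists (jT0 y) => //; exists y].
  + by move=> _ [y Dy <-]; apply/jT0_pos/DN.
  + exact: conj_sum_directed.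
  + exact: T0_M'.
  + exact: conj_sum_lub.
- move=> x px h; have [N'x p] := px.
  have hv xi : dotp (jT0 x xi) xi = 0.
    have := h _ (vector_functional_normal bM' xi); rewrite /jT /vector_functional.
    have := (op_le0P _).1 (jT0_pos px).2 xi => /ge0_rc ->.
    by move=> [->].
  apply/funext => xi; rewrite -(sum_a_m xi) (op_sum _ _ _ (bN' N'x)).
  apply: big1 => j _; rewrite (opZ (bN' N'x)).
  have := hv xi; rewrite /jT0 (conj_sum_form bm) => /eqP.
  rewrite psumr_eq0 => [/allP/(_ j)|l _]; last exact: (op_le0P x).1.
  rewrite mem_index_enum => /(_ isT)/eqP/(pos_ker (bN' N'x) p) ->.
  by rewrite scaler0.
(* [jT0] takes bounded values everywhere, so x approximates itself. *)
- move=> x l d N'x d0 hl; exists x.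
    split=> //; exists (jT0 (adj x \o x)) => //.
    apply: jT0_pos; split; first by apply: compN' => //; exact: adjN'.
    exact/adj_self_pos/bN'.
  move=> phi /hl[fl _ _]; rewrite subrr.
  have N0 : N' 0 by have [[]] := aN'.
  have := fl (-1) 0 0 N0 N0; rewrite scaler0 addr0 mulN1r addNr => ->.
  by rewrite normr0 ler0c ltW.
Qed.

Let d y p := jT0 (adj (jn p) \o y).

Lemma M'd y p : N' y -> M' (d y p).
Proof. by move=> N'y; apply: T0_M'; apply: compN' => //; exact/adjN'/N'n. Qed.

(** Parseval's identity: the n_p are orthonormal for the M'-valued inner product jT0(x^* y), and the
    d_p are the coefficients of y. *)
Lemma jT0_sq y : N' y -> jT0 (adj y \o y) = \sum_p (adj (d y p) \o d y p).
Proof.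
move=> N'y; apply/funext => xi; rewrite fct_sumE jT0E /=.
have dE p eta : adj (d y p) eta = \sum_j m j (adj y (jn p (adj (m j) eta))).
  rewrite /d jT0_adj; last by apply: compN' => //; exact/adjN'/N'n.
  rewrite adj_comp; [|exact/bounded_adj/bn|exact: bN'].
  by rewrite adjK ?jT0E //; exact: bn.
under [RHS]eq_bigr => p _ do rewrite dE.
rewrite exchange_big /=; apply: eq_bigr => j _.
rewrite -(op_sum _ _ _ (bm j)) -(op_sum _ _ _ (bounded_adj (bN' N'y))).
rewrite -[in LHS](N'_expand N'y); congr (m j (adj y _)); apply: eq_bigr => p _.
by rewrite -(comm_MM' (adjM (Mm j)) (M'd p N'y)).
Qed.

Lemma jT0_orth q p xi : jT0 (adj (jn q) \o jn p) xi = (q == p)%:R *: xi.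
Proof.
rewrite jT0E -[in RHS](sum_m_e xi) scaler_sumr; apply: eq_bigr => j _.
by rewrite /= adj_jn /jn /= orth_m' (opZ (bm j)).
Qed.

Section Functional.
Variable psi : (H -> H) -> R[i].
Hypothesis npsi : normal_functional M' psi.

Lemma M'0 : M' 0. Proof. by have [[]] := aM'. Qed.

Lemma psi0 : psi 0 = 0.
Proof.
have [fl _ _] := npsi.
by have := fl (-1) 0 0 M'0 M'0; rewrite scaler0 addr0 mulN1r addNr.
Qed.

Lemma psiD x y : M' x -> M' y -> psi (x + y) = psi x + psi y.
Proof. by have [fl _ _] := npsi; move=> hx hy; have := fl 1 x y hx hy; rewrite scale1r mul1r. Qed.

Lemma psiZ r x : M' x -> psi (r *: x) = r * psi x.
Proof. by have [fl _ _] := npsi; move=> hx; have := fl r x 0 hx M'0; rewrite psi0 !addr0. Qed.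

Lemma psi_sum (F : I -> H -> H) : (forall i, M' (F i)) -> psi (\sum_i F i) = \sum_i psi (F i).
Proof.
move=> hF; have [lM' _ _ _] := aM'.
suff [_ ->] : M' (\sum_i F i) /\ psi (\sum_i F i) = \sum_i psi (F i) by [].
elim/big_rec2: _ => [|i y x _ [hx ex]]; first by split; [exact: M'0|exact: psi0].
by split; [exact: lin_closedD|rewrite psiD // ex].
Qed.

Lemma finite_weight1 : finite_weight M' (fun x => Defs.ReE (psi x)).
Proof.
have [fl ps _] := npsi; split=> [x px|r x y r0 [M'x _] [M'y _]].
  by exists (re (psi x)) => //; exact/ge0_Re/ps.
by rewrite fl // /Defs.ReE -EFinM -EFinD; congr (_%:E); rewrite -/(re _) ReD ReZ.
Qed.

Lemma finite_weight2 : finite_weight N' (fun x => jT x psi).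
Proof.
have [fl ps _] := npsi; split=> [x px|r x y r0 px py].
  by exists (re (psi (jT0 x))) => //; exact/ge0_Re/ps/jT0_pos.
rewrite /jT jT0_lin fl; [|by have [] := jT0_pos px|by have [] := jT0_pos py].
by rewrite /Defs.ReE -EFinM -EFinD; congr (_%:E); rewrite -/(re _) ReD ReZ.
Qed.

Local Notation w1 := (fun x : H -> H => Defs.ReE (psi x)).
Local Notation w2 := (fun x : H -> H => jT x psi).

Lemma w2_sq y : N' y -> re (psi (jT0 (adj y \o y))) =
  \sum_p re (psi (adj (d y p) \o d y p)).
Proof.
move=> N'y; rewrite jT0_sq // psi_sum ?Re_sum // => p.
by apply: compM'; [exact/adjM'/M'd|exact: M'd].
Qed.

Lemma psi_sq_ge0 y : M' y -> 0 <= re (psi (adj y \o y)).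
Proof.
have [_ ps _] := npsi; move=> M'y; apply/ge0_Re/ps; split.
  by apply: compM' => //; exact: adjM'.
exact/adj_self_pos/bM'.
Qed.

(** By Parseval the coefficients (d_p) identify the GNS space of psi o T with copies of that of psi,
    and y xi = sum_p n_p d_p xi. So R(xi) R(xi)^* becomes sum_p n_p R(xi) R(xi)^* n_p^*, which is
    [jeps t]. *)
Lemma theta_jT xi t : theta_spec M' w1 xi t -> theta_spec N' w2 xi (jeps t).
Proof.
move=> [bt ht]; split; first exact: bounded_conj_sum bn _ bt.
move=> zeta; pose s p := re (dotp (t (adj (jn p) zeta)) (adj (jn p) zeta)).
have s0 p : 0 <= s p by have [h _ _] := ht (adj (jn p) zeta); exact: ge0_Re.
have sE : re (dotp (jeps t zeta) zeta) = \sum_p s p.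
  by rewrite /jeps (conj_sum_form bn) Re_sum.
split=> [|v N'v|e0 e00].
- by rewrite /jeps (conj_sum_form bn); apply: sumr_ge0 => p _; have [] := ht (adj (jn p) zeta).
- rewrite sE /jT /= -/(re _) w2_sq //.
  have -> : dotp (v xi) zeta = \sum_p dotp (d v p xi) (adj (jn p) zeta).
    rewrite -(N'_expand N'v) ip_suml; apply: eq_bigr => p _.
    by rewrite (ip_adjr (bn p)).
  apply: (@le_trans _ _ ((\sum_p rn (dotp (d v p xi) (adj (jn p) zeta))) ^+ 2)).
    by rewrite ler_pXn2r ?nnegrE ?rn_ge0 ?sumr_ge0 ?rn_sum // => *; exact: rn_ge0.
  apply: sum_CS => [p|p|p]; [exact/psi_sq_ge0/M'd|exact: s0|].
  by have [_ h _] := ht (adj (jn p) zeta); exact: h (M'd p N'v).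
(* Almost optimal v_p are chosen in each component and then combined into one element of N'; c0 is
   the share of the error of each component. *)
- have [c0 c00 hc] : exists2 c0 : R, 0 < c0 & \sum_(i : I) c0 < e0.
    exists (e0 / (#|I|.+1)%:R); first by rewrite divr_gt0 ?ltr0Sn.
    rewrite big_const iter_addr_0 -(mulr_natr (e0 / _)) mulrAC ltr_pdivrMr ?ltr0Sn //.
    by rewrite ltr_pM2l // ltr_nat; exact: ltnSn.
  have /choice[v hv] : forall p, exists v, [/\ M' v, re (psi (adj v \o v)) <= 1 &
      s p < rn (dotp (v xi) (adj (jn p) zeta)) ^+ 2 + c0].
    move=> p; have [_ _ h] := ht (adj (jn p) zeta).
    by have [v [M'v hv1] hv2] := h c0 c00; exists v; split=> //; rewrite -lee_fin.
  pose g p := dotp (v p xi) (adj (jn p) zeta).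
  pose G := \sum_p rn (g p) ^+ 2.
  have G0 : 0 <= G by apply: sumr_ge0 => p _; exact: sqr_ge0.
  have sG : \sum_p s p < G + e0.
    apply: (@le_lt_trans _ _ (G + \sum_(i : I) c0)); last by rewrite ltrD2l.
    rewrite /G -big_split /=; apply: ler_sum => p _; apply: ltW.
    by have [] := hv p.
  have [lN' _ _ _] := aN'; have [lM' _ _ _] := aM'.
  have [Gz|Gnz] := eqVneq G 0.
    exists 0; first split; first exact: lN'.1.
      have -> : adj (0 : H -> H) \o (0 : H -> H) = 0.
        apply/funext => z; rewrite /= [(0 : H -> H) z]/(0 : H).
        by rewrite (op0 (bounded_adj (bounded0 H))).
      rewrite /jT; have -> : jT0 0 = 0.
        apply/funext => z; rewrite jT0E; apply: big1 => j _.
        by rewrite [(0 : H -> H) _]/(0 : H) (op0 (bm j)).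
      by rewrite psi0 /Defs.ReE /= lee_fin ler01.
    by rewrite [(0 : H -> H) _]/(0 : H) ip0l rn0 expr0n sE; move: sG; rewrite Gz.
  have Gp : 0 < G by rewrite lt0r Gnz.
  pose q := (Num.sqrt G)^-1.
  have q2 : q ^+ 2 = G^-1 by rewrite exprVn sqr_sqrtr.
  (* The equality case of Cauchy-Schwarz: weights proportional to the conjugates of g_p, normalized
     by sqrt G so that V has weight at most 1 and <V xi, zeta> = sqrt G. This is why G = 0 was
     treated apart. *)
  pose la p : R[i] := q%:C * Num.conj (g p).
  pose V : H -> H := \sum_p (jn p \o (la p *: v p)).
  have M'lv p : M' (la p *: v p) by apply: lin_closedZ => //; have [] := hv p.
  have N'V : N' V.
    by apply: lin_closed_sum => // p _; apply: compN'; [exact: N'n|exact: M'N'].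
  have VE z : V z = \sum_p jn p (la p *: v p z) by rewrite /V fct_sumE.
  have dV p : d V p = la p *: v p.
    apply/funext => z; rewrite /d.
    have -> : adj (jn p) \o V = \sum_r ((adj (jn p) \o jn r) \o (la r *: v r)).
      apply/funext => y; rewrite fct_sumE /= VE (op_sum _ _ _ (bounded_adj (bn p))).
      by apply: eq_bigr => r _.
    rewrite jT0E.
    under eq_bigr => j _ do rewrite fct_sumE (op_sum _ _ _ (bm j)) /=.
    rewrite exchange_big /= (bigD1 p) //= [X in _ + X]big1 ?addr0 => [|r rp].
      under eq_bigr => j _ do rewrite (comm_MM' (adjM (Mm j)) (M'lv p)).
      by have := jT0_orth p p (la p *: v p z); rewrite jT0E eqxx scale1r.
    under eq_bigr => j _ do rewrite (comm_MM' (adjM (Mm j)) (M'lv r)).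
    have := jT0_orth p r (la r *: v r z); rewrite jT0E eq_sym (negPf rp) scale0r.
    by [].
  exists V; first split=> //.
    rewrite /jT lee_fin -/(re _) w2_sq // -[leRHS](mulfV Gnz) /G mulr_suml.
    apply: ler_sum => p _; rewrite dV.
    have [M'v v1 _] := hv p.
    have -> : adj (la p *: v p) \o (la p *: v p) =
        ((rn (g p) ^+ 2 * G^-1)%:C) *: (adj (v p) \o v p).
      have bv := bM' M'v.
      apply/funext => z; rewrite /= !fctE.
      have -> : adj (la p *: v p) = Num.conj (la p) *: adj (v p).
        have := adj_lin (la p) bv (bounded0 H); rewrite addr0 => ->.
        have -> : adj (0 : H -> H) = 0; last by rewrite addr0.
        by apply: adj_eq => x y; rewrite [(0 : H -> H) x]/(0 : H)
          [(0 : H -> H) y]/(0 : H) ip0l ip0r.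
      rewrite !fctE (opZ (bounded_adj bv)) scalerA; congr (_ *: _).
      rewrite rcM rn_sqr_conj -q2 rcX /la rmorphM /= conj_rc conjCK.
      by ring.
    rewrite psiZ; last by apply: compM' => //; exact: adjM'.
    rewrite ReZ ler_piMr // mulr_ge0 ?sqr_ge0 // invr_ge0.
    exact: ltW.
  rewrite sE; have -> : dotp (V xi) zeta = (q * G)%:C.
    rewrite VE ip_suml rcM /G rmorph_sum /= mulr_sumr; apply: eq_bigr => p _.
    rewrite (ip_adjr (bn p)) ipZl -/(g p) /la rn_sqr_conj -mulrA.
    by rewrite [Num.conj _ * _]mulrC.
  rewrite rn_rc real_normK ?num_real // exprMn q2 expr2 mulrA mulVf // mul1r.
  exact: sG.
Qed.

(** From M' to N', test the operator [jeps t] at y xi and divide by |y xi|^2. Conversely, T(y^* y) =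
    c y^* y for y in M'. *)
Lemma bounded1_2 xi : weight_bounded M' w1 xi <-> weight_bounded N' w2 xi.
Proof.
split.
  move=> h; have [bt ht] := theta_jT (theta_specP aM' finite_weight1 h).
  have [k k0 hk] := bounded_le_scalar bt.
  apply/(weight_boundedP aN' finite_weight2); exists k; first exact: ltW.
  move=> y N'y; have [_ hv _] := ht (y xi); have := hv y N'y.
  rewrite /= -/(re _) ipxx rn_rc ger0_norm ?sqr_ge0 // => h1.
  have w0 : 0 <= re (psi (jT0 (adj y \o y))).
    by rewrite w2_sq //; apply: sumr_ge0 => p _; exact/psi_sq_ge0/M'd.
  have [->|r0] := eqVneq (rn (y xi) ^+ 2) 0; first by rewrite mulr_ge0 // ltW.
  have rp : 0 < rn (y xi) ^+ 2 by rewrite lt0r r0 sqr_ge0.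
  rewrite -(ler_pM2r rp) -expr2 (le_trans h1) // [k * _]mulrC -mulrA.
  by rewrite ler_wpM2l.
move=> /(weight_boundedP aN' finite_weight2)[k k0 hk].
apply/(weight_boundedP aM' finite_weight1); exists (k * `|c|); first exact: mulr_ge0.
move=> y M'y; rewrite (le_trans (hk y (M'N' M'y))) // -mulrA ler_wpM2l //.
rewrite /jT /= -!/(re _).
have M'yy : M' (adj y \o y) by apply: compM' => //; exact: adjM'.
have -> : jT0 (adj y \o y) = c%:C *: (adj y \o y).
  apply/funext => z; rewrite jT0E !fctE -(sum_m_m ((adj y \o y) z)).
  apply: eq_bigr => j _; rewrite -[adj y (y _)]/((adj y \o y) (adj (m j) z)).
  by rewrite (comm_MM' (adjM (Mm j)) M'yy).
by rewrite psiZ // ReZ ler_wpM2r ?ler_norm // psi_sq_ge0.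
Qed.

Lemma spatial_eq phi : spatial_derivative M' (phi \o jeps) w1 = spatial_derivative N' phi w2.
Proof.
apply/funext => xi; rewrite /spatial_derivative; congr (ereal_sup (image _ _)).
apply/funext => r; congr ereal_inf; apply/seteqP; split=> z [eta [wb hr] <-].
  exists eta; first by split=> //; exact/bounded1_2.
  by rewrite /= (theta_specE aN' finite_weight2 (theta_jT (theta_specP aM' finite_weight1 wb))).
have wb1 : weight_bounded M' w1 eta by exact/bounded1_2.
exists eta => //=.
by rewrite (theta_specE aN' finite_weight2 (theta_jT (theta_specP aM' finite_weight1 wb1))).
Qed.
End Functional.

Lemma jeps_index : kosaki_index N M jeps c%:E.
Proof.
exists jT; first split; first exact: jT_weight.
  by move=> phi psi _ [npsi _]; exact: spatial_eq.
move=> psi npsi; rewrite /jT.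
have -> : jT0 id = c%:C *: id by apply/funext => z; rewrite jT0E /= sum_m_m.
rewrite psiZ //; last exact: commutant_id.
by rewrite /Defs.ReE -EFinM -!/(re _) ReZ.
Qed.

(** * Minimality among all expectations *)

Hypothesis M_cyclic : forall zeta (r : R), 0 < r ->
  exists2 x, M x & rn (x Omega - zeta) < r.
Hypothesis Omega1 : rn Omega = 1.
Hypothesis m'_Omega : forall i, m' i Omega = adj (m i) Omega.
Hypothesis sum_m'_m' : forall xi, \sum_i adj (m' i) (m' i xi) = c%:C *: xi.
Variable nu : I -> H -> H.
Hypothesis N_nu : forall i, N (nu i).
Hypothesis nu_orth : forall i j xi, adj (nu i) (nu j xi) = (i == j)%:R *: xi.
Hypothesis c_gt0 : 0 < c.

Let bnu i : bounded_op (nu i). Proof. exact/bM/NM. Qed.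

Definition jv : H -> H := \sum_j (nu j \o adj (m j)).

Lemma M_jv : M jv.
Proof.
have [lM _ _ _] := aM; apply: lin_closed_sum => // j _.
by apply: compM; [exact: NM|exact: adjM].
Qed.

Lemma jvE xi : jv xi = \sum_j nu j (adj (m j) xi).
Proof. by rewrite /jv fct_sumE. Qed.

Lemma nu_jv i xi : adj (nu i) (jv xi) = adj (m i) xi.
Proof.
rewrite jvE (op_sum _ _ _ (bounded_adj (bnu i))) (bigD1 i) //= big1 => [|j ji].
  by rewrite nu_orth eqxx scale1r addr0.
by rewrite nu_orth eq_sym (negPf ji) scale0r.
Qed.

Lemma adj_jvE xi : adj jv xi = \sum_j m j (adj (nu j) xi).
Proof.
apply: ip_ext => eta; rewrite (ip_adjl (bM M_jv)) jvE ip_sumr ip_suml.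
by apply: eq_bigr => j _; rewrite (ip_adjr (bm j)) (ip_adjl (bnu j)).
Qed.

Lemma adj_jv_jv xi : adj jv (jv xi) = c%:C *: xi.
Proof. by rewrite adj_jvE -(sum_m_m xi); apply: eq_bigr => j _; rewrite nu_jv. Qed.

Lemma separating' y : M' y -> y Omega = 0 -> y = 0.
Proof.
move=> M'y y0; apply/funext => xi; apply/rn_le0/ler_addgt0Pr => r r0; rewrite add0r.
have [_ [k k0 hk]] := (bounded_opP y).1 (bM' M'y).
have [x Mx hx] := M_cyclic xi (divr_gt0 r0 k0).
have : y (x Omega) = 0 by rewrite (comm_MM' Mx M'y) y0 (op0 (bM Mx)).
move=> xy; rewrite -[y xi]subr0 -xy -(opB (bM' M'y)) (le_trans (hk _)) //.
by rewrite rn_distrC mulrC -ler_pdivlMr // ltW.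
Qed.

Let psi := vector_functional Omega.

Lemma npsi_Omega : normal_functional M' psi.
Proof. exact: vector_functional_normal. Qed.

Lemma faithful_Omega : faithful_normal_functional M' psi.
Proof.
split; first exact: npsi_Omega.
by move=> x [M'x px] /(pos_ker (bM' M'x) px) /(separating' M'x).
Qed.

Lemma psi_Omega_sq y : bounded_op y -> re (psi (adj y \o y)) = rn (y Omega) ^+ 2.
Proof. by move=> hy; rewrite /psi /vector_functional dotp_adj_self. Qed.

Lemma Omega_bounded x : M x -> weight_bounded M' (fun y => Defs.ReE (psi y)) (x Omega).
Proof.
move=> Mx; have [_ [k k0 hk]] := (bounded_opP x).1 (bM Mx).
apply/(weight_boundedP aM' (finite_weight1 npsi_Omega)).
exists (k ^+ 2); first exact: sqr_ge0.
move=> y M'y; rewrite /= -/(re _) psi_Omega_sq; last exact: bM'.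
rewrite (comm_MM' Mx M'y) -exprMn ler_pXn2r ?nnegrE ?rn_ge0 //.
by rewrite mulr_ge0 ?rn_ge0 // ltW.
Qed.

(** As M' Omega is dense, the GNS space of psi is H itself, and R(x Omega) maps y Omega to y x Omega
    = x y Omega, so it equals x. *)
Lemma theta_Omega x : M x ->
  theta M' (fun y => Defs.ReE (psi y)) (x Omega) = x \o adj x.
Proof.
move=> Mx; have := theta_specP aM' (finite_weight1 npsi_Omega) (Omega_bounded Mx).
set t := theta _ _ _ => -[bt ht].
have bx := bM Mx.
apply: op_ext => //; first exact: bounded_comp bx (bounded_adj bx).
move=> zeta; have [h1 h2 h3] := ht zeta.
have -> : dotp ((x \o adj x) zeta) zeta = (rn (adj x zeta) ^+ 2)%:C.
  by rewrite /= (ip_adjr bx) ipxx.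
rewrite (ge0_rc h1); congr (_%:C); set T := re _.
set eta := adj x zeta; set a0 := rn eta.
have a00 : 0 <= a0 := rn_ge0 eta.
have T0 : 0 <= T by exact: ge0_Re.
have yxE y : M' y -> dotp (y (x Omega)) zeta = dotp (y Omega) eta.
  by move=> M'y; rewrite (comm_MM' Mx M'y) (ip_adjr bx).
apply/eqP; rewrite eq_le; apply/andP; split.
  apply/ler_addgt0Pr => d0 d00; have [y [M'y wy] hy] := h3 d0 d00.
  apply: (le_trans (ltW hy)); rewrite lerD2r yxE //.
  move: wy; rewrite lee_fin -/(re _) psi_Omega_sq; last exact: bM'.
  move=> y1; have := ip_CS (y Omega) eta.
  rewrite -(@ler_pXn2r _ 2) ?nnegrE ?mulr_ge0 ?rn_ge0 // => h.
  by rewrite (le_trans h) // exprMn ler_piMl ?sqr_ge0.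
rewrite leNgt; apply/negP => Ta.
have ap : 0 < a0.
  rewrite lt0r a00 andbT; apply/eqP => az; move: Ta.
  by rewrite az expr0n /= ltNge T0.
have a2 : 0 < a0 ^+ 2 by rewrite exprn_gt0.
(* A tenth of the relative gap: approximating eta by y Omega up to ep |eta| loses at most 5 ep a0^2,
   while the gap is 10 ep a0^2. *)
set ep := (a0 ^+ 2 - T) / (10 * a0 ^+ 2).
have epE : ep * (10 * a0 ^+ 2) = a0 ^+ 2 - T.
  by rewrite divfK // mulf_neq0 ?pnatr_eq0 // gt_eqF.
have ep0 : 0 < ep by rewrite divr_gt0 ?subr_gt0 ?mulr_gt0.
have ep1 : ep <= 1 by rewrite ler_pdivrMr ?mulr_gt0 //; lra.
have [y M'y hy] := M'_dense eta (mulr_gt0 ep0 ap).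
have := h2 y M'y; rewrite /= -!/(re _) -/T psi_Omega_sq ?yxE //; last exact: bM'.
have n1 : rn (y Omega) <= a0 * (1 + ep).
  by have := rn_triangle eta (y Omega) 0; rewrite !subr0 -/a0; lra.
have n2 : a0 ^+ 2 * (1 - ep) <= rn (dotp (y Omega) eta).
  have := rn_triangle (dotp (y Omega) eta) (dotp eta eta) 0; rewrite !subr0.
  rewrite {1}ipxx rn_rc ger0_norm ?sqr_ge0 // -/a0.
  rewrite (rn_distrC (dotp eta eta)) -ipBl => h4.
  have := ip_CS (y Omega - eta) eta; rewrite -/a0.
  have : rn (y Omega - eta) * a0 <= ep * a0 * a0 by rewrite ler_wpM2r // ltW.
  rewrite expr2; move: h4; rewrite expr2; lra.
have n3 : (a0 ^+ 2 * (1 - ep)) ^+ 2 <= rn (dotp (y Omega) eta) ^+ 2.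
  by rewrite ler_pXn2r ?nnegrE ?rn_ge0 ?mulr_ge0 ?sqr_ge0 // subr_ge0.
have n4 : rn (y Omega) ^+ 2 * T <= (a0 * (1 + ep)) ^+ 2 * T.
  rewrite ler_wpM2r // ler_pXn2r ?nnegrE ?rn_ge0 ?mulr_ge0 //.
  by rewrite addr_ge0 // ltW.
move=> n5; have : a0 ^+ 2 * (a0 ^+ 2 * (1 - ep) ^+ 2) <= a0 ^+ 2 * ((1 + ep) ^+ 2 * T).
  by have := le_trans n3 (le_trans n5 n4); rewrite !exprMn; lra.
rewrite ler_pM2l // => n6.
have k1 : 1 - 2 * ep <= (1 - ep) ^+ 2 by have := sqr_ge0 ep; lra.
have k2 : (1 + ep) ^+ 2 <= 1 + 3 * ep by nra.
have k3 : a0 ^+ 2 * (1 - 2 * ep) <= (1 + 3 * ep) * T.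
  apply: (le_trans _ (le_trans n6 _)); last by rewrite ler_wpM2r.
  by rewrite ler_wpM2l // ltW.
have k4 : ep * T <= ep * a0 ^+ 2 by rewrite ler_wpM2l ?(ltW ep0) // ltW.
have := mulr_gt0 ep0 a2; lra.
Qed.

Section OtherExpectation.
Variable eps' : (H -> H) -> H -> H.
Hypothesis heps : fn_conditional_expectation N M eps'.

Lemma eps'_lin (r : R[i]) x y : M x -> M y -> eps' (r *: x + y) = r *: eps' x + eps' y.
Proof. by case: heps => [[_ _ h _]] _ _ _; exact: h. Qed.

Lemma eps'_sum (J : finType) (F : J -> H -> H) : (forall i, M (F i)) ->
  eps' (\sum_i F i) = \sum_i eps' (F i).
Proof.
move=> hF; have [lM _ _ _] := aM.
suff [_ ->] : M (\sum_i F i) /\ eps' (\sum_i F i) = \sum_i eps' (F i) by [].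
elim/big_rec2: _ => [|i y x _ [hx ex]].
  split; first exact: lM.1.
  have [[_ h _ _] _ _ _] := heps; apply: h; have [[]] := aN; done.
split; first exact: lin_closedD.
by have := eps'_lin 1 (hF i) hx; rewrite !scale1r ex.
Qed.

(** The density h of eps' with respect to eps, found by applying eps' to x = sum_k m_k eps(m_k^*
    x). *)
Definition jh : H -> H := \sum_k (eps' (m k) \o adj (m k)).

Lemma N_eps' x : M x -> N (eps' x).
Proof. by case: heps => [[h _ _ _]] _ _ _; exact: h. Qed.

Lemma M_jh : M jh.
Proof.
have [lM _ _ _] := aM; apply: lin_closed_sum => // j _.
by apply: compM; [exact/NM/N_eps'|exact: adjM].
Qed.

Lemma N_id : N id. Proof. by case: aN. Qed.

Lemma eps'_jeps x : M x -> eps' x = jeps (jh \o x).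
Proof.
move=> Mx; have [[_ _ _ bi] _ _ _] := heps.
have Mmx k : M (adj (m k) \o x) by apply: compM => //; exact: adjM.
have -> : jeps (jh \o x) = \sum_k jeps (eps' (m k) \o (adj (m k) \o x)).
  apply/funext => xi; rewrite fct_sumE.
  under [RHS]eq_bigr => k _ do rewrite jepsE.
  rewrite jepsE exchange_big /=; apply: eq_bigr => k _.
  by rewrite /jh fct_sumE (op_sum _ _ _ be) (op_sum _ _ _ (bm' k)).
have {1}-> : x = \sum_k (m k \o jeps (adj (m k) \o x)).
  by apply/funext => xi; rewrite fct_sumE -(M_expandl Mx).
rewrite eps'_sum => [|k]; last by apply: compM => //; exact/NM/jeps_N.
apply: eq_bigr => k _.
have -> : eps' (m k \o jeps (adj (m k) \o x)) = eps' (m k) \o jeps (adj (m k) \o x).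
  exact: (bi id (m k) (jeps (adj (m k) \o x)) N_id (Mm k) (jeps_N (Mmx k))).
by apply/esym; exact: (jeps_bimod (N_eps' (Mm k)) (Mmx k) N_id).
Qed.

Lemma jeps_jh : jeps jh = id.
Proof.
have [[_ h _ _] _ _ _] := heps; have Mid : M id by case: aM.
by rewrite -(h _ N_id) (eps'_jeps Mid).
Qed.

Lemma jh_Omega : dotp (jh Omega) Omega = 1.
Proof.
have := jeps_e M_jh Omega; rewrite e_Omega jeps_jh /= => h.
have es xi eta : dotp (e xi) eta = dotp xi (e eta) by rewrite -{1}adj_e (ip_adjl be).
by rewrite -{2}e_Omega -es -h ipxx Omega1 expr1n.
Qed.

(** The nu_j lie in N and leave eps' untouched; since they are orthogonal, the left side is sum_ij
    <eps'(m_i^* m_j) m_j^* Omega, m_i^* Omega> = sum_i <h m_i^* Omega, m_i^* Omega>. Now m_i^* Omega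
    = m'_i Omega and m'_i commutes with h, so c <h Omega, Omega> = c remains whatever eps' is. *)
Lemma eps'_jv : dotp (eps' (jv \o adj jv) (jv Omega)) (jv Omega) = c%:C.
Proof.
have [[_ _ _ bi] _ _ _] := heps.
have Mmm i j : M (adj (m i) \o m j) by apply: compM => //; exact: adjM.
have -> : jv \o adj jv =
    \sum_i \sum_j (nu i \o (adj (m i) \o m j) \o adj (nu j)).
  apply/funext => xi; rewrite fct_sumE /= jvE; apply: eq_bigr => i _.
  rewrite fct_sumE adj_jvE (op_sum _ _ _ (bounded_adj (bm i))) (op_sum _ _ _ (bnu i)).
  by apply: eq_bigr => j _.
have [lM _ _ _] := aM.
have Mt i j : M (nu i \o (adj (m i) \o m j) \o adj (nu j)).
  by apply: compM; [apply: compM => //; exact: NM|exact/adjM/NM].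
have adjN i : N (adj (nu i)) by have [] := stN (N_nu i).
rewrite eps'_sum => [|i]; last by apply: lin_closed_sum => // j _; exact: Mt.
rewrite fct_sumE ip_suml.
have term i : dotp (eps' (\sum_j (nu i \o (adj (m i) \o m j) \o adj (nu j)))
    (jv Omega)) (jv Omega) = dotp (jh Omega) (adj (m' i) (m' i Omega)).
  rewrite eps'_sum // fct_sumE ip_suml.
  under eq_bigr => j _ do rewrite (bi _ _ _ (N_nu i) (Mmm i j) (adjN j)) /= nu_jv
    (ip_adjr (bnu i)) nu_jv.
  rewrite -ip_suml.
  have -> : \sum_j eps' (adj (m i) \o m j) (adj (m j) Omega) = jh (adj (m i) Omega).
    have Mx : M (jh \o adj (m i)) by apply: compM; [exact: M_jh|exact: adjM].
    rewrite -[RHS]/((jh \o adj (m i)) Omega) -(M_expandr Mx Omega).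
    by apply: eq_bigr => j _; rewrite (eps'_jeps (Mmm i j)).
  by rewrite -m'_Omega -(comm_MM' M_jh (M'm i)) (ip_adjr (bm' i)).
under eq_bigr => i _ do rewrite term.
by rewrite -ip_sumr sum_m'_m' ipZr conj_rc jh_Omega mulr1.
Qed.

Lemma index_ge c' : kosaki_index N M eps' c' -> (c%:E <= c')%E.
Proof.
move=> [T [hT hE] hid].
have npsi := npsi_Omega; have [faith_psi _] := faithful_Omega.
have psi1 : psi id = 1 by rewrite /psi /vector_functional ipxx Omega1 expr1n.
have Tid : T id psi = c' by rewrite hid // psi1 /Defs.ReE /= mule1.
have [T1 T2 T3 [T4 T5 T6]] := hT.
have pid : positive_part N' id.
  by split; [exact: commutant_id|apply/op_le0P => xi; rewrite ipxx ler0c sqr_ge0].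
have c'0 : (0 <= c')%E by rewrite -Tid; have [h _ _] := T1 _ pid; exact: h.
rewrite leNgt; apply/negP => c'c.
have [r c'E] : exists r : R, c' = r%:E.
  by move: c'0 c'c; case: (c') => [r| |] // _ _; exists r.
have r0 : 0 <= r by rewrite -lee_fin -c'E.
have rc : r < c by rewrite -lte_fin -c'E.
have [lN' _ _ _] := aN'.
(* T is a priori only semifinite. Finiteness of T at 1 spreads to x because x and k + 1 - x are both
   positive and add up to (k + 1) id. *)
have fw : finite_weight N' (fun x => T x psi).
  split=> [x px|s x y s0 px py]; last exact: T2.
  have [N'x p] := px.
  have Tge y : positive_part N' y -> (0 <= T y psi)%E.
    by move=> /T1[h _ _]; exact: h.
  have [k k0 hk] := bounded_le_scalar (bN' N'x).
  have py : positive_part N' ((k + 1)%:C *: id - x).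
    split; first by apply: (lin_closedB lN') => //; apply: lin_closedZ => //; case: pid.
    apply/op_le0P => xi; rewrite !fctE ipBl ipZl ipxx (pos_dotpE p) -rcM -rcB ler0c.
    by have := hk xi; have := sqr_ge0 (rn xi); lra.
  have e1 : (1%:C *: x + ((k + 1)%:C *: id - x) : H -> H) = k%:C *: id + id.
    apply/funext => xi; rewrite !fctE rcD scalerDl rmorph1 !scale1r.
    by rewrite addrC subrK.
  have := T2 1 x _ psi ler01 px py npsi.
  rewrite e1 T2 ?(ltW k0) // Tid c'E mul1e -EFinM -EFinD.
  have := Tge _ px; have := Tge _ py.
  case: (T x psi) => [u| |] //; first by move=> _ u0 _; exists u; rewrite -?lee_fin.
  by case: (T _ psi).
pose X := jv \o adj jv; have MX : M X by apply: compM; [exact: M_jv|exact/adjM/M_jv].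
have pX : op_le 0 X.
  apply/op_le0P => xi; rewrite /X /= (ip_adjr (bM M_jv)) ipxx ler0c.
  exact: sqr_ge0.
have [_ eps_pos _ _] := heps.
have peX := eps_pos X (conj MX pX).
have bN x : N x -> bounded_op x by case/stN.
have beX : bounded_op (eps' X) by exact/bN/N_eps'.
pose A := re (dotp (eps' X Omega) Omega).
have A0 : 0 <= A by exact/ge0_Re/(op_le0P _).1.
pose xi0 := jv Omega.
have xi0c : rn xi0 ^+ 2 = c.
  by rewrite -Re_ipxx /xi0 -(ip_adjl (bM M_jv)) adj_jv_jv ipZl ReZ Re_ipxx Omega1 expr1n mulr1.
(* Chosen so that K c (c - r) exceeds 2 r (A + 1), the bound to which the two estimates of the
   derivative will lead. *)
pose K := 2 * r * (A + 1) / (c * (c - r)) + 1.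
have cr0 : 0 < c * (c - r) by rewrite mulr_gt0 // subr_gt0.
have K0 : 0 < K.
  apply: ltr_wpDl => //; apply: divr_ge0; last exact: ltW.
  by rewrite !mulr_ge0 //; lra.
pose ka := Num.sqrt K; have ka2 : ka ^+ 2 = K by rewrite sqr_sqrtr // ltW.
pose phi x := vector_functional Omega x + vector_functional (ka%:C *: xi0) x.
have phiE x : bounded_op x ->
    phi x = dotp (x Omega) Omega + K%:C * dotp (x xi0) xi0.
  move=> bx; rewrite /phi /vector_functional (opZ bx) ipZl ipZr conj_rc mulrA.
  by rewrite -rcM -expr2 ka2.
have fphi : faithful_normal_functional N phi.
  split; first exact: vector_functional2_normal.
  move=> x [Nx px]; rewrite (phiE x (bN x Nx)) => h0.
  apply: (separating (NM Nx)); apply: (pos_ker (bN _ Nx) px).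
  have p1 := (op_le0P x).1 px Omega; have p2 := (op_le0P x).1 px xi0.
  apply/eqP; rewrite eq_le p1 andbT -h0 lerDl mulr_ge0 // ler0c.
  exact: ltW.
have Exi : spatial_derivative M' (phi \o eps') (fun x => Defs.ReE (psi x)) xi0 =
    spatial_derivative N' phi (fun x => T x psi) xi0.
  by rewrite (hE phi psi fphi faithful_Omega).
(* xi0 itself competes in the infimum for every radius, and there the value is phi(eps'(v v^* )) = A
   + K c. *)
have upper : (spatial_derivative M' (phi \o eps') (fun x => Defs.ReE (psi x)) xi0
    <= (A + K * c)%:E)%E.
  apply: ge_ereal_sup => _ [rho rho0 <-].
  apply: ereal_inf_lbound; exists xi0.
    split; first exact: Omega_bounded M_jv.
    by rewrite subrr normr0 ltcR.
  rewrite (theta_Omega M_jv) /= phiE // eps'_jv /Defs.ReE -/(re _) ReD -rcM.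
  by [].
(* Small enough that |<eta, xi0>| >= c - (c - r)/4 for every competitor eta, hence |<eta, xi0>|^2 >=
   c (c + r)/2. *)
pose rho := (c - r) / (4 * (rn xi0 + 1)).
have xi00 := rn_ge0 xi0.
have rho0 : 0 < rho by rewrite divr_gt0 ?subr_gt0 // mulr_gt0 // ltr_wpDl.
pose nearby := [set eta : H | weight_bounded N' (fun x => T x psi) eta /\
  `|eta - xi0| < rho%:C].
have lower : (ereal_inf [set Defs.ReE (phi (theta N' (fun x => T x psi) eta)) |
    eta in nearby] < (A + K * c + 1)%:E)%E.
  apply: (@le_lt_trans _ _ (A + K * c)%:E); last by rewrite lte_fin ltrDl.
  apply: le_trans upper; rewrite Exi; apply: ereal_sup_ubound.
  by exists rho.
have [_ [eta [wb near_eta] <-]] := ereal_inf_lt lower.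
have [bt ht] := theta_specP aN' fw wb; set t := theta _ _ _ in bt ht *.
rewrite lte_fin phiE // -/(re _) ReD ReZ.
have [p0 _ _] := ht Omega; have := ge0_Re p0.
have [p1 h1 _] := ht xi0; have := ge0_Re p1; set S := re _ in h1 *.
have N'id : N' id by case: pid.
(* The test element 1 gives |<eta, xi0>|^2 <= r <t xi0, xi0>, the only place where the index of eps'
   enters the estimate. *)
have := h1 id N'id; rewrite adj_id -[id \o id]/(id : H -> H) Tid c'E /=.
have d1 : rn xi0 ^+ 2 <= rn (dotp eta xi0) + rho * rn xi0.
  have := rn_triangle (dotp eta xi0) (dotp xi0 xi0) 0; rewrite !subr0.
  rewrite {1}ipxx rn_rc ger0_norm ?sqr_ge0 // -ipBl.
  have := ip_CS (xi0 - eta) xi0; have : rn (xi0 - eta) * rn xi0 <= rho * rn xi0.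
    rewrite ler_wpM2r // rn_distrC.
    by move: near_eta; rewrite norm_rn ltcR => /ltW.
  by lra.
have d2 : rho * rn xi0 <= (c - r) / 4.
  have z0 : 0 < rn xi0 + 1 by rewrite ltr_wpDl.
  have -> : (c - r) / 4 = rho * (rn xi0 + 1).
    by rewrite /rho invfM mulrA divfK // gt_eqF.
  by rewrite ler_pM2l // lerDl.
rewrite xi0c in d1.
have d3 : c - (c - r) / 4 <= rn (dotp eta xi0) by lra.
have KE : K * (c * (c - r)) = 2 * r * (A + 1) + c * (c - r).
  by rewrite /K; field; rewrite ?gt_eqF ?subr_gt0.
have c00 := c_gt0.
have d4 : c * (c + r) / 2 <= rn (dotp eta xi0) ^+ 2.
  apply: (@le_trans _ _ ((c - (c - r) / 4) ^+ 2)); last first.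
    by rewrite ler_pXn2r ?nnegrE ?rn_ge0 //; lra.
  by have := sqr_ge0 (c - r); lra.
move: (rn (dotp eta xi0)) d4 => g d4 g2 S0 w0 hlt.
have d5 : K * (c * (c + r) / 2) <= r * (K * S).
  rewrite [leRHS]mulrCA; apply: ler_wpM2l; first exact: ltW.
  exact: le_trans d4 g2.
have d6 : r * (K * S) <= r * (A + K * c + 1) by rewrite ler_wpM2l //; lra.
by move: d5 d6 KE cr0; lra.
Qed.
End OtherExpectation.

Theorem jones_minimal_index : minimal_index N M c%:E.
Proof.
split; first by exists jeps; [exact: jeps_expectation|exact: jeps_index].
by move=> eps c' heps; exact: index_ge.
Qed.
End JonesData.

(** * Algebras with a C*-norm and their representations *)

Definition cnorm_cvg (R : realType) (A : cstarAlgType R) (u : nat -> A) (l : A) : Prop :=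
  forall e : R, 0 < e -> exists N : nat, forall n, (N <= n)%N -> cnorm (u n - l) < e.

Definition closed_subspace (R : realType) (A : cstarAlgType R) (Q : set A) : Prop :=
  (forall (a : R[i]) x y, Q x -> Q y -> Q (a *: x + y)) /\ cnorm_closed Q.

Section CStarAlgebras.
Variables (R : realType) (A : cstarAlgType R).
Implicit Types (x y z : A) (a : R[i]).

Lemma cnorm0 : cnorm (0 : A) = 0.
Proof. by rewrite -(scale0r (0 : A)) cnormZ normr0 mul0r. Qed.

Lemma cnormN x : cnorm (- x) = cnorm x.
Proof. by rewrite -scaleN1r cnormZ normrN1 mul1r. Qed.

Lemma cnorm_ge0 x : 0 <= cnorm x.
Proof. by have := cnormD_le x (- x); rewrite subrr cnorm0 cnormN; lra. Qed.

Lemma cnorm_distrC x y : cnorm (x - y) = cnorm (y - x).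
Proof. by rewrite -cnormN opprB. Qed.

Lemma cnorm_triangle y x z : cnorm (x - z) <= cnorm (x - y) + cnorm (y - z).
Proof. by rewrite (le_trans _ (cnormD_le _ _)) // addrA subrK. Qed.

Lemma starD x y : star (x + y) = star x + star y.
Proof. by have := star_antilinear 1 x y; rewrite !scale1r conjC1 scale1r. Qed.

Lemma star0 : star (0 : A) = 0.
Proof.
by have := starD 0 0; rewrite addr0 => /(f_equal (fun z => z - star 0)); rewrite subrr addrK.
Qed.

Lemma starZ a x : star (a *: x) = Num.conj a *: star x.
Proof. by have := star_antilinear a x 0; rewrite star0 !addr0. Qed.

Lemma starN x : star (- x) = - star x.
Proof. by rewrite -scaleN1r starZ rmorphN1 scaleN1r. Qed.

Lemma starB x y : star (x - y) = star x - star y.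
Proof. by rewrite starD starN. Qed.

Lemma star1 : star (1 : A) = 1.
Proof. by rewrite -[LHS]mulr1 -{2}(starK (1 : A)) -starM mulr1 starK. Qed.

Lemma star_sum (I : Type) (r : seq I) (P : pred I) (F : I -> A) :
  star (\sum_(i <- r | P i) F i) = \sum_(i <- r | P i) star (F i).
Proof. exact: (big_morph _ starD star0). Qed.

Lemma cnorm_star_le x : cnorm x <= cnorm (star x).
Proof.
have [z|nz] := eqVneq (cnorm x) 0; first by rewrite z cnorm_ge0.
have p : 0 < cnorm x by rewrite lt0r nz cnorm_ge0.
by rewrite -(ler_pM2r p) -expr2 -cstar_identity cnormM_le.
Qed.

Lemma cnorm_star x : cnorm (star x) = cnorm x.
Proof.
by apply/eqP; rewrite eq_le cnorm_star_le -{2}(starK x) cnorm_star_le.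
Qed.

Lemma cnorm_cvgP (u : nat -> A) l :
  ((fun n => cnorm (u n - l)) @ \oo --> (0 : R)) <-> cnorm_cvg u l.
Proof.
split=> [h e e0|h].
  have /cvgrPdist_lt/(_ e e0)[N _ hN] := h; exists N => n /hN /=.
  by rewrite sub0r normrN ger0_norm // cnorm_ge0.
apply/cvgrPdist_lt => e e0; have [N hN] := h e e0; exists N => // n /hN /=.
by rewrite sub0r normrN ger0_norm // cnorm_ge0.
Qed.

Lemma cnorm_cvg_unique (u : nat -> A) l l' : cnorm_cvg u l -> cnorm_cvg u l' -> l = l'.
Proof.
move=> h h'; apply/eqP; rewrite -subr_eq0; apply/eqP/cnorm0_eq0/eqP.
rewrite eq_le cnorm_ge0 andbT; apply/ler_addgt0Pr => e e0; rewrite add0r.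
have e2 : 0 < e / 2 by lra.
have [N hN] := h _ e2; have [K hK] := h' _ e2.
have := hN _ (leq_maxl N K); have := hK _ (leq_maxr N K); set n := maxn N K.
by have := cnorm_triangle (u n) l l'; rewrite (cnorm_distrC l (u n)); lra.
Qed.

Lemma cnorm_cvg_cst x : cnorm_cvg (fun=> x) x.
Proof. by move=> e e0; exists 0%N => n _; rewrite subrr cnorm0. Qed.

Lemma cnorm_cvgM b c (u : nat -> A) l : cnorm_cvg u l -> cnorm_cvg (fun n => b * u n * c) (b * l * c).
Proof.
move=> h e e0; have k0 : 0 < cnorm b * cnorm c + 1.
  by rewrite ltr_wpDl // mulr_ge0 ?cnorm_ge0.
have [N hN] := h _ (divr_gt0 e0 k0); exists N => n /hN.
rewrite ltr_pdivlMr // => h1; rewrite -mulrBl -mulrBr.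
apply: le_lt_trans h1; rewrite (le_trans (cnormM_le _ _)) //.
have := cnormM_le b (u n - l); have := cnorm_ge0 c; have := cnorm_ge0 (u n - l).
have := cnorm_ge0 b; nra.
Qed.

Lemma cnorm_cvg_star (u : nat -> A) l : cnorm_cvg u l -> cnorm_cvg (fun n => star (u n)) (star l).
Proof. by move=> h e /h[N hN]; exists N => n /hN; rewrite -starB cnorm_star. Qed.

Lemma geometric_small (q e : R) : 0 <= q -> q < 1 -> 0 < e ->
  exists N, forall n, (N <= n)%N -> q ^+ n < e.
Proof.
move=> q0 q1 e0; have : (GRing.exp q) @ \oo --> 0 by apply: cvg_expr; rewrite ger0_norm.
move=> /cvgrPdist_lt/(_ e e0)[N _ hN]; exists N => n /hN /=.
by rewrite sub0r normrN ger0_norm // exprn_ge0.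
Qed.

Lemma cnormX x n : cnorm (x ^+ n) <= cnorm (1 : A) * cnorm x ^+ n.
Proof.
elim: n => [|n IH]; first by rewrite !expr0 mulr1.
rewrite exprSr (le_trans (cnormM_le _ _)) // exprSr mulrA ler_wpM2r //.
exact: cnorm_ge0.
Qed.

(** The geometric series. A left inverse is what [rep_contractive] requires, to recover a vector
    from its image under 1 - x. *)
Lemma neumann x : cnorm x < 1 -> exists b, b * (1 - x) = 1.
Proof.
move=> x1; set q := cnorm x; set k := cnorm (1 : A).
have q0 : 0 <= q := cnorm_ge0 x; have k0 : 0 <= k := cnorm_ge0 1.
pose u n := \sum_(i < n) x ^+ i.
have uE n : u n * (1 - x) = 1 - x ^+ n.
  elim: n => [|n IH]; first by rewrite /u big_ord0 mul0r expr0 subrr.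
  rewrite /u big_ord_recr /= mulrDl -/(u n) IH mulrBr mulr1 -exprSr.
  by rewrite addrA subrK.
have tail n d : cnorm (u (n + d)%N - u n) * (1 - q) <= k * q ^+ n * (1 - q ^+ d).
  elim: d => [|d IH]; first by rewrite addn0 subrr cnorm0 mul0r expr0 subrr mulr0.
  have -> : u (n + d.+1)%N - u n = (u (n + d)%N - u n) + x ^+ (n + d).
    by rewrite addnS /u big_ord_recr /= addrAC.
  have h1 : 0 <= 1 - q by rewrite subr_ge0 ltW.
  apply: (le_trans (ler_wpM2r h1 (cnormD_le _ _))).
  have h2 : cnorm (x ^+ (n + d)) * (1 - q) <= k * (q ^+ n * q ^+ d) * (1 - q).
    by rewrite ler_wpM2r // -exprD cnormX.
  by move: IH h2; rewrite exprS mulrDl; lra.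
have [b hb] : exists b, cnorm_cvg u b.
  have [|b hb] := @cnorm_complete _ _ u; last by exists b; apply/cnorm_cvgP.
  move=> e e0; have q1 : 0 < 1 - q by rewrite subr_gt0.
  have k1 : 0 < k + 1 by lra.
  have e1 : 0 < e * (1 - q) / (k + 1) by rewrite divr_gt0 ?mulr_gt0.
  have [N hN] := geometric_small q0 x1 e1; exists N.
  have key n d : (N <= n)%N -> cnorm (u (n + d)%N - u n) < e.
    move=> /hN; rewrite ltr_pdivlMr // => h.
    rewrite -(ltr_pM2r q1) (le_lt_trans (tail n d)) // (le_lt_trans _ h) //.
    have a1 := exprn_ge0 n q0; have a2 := exprn_ge0 d q0.
    have a3 : k * q ^+ n * q ^+ d >= 0 by rewrite !mulr_ge0.
    lra.
  move=> m n hm hn; have [mn|nm] := leqP m n.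
    by rewrite cnorm_distrC -(subnKC mn); exact: key.
  by rewrite -(subnKC (ltnW nm)); exact: key.
exists b; apply: (@cnorm_cvg_unique (fun n => 1 * u n * (1 - x))).
  by have := cnorm_cvgM 1 (1 - x) hb; rewrite mul1r.
move=> e e0; have k1 : 0 < k + 1 by lra.
have [N hN] := geometric_small q0 x1 (divr_gt0 e0 k1); exists N => n /hN.
rewrite mul1r uE addrAC subrr add0r cnormN ltr_pdivlMr // => h.
rewrite (le_lt_trans (cnormX _ _)) // -/k -/q.
have := exprn_ge0 n q0; lra.
Qed.
End CStarAlgebras.

Definition star_rep (R : realType) (A : cstarAlgType R) (H : hilbertType R)
    (pi : A -> H -> H) : Prop :=
  [/\ forall x, bounded_op (pi x), pi 1 = id,
      forall (a : R[i]) x y, pi (a *: x + y) = a *: pi x + pi y,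
      forall x y, pi (x * y) = pi x \o pi y &
      forall x (xi eta : H), dotp (pi (star x) xi) eta = dotp xi (pi x eta)].

Section Representations.
Variables (R : realType) (A : cstarAlgType R) (H : hilbertType R) (pi : A -> H -> H).
Hypothesis hpi : star_rep pi.
Implicit Types (x y : A) (xi eta : H).

Lemma rep_bounded x : bounded_op (pi x).
Proof. by case: hpi. Qed.
Lemma rep1 xi : pi 1 xi = xi.
Proof. by case: hpi => _ -> _ _ _. Qed.
Lemma repL a x y xi : pi (a *: x + y) xi = a *: pi x xi + pi y xi.
Proof. by case: hpi => _ _ -> _ _. Qed.
Lemma repM x y xi : pi (x * y) xi = pi x (pi y xi).
Proof. by case: hpi => _ _ _ -> _. Qed.
Lemma rep_star x : adj (pi x) = pi (star x).
Proof. by case: hpi => _ _ _ _ h; apply: adj_eq => xi eta; rewrite h. Qed.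
Lemma rep0 xi : pi 0 xi = 0.
Proof. by have := repL (-1) 0 0 xi; rewrite scaler0 addr0 scaleN1r addNr. Qed.
Lemma repD x y xi : pi (x + y) xi = pi x xi + pi y xi.
Proof. by have := repL 1 x y xi; rewrite !scale1r. Qed.
Lemma repZ a x xi : pi (a *: x) xi = a *: pi x xi.
Proof. by have := repL a x 0 xi; rewrite rep0 !addr0. Qed.
Lemma repB x y xi : pi (x - y) xi = pi x xi - pi y xi.
Proof. by have := repL (-1) y x xi; rewrite !scaleN1r addrC => ->; rewrite addrC. Qed.
Lemma rep_sum (I : Type) (r : seq I) (P : pred I) (F : I -> A) xi :
  pi (\sum_(i <- r | P i) F i) xi = \sum_(i <- r | P i) pi (F i) xi.
Proof. exact: (big_morph (fun x => pi x xi) (fun x y => repD x y xi) (rep0 xi)). Qed.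
Lemma rep_ipl x xi eta : dotp (pi x xi) eta = dotp xi (pi (star x) eta).
Proof. by rewrite (ip_adjr (rep_bounded x)) rep_star. Qed.
(* Approximate eigenvectors of pi(x)^* pi(x) at the square of its norm would
   contradict the invertibility of |pi(x)|^2 - x^* x. *)
Lemma rep_contractive x xi : rn (pi x xi) <= cnorm x * rn xi.
Proof.
have bx := rep_bounded x.
have [_ [k k0 hk]] := (bounded_opP (pi x)).1 bx.
pose S := [set rn (pi x eta) | eta in [set eta : H | rn eta <= 1]].
have S0 : has_sup S.
  split; first by exists 0, 0; rewrite /= ?(op0 bx) ?rn0 // ler01.
  exists k => _ [eta /= e1 <-]; rewrite (le_trans (hk _)) //.
  by rewrite -[leRHS]mulr1 ler_wpM2l // ltW.
set m := sup S.
have m_ub eta : rn (pi x eta) <= m * rn eta.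
  have [z|nz] := eqVneq (rn eta) 0.
    by rewrite (rn0_eq0 z) (op0 bx) !rn0 mulr0.
  have p : 0 < rn eta by rewrite lt0r nz rn_ge0.
  have pi0 : 0 <= (rn eta)^-1 by rewrite invr_ge0 ltW.
  rewrite -ler_pdivrMr //; apply: ub_le_sup; first exact: S0.2.
  exists ((rn eta)^-1%:C *: eta) => /=.
    by rewrite rnZ rn_rc ger0_norm // mulVf.
  by rewrite (opZ bx) rnZ rn_rc ger0_norm // mulrC.
have m0 : 0 <= m.
  by rewrite (@le_trans _ _ (rn (pi x 0))) ?rn_ge0 // ub_le_sup //;
    [exact: S0.2|exists 0 => //=; rewrite rn0 ler01].
suff mx : m <= cnorm x by rewrite (le_trans (m_ub xi)) // ler_wpM2r // rn_ge0.
rewrite leNgt; apply/negP => xm.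
have mp : 0 < m by rewrite (le_lt_trans (cnorm_ge0 x)).
have m2 : 0 < m ^+ 2 by rewrite exprn_gt0.
have hx1 : cnorm ((m ^+ 2)^-1%:C *: (star x * x)) < 1.
  rewrite cnormZ -/(re _) -/(rn _) rn_rc ger0_norm ?invr_ge0 ?sqr_ge0 //.
  rewrite ltr_pdivrMl // mulr1 cstar_identity.
  by rewrite ltr_pXn2r ?nnegrE ?cnorm_ge0.
have [b hb] := neumann hx1.
have [_ [l l0 hl]] := (bounded_opP (pi b)).1 (rep_bounded b).
have adj_ub eta : rn (pi (star x) eta) <= m * rn eta.
  have [->|nz] := eqVneq (rn (pi (star x) eta)) 0; first by rewrite mulr_ge0 ?rn_ge0.
  have p : 0 < rn (pi (star x) eta) by rewrite lt0r nz rn_ge0.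
  rewrite -(ler_pM2r p) -expr2 -Re_ipxx rep_ipl starK.
  rewrite (le_trans (Re_le_rn' _)) // (le_trans (ip_CS _ _)) //.
  rewrite -mulrA mulrCA; apply: ler_wpM2l; first exact: rn_ge0.
  exact: m_ub.
(* For an almost maximizing eta, |eta - m^-2 x^* x eta|^2 <= 1 - |x eta|^2 / m^2 <= 2 d / m.
   Applying b gives 1/4 <= |eta|^2 <= c d, while d is chosen to make c d at most 1/8. *)
pose c := l ^+ 2 * 2 / m.
have c0 : 0 <= c by rewrite divr_ge0 ?mulr_ge0 ?(ltW l0).
pose d := Num.min (m / 2) ((c + 1)^-1 / 8).
have d0 : 0 < d by rewrite lt_min !divr_gt0 ?invr_gt0 // ltr_wpDl.
have [_ [eta /= e1 <-] heta] := sup_adherent d0 S0.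
rewrite -/m in heta.
have dm : d <= m / 2 by rewrite ge_min lexx.
have dc : d * (c + 1) <= 8^-1.
  have c1 : 0 < c + 1 by lra.
  by rewrite -ler_pdivlMr // [leRHS]mulrC ge_min lexx orbT.
have half : 2^-1 <= rn eta.
  rewrite -(ler_pM2l mp) (le_trans _ (m_ub eta)) //.
  by apply: le_trans (ltW heta); lra.
have eq_eta : eta = pi b (eta - (m ^+ 2)^-1%:C *: pi (star x) (pi x eta)).
  by rewrite -repM -repZ -[X in X - _]rep1 -repB -repM hb rep1.
have : rn eta ^+ 2 <= l ^+ 2 * rn (eta - (m ^+ 2)^-1%:C *: pi (star x) (pi x eta)) ^+ 2.
  rewrite -exprMn ler_pXn2r ?nnegrE ?mulr_ge0 ?rn_ge0 ?(ltW l0) //.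
  by rewrite {1}eq_eta.
rewrite rn2B ipZr conj_rc ReZ -rep_ipl Re_ipxx rnZ rn_rc exprMn.
rewrite ger0_norm ?invr_ge0 ?sqr_ge0 //.
have t1 := adj_ub (pi x eta).
have t2 : rn (pi (star x) (pi x eta)) ^+ 2 <= m ^+ 2 * rn (pi x eta) ^+ 2.
  by rewrite -exprMn ler_pXn2r ?nnegrE ?mulr_ge0 ?rn_ge0.
have t3 : (m ^+ 2)^-1 ^+ 2 * rn (pi (star x) (pi x eta)) ^+ 2 <=
    (m ^+ 2)^-1 * rn (pi x eta) ^+ 2.
  rewrite expr2 -mulrA ler_wpM2l ?invr_ge0 ?sqr_ge0 //.
  by rewrite ler_pdivrMl.
have t4 : rn eta ^+ 2 <= 1 by rewrite expr_le1 ?rn_ge0.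
have t5 : m ^+ 2 - 2 * m * d <= rn (pi x eta) ^+ 2.
  have : (m - d) ^+ 2 <= rn (pi x eta) ^+ 2.
    by rewrite ler_pXn2r ?nnegrE ?rn_ge0 ?(ltW heta) //; lra.
  by have := sqr_ge0 d; lra.
have t6 : 1 - 2 * d / m <= (m ^+ 2)^-1 * rn (pi x eta) ^+ 2.
  rewrite [leRHS]mulrC ler_pdivlMr // mulrBl mul1r.
  have -> : 2 * d / m * m ^+ 2 = 2 * m * d by field; rewrite gt_eqF.
  by [].
have t7 : 2^-1 ^+ 2 <= rn eta ^+ 2 by rewrite ler_pXn2r ?nnegrE ?rn_ge0 ?invr_ge0.
move=> t8; have t9 : l ^+ 2 * (2 * d / m) = c * d by rewrite /c; field; rewrite gt_eqF.
have : rn eta ^+ 2 <= l ^+ 2 * (2 * d / m).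
  apply: (le_trans t8); rewrite ler_wpM2l ?sqr_ge0 //.
  move: t3 t4 t6; move: (_^-1 ^+ 2 * _) (_^-1 * _) (2 * d / m) => U W V.
  by lra.
rewrite t9; have : d * (c + 1) = c * d + d by ring.
by lra.
Qed.

Lemma rep_seqlim (u : nat -> A) l xi : cnorm_cvg u l ->
  seqlim (fun n => pi (u n) xi) (pi l xi).
Proof.
move=> h e e0; have k0 : 0 < rn xi + 1 by have := rn_ge0 xi; lra.
have [N hN] := h _ (divr_gt0 e0 k0); exists N => n /hN.
rewrite ltr_pdivlMr // => h1; rewrite -repB (le_lt_trans (rep_contractive _ _)) //.
by have := cnorm_ge0 (u n - l); lra.
Qed.

Lemma rep_range_star : star_closed (range pi).
Proof.
by move=> _ [x _ <-]; split; [exact: rep_bounded|rewrite rep_star; exists (star x)].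
Qed.
End Representations.

(** * Closed spans and commutants from the generators *)

Section GeneratedAlgebra.
Variables (R : realType) (A : cstarAlgType R) (s : 'I_2 -> A).
Hypothesis hs : cuntz_generators s.

Lemma cnorm_closedP (Q : set A) : (forall u l, (forall n, Q (u n)) -> cnorm_cvg u l -> Q l) ->
  cnorm_closed Q.
Proof. by move=> h u l hu /cnorm_cvgP; exact: h. Qed.

Lemma cnorm_closedE (Q : set A) : cnorm_closed Q ->
  forall u l, (forall n, Q (u n)) -> cnorm_cvg u l -> Q l.
Proof. by move=> h u l hu /cnorm_cvgP; exact: h. Qed.

Definition span_of (L : set A) : set A :=
  [set x | forall Q, closed_subspace Q -> L `<=` Q -> Q x].

Lemma span_closed L : closed_subspace (span_of L).
Proof.
split=> [a x y hx hy Q cQ LQ|]; first by apply: cQ.1; [exact: hx|exact: hy].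
apply: cnorm_closedP => u l hu ul Q cQ LQ.
by apply: (cnorm_closedE cQ.2 _ ul) => n; exact: hu.
Qed.

Lemma span_sub L : L `<=` span_of L.
Proof. by move=> x Lx Q _; apply. Qed.

Lemma span0 L : L !=set0 -> span_of L 0.
Proof.
move=> [x Lx] Q cQ LQ; have := cQ.1 (-1) x x (LQ _ Lx) (LQ _ Lx).
by rewrite scaleN1r addNr.
Qed.

(** The closed span of [L] is stable under left multiplication by the generators and their adjoints,
    hence by the whole algebra: a closed left ideal containing 1. This is the induction principle
    for identities that are linear and continuous in one variable. *)
Lemma span_all L : span_of L 1 ->
  (forall i x, L x -> span_of L (s i * x)) ->
  (forall i x, L x -> span_of L (star (s i) * x)) ->
  forall Q, closed_subspace Q -> L `<=` Q -> forall x, Q x.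
Proof.
move=> h1 hl hr Q cQ LQ x; pose S := span_of L.
have cS := span_closed L.
have mulS y : (forall z, L z -> S (y * z)) -> forall z, S z -> S (y * z).
  move=> hy z Sz; apply: (Sz [set z | S (y * z)]) => //; split.
    by move=> a u v hu hv /=; rewrite mulrDr -scalerAr; exact: cS.1.
  apply: cnorm_closedP => u l hu ul /=.
  apply: (cnorm_closedE cS.2 hu).
  by have := cnorm_cvgM y 1 ul; under eq_fun do rewrite mulr1; rewrite mulr1.
pose B := [set y | (forall z, S z -> S (y * z)) /\ (forall z, S z -> S (star y * z))].
have : B = setT.
  have [_ _ gen] := hs; apply: gen.
  - split.
    + by split=> z; rewrite ?star1 mul1r.
    + move=> a y z [hy1 hy2] [hz1 hz2]; split=> w Sw.
        by rewrite mulrDl -scalerAl; exact: (cS.1 a _ _ (hy1 w Sw) (hz1 w Sw)).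
      rewrite star_antilinear mulrDl -scalerAl.
      exact: (cS.1 _ _ _ (hy2 w Sw) (hz2 w Sw)).
    + move=> y z [hy1 hy2] [hz1 hz2]; split=> w Sw.
        by rewrite -mulrA; exact: (hy1 _ (hz1 w Sw)).
      by rewrite starM -mulrA; exact: (hz2 _ (hy2 w Sw)).
    + by move=> y [hy1 hy2]; split; rewrite ?starK.
  - apply: cnorm_closedP => u l hu ul; split=> z Sz.
      apply: (cnorm_closedE cS.2 (u := fun n => u n * z)) => [n|].
        by have [h _] := hu n; exact: h.
      by have := cnorm_cvgM 1 z ul; under eq_fun do rewrite mul1r; rewrite mul1r.
    apply: (cnorm_closedE cS.2 (u := fun n => star (u n) * z)) => [n|].
      by have [_ h] := hu n; exact: h.
    have := cnorm_cvgM 1 z (cnorm_cvg_star ul).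
    by under eq_fun do rewrite mul1r; rewrite mul1r.
  - by move=> i; split; apply: mulS; [exact: hl|exact: hr].
move=> BT; have [Bx _] : B x by rewrite BT.
have := Bx 1 h1; rewrite mulr1 => Sx; exact: Sx.
Qed.

Variables (H : hilbertType R) (pi : A -> H -> H).
Hypothesis hpi : star_rep pi.

Lemma commutant_rep y : commutant (range pi) y <->
  bounded_op y /\ forall i, (forall xi, y (pi (s i) xi) = pi (s i) (y xi)) /\
    (forall xi, y (pi (star (s i)) xi) = pi (star (s i)) (y xi)).
Proof.
split=> [[hy cy]|[hy cy]]; split=> //.
  by move=> i; split=> xi; [have := cy (pi (s i))|have := cy (pi (star (s i)))];
    move=> /(_ (imageT _ _))/(f_equal (@^~ xi)).
pose B := [set x | (forall xi, y (pi x xi) = pi x (y xi)) /\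
                   (forall xi, y (pi (star x) xi) = pi (star x) (y xi))].
suff BT : B = setT.
  move=> _ [x _ <-]; apply/funext => xi.
  have [h _] : B x by rewrite BT.
  exact: h.
have [_ _ gen] := hs; apply: gen.
- split.
  + by split=> xi; rewrite ?star1 !(rep1 hpi).
  + move=> a u v [u1 u2] [v1 v2]; split=> xi.
      by rewrite !(repL hpi) (opP hy) u1 v1.
    by rewrite star_antilinear !(repL hpi) (opP hy) u2 v2.
  + move=> u v [u1 u2] [v1 v2]; split=> xi; first by rewrite !(repM hpi) u1 v1.
    by rewrite starM !(repM hpi) v2 u2.
  + by move=> u [u1 u2]; split; rewrite ?starK.
- apply: cnorm_closedP => u l hu ul; split=> xi.
    have h1 := rep_seqlim hpi (y xi) ul.
    apply: (seqlim_unique _ h1).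
    have := seqlim_op hy (rep_seqlim hpi xi ul).
    by congr (seqlim _ _); apply/funext => n /=; have [-> _] := hu n.
  have ul' := cnorm_cvg_star ul.
  apply: (seqlim_unique _ (rep_seqlim hpi (y xi) ul')).
  have := seqlim_op hy (rep_seqlim hpi xi ul').
  by congr (seqlim _ _); apply/funext => n /=; have [_ ->] := hu n.
- by move=> i; exact: cy.
Qed.
End GeneratedAlgebra.

(** * The Cuntz algebra and its KMS state *)

Section CuntzGenerators.
Variables (R : realType) (A : cstarAlgType R) (s : 'I_2 -> A).
Hypothesis hs : cuntz_generators s.

(** For i different from j, inserting 1 = sum_k s_k s_k^* into s_i^* s_j yields twice s_i^* s_j. *)
Lemma gen_star_gen i j : star (s i) * s j = (i == j)%:R.
Proof.
have [h1 h2 _] := hs; have [->|ij] := eqVneq i j; first exact: h1.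
have : star (s i) * (\sum_(k < 2) s k * star (s k)) * s j = star (s i) * s j.
  by rewrite h2 mulr1.
have -> : \sum_(k < 2) s k * star (s k) = s i * star (s i) + s j * star (s j).
  rewrite (bigD1 i) //= (bigD1 j) /=; last by rewrite eq_sym.
  rewrite big1 ?addr0 // => k /andP[ki kj]; exfalso.
  by case: i j k ij ki kj {h1} => [[|[|i]] hi] // [[|[|j]] hj] // [[|[|k]] hk].
rewrite mulrDr !mulrDl !mulrA h1 mul1r -!mulrA h1 mulr1.
by move=> /eqP; rewrite -subr_eq0 addrK => /eqP ->.
Qed.

Lemma gen_sum : \sum_(k < 2) s k * star (s k) = 1.
Proof. by case: hs. Qed.

Definition sw (w : seq 'I_2) : A := \prod_(i <- w) s i.

Lemma sw_cons i w : sw (i :: w) = s i * sw w.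
Proof. by rewrite /sw big_cons. Qed.

Lemma sw_cat v w : sw (v ++ w) = sw v * sw w.
Proof. by rewrite /sw big_cat. Qed.

Lemma sw_nil : sw [::] = 1.
Proof. by rewrite /sw big_nil. Qed.

Lemma sw_star_sw v w : size v = size w -> star (sw v) * sw w = (v == w)%:R.
Proof.
elim: v w => [|i v IH] [|j w] //= => [_|[vw]]; first by rewrite sw_nil star1 mulr1.
rewrite !sw_cons starM mulrA -(mulrA _ (star (s i))) gen_star_gen eqseq_cons.
by case: eqVneq => _ /=; [rewrite mulr1 IH|rewrite mulr0 mul0r].
Qed.

Lemma monomials_span (Q : set A) : closed_subspace Q ->
  (forall v w, Q (sw v * star (sw w))) -> forall x, Q x.
Proof.
move=> cQ hQ; pose L := [set x | exists v w, x = sw v * star (sw w)].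
apply: (span_all hs (L := L)) => //.
- by apply: span_sub; exists [::], [::]; rewrite sw_nil star1 mulr1.
- by move=> i _ [v [w ->]]; apply: span_sub; exists (i :: v), w; rewrite sw_cons mulrA.
- move=> i _ [[|j v] [w ->]].
    by apply: span_sub; exists [::], (rcons w i);
      rewrite -cats1 sw_cat starM sw_cons !sw_nil mulr1 !mul1r.
  rewrite sw_cons -mulrA mulrA gen_star_gen; case: eqVneq => _.
    by rewrite mul1r; apply: span_sub; exists v, w.
  by rewrite mul0r; apply: span0; exists 1, [::], [::]; rewrite sw_nil star1 mulr1.
- by move=> _ [v [w ->]].
Qed.

End CuntzGenerators.

Section GaugeAverage.
Variables (R : realType) (A : cstarAlgType R).
Variables (gamma : R[i] -> {lrmorphism A -> A}) (E : A -> A).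
Hypothesis hE : gauge_average gamma E.

(** Homogeneity of weight p - n, recorded as two natural numbers that count generators and
    adjoints. *)
Definition degree (p n : nat) (x : A) : Prop :=
  forall z : R[i], `|z| = 1 -> gamma z x = (z ^+ p * Num.conj z ^+ n) *: x.

Lemma degreeM p n p' n' x y : degree p n x -> degree p' n' y ->
  degree (p + p') (n + n') (x * y).
Proof.
move=> hx hy z z1; have -> : gamma z (x * y) = gamma z x * gamma z y := rmorphM _ _ _.
rewrite hx // hy // -scalerAl -scalerAr scalerA.
by congr (_ *: _); rewrite !exprD; ring.
Qed.

Lemma unit_conj (z : R[i]) : `|z| = 1 -> z * Num.conj z = 1.
Proof. by move=> z1; rewrite -rn_sqr_conj rcX -norm_rn z1 expr1n. Qed.

Lemma degree_diag p x : degree p p x <-> gauge_fixed gamma x.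
Proof.
by split=> h z z1; rewrite h // -exprMn unit_conj // expr1n scale1r.
Qed.

Lemma degree1 : degree 0 0 1.
Proof. by move=> z _; rewrite !expr0 mulr1 scale1r; exact: (rmorph1 (gamma z)). Qed.

Lemma degreeD p n x y : degree p n x -> degree p n y -> degree p n (x + y).
Proof.
move=> hx hy z z1; have -> : gamma z (x + y) = gamma z x + gamma z y := raddfD _ _ _.
by rewrite hx // hy // scalerDr.
Qed.

Definition cis (t : R) : R[i] := cos t +i* sin t.

Lemma cisD t u : cis (t + u) = cis t * cis u.
Proof.
apply/eqP; rewrite eq_complex /cis cosD sinD /=.
by apply/andP; split; apply/eqP; ring.
Qed.

Lemma cisX t n : cis t ^+ n = cis (n%:R * t).
Proof.
elim: n => [|n IH]; first by rewrite expr0 mul0r /cis cos0 sin0.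
by rewrite exprS IH -cisD mulrSr mulrDl mul1r addrC.
Qed.

Lemma norm_cis t : `|cis t| = 1.
Proof. by rewrite normc_def /cis /= cos2Dsin2 sqrtr1. Qed.

Lemma cis_2pi : cis (2 * pi) = 1.
Proof. by rewrite /cis mulr_natl cos2pi sin2pi. Qed.

Lemma average_fixed x : gauge_fixed gamma x -> E x = x.
Proof.
move=> hx; have /cnorm_cvgP := hE x; set u := (X in cnorm_cvg X _) => hu.
apply: (cnorm_cvg_unique hu).
suff -> : u = fun=> x by exact: cnorm_cvg_cst.
apply/funext => n; rewrite /u.
under eq_bigr => k _ do rewrite hx ?norm_cis //.
by rewrite sumr_const card_ord -[x *+ _]scaler_nat scalerA mulVf ?scale1r //.
Qed.

(** The Riemann sum of the character z^(p - n) over the (N+1)-st roots of unity vanishes exactly,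
    not only in the limit, as soon as N >= 2 (p + n). *)
Lemma average_degree p n x : degree p n x -> p != n -> E x = 0.
Proof.
move=> hx pn; have /cnorm_cvgP := hE x; set u := (X in cnorm_cvg X _) => hu.
apply: (cnorm_cvg_unique hu) => e e0; exists (2 * (p + n))%N => N hN.
rewrite subr0 /u.
pose t : R := 2 * pi / N.+1%:R; pose w := cis t ^+ p * Num.conj (cis t) ^+ n.
have rootE (k : nat) : cis (2 * pi * k%:R / N.+1%:R) = cis t ^+ k.
  by rewrite cisX; congr cis; rewrite /t; ring.
have N0 : (N.+1%:R : R) != 0 by rewrite pnatr_eq0.
have ct : Num.conj (cis t) = cis (- t) by rewrite conjCE /cis cosN sinN.
have wN : w ^+ N.+1 = 1.
  rewrite /w exprMn -!exprM ![(_ * N.+1)%N]mulnC !exprM.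
  have e1 : cis t ^+ N.+1 = 1.
    by rewrite cisX /t mulrC divfK // cis_2pi.
  have e2 : Num.conj (cis t) ^+ N.+1 = 1.
    by rewrite -[LHS](rmorphXn Num.conj) -[RHS](rmorph1 Num.conj); congr Num.conj.
  have key (a b : R[i]) : a = 1 -> b = 1 -> a ^+ p * b ^+ n = 1.
    by move=> -> ->; rewrite !expr1n mulr1.
  exact: key.
(* The angle d t lies strictly between 0 and pi, so w has a nonzero imaginary part and differs from
   1. *)
have small d : (0 < d)%N -> (d <= p + n)%N -> 0 < sin (d%:R * t).
  move=> d0 dpn; apply: sin_gt0_pi; rewrite /t; apply/andP; split.
    by rewrite mulr_gt0 ?ltr0n // divr_gt0 ?mulr_gt0 ?pi_gt0 ?ltr0n.
  rewrite mulrA ltr_pdivrMr ?ltr0n // mulrA [d%:R * 2]mulrC [ltRHS]mulrC.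
  rewrite ltr_pM2r ?pi_gt0 // -natrM ltr_nat ltnS (leq_trans _ hN) //.
  by rewrite leq_mul2l dpn orbT.
have w1 : w != 1.
  rewrite /w ct !cisX -cisD; apply/eqP => /(f_equal (@complex.Im R)) /=.
  have [lt|gt|eq] := ltngtP p n; last by rewrite eq eqxx in pn.
    have -> : p%:R * t + n%:R * - t = - ((n - p)%:R * t).
      by rewrite natrB ?(ltnW lt) //; ring.
    rewrite sinN => h; have := small (n - p)%N; rewrite subn_gt0 lt.
    rewrite (leq_trans (leq_subr _ _)) ?leq_addl // => /(_ isT isT).
    by move: h; lra.
  have -> : p%:R * t + n%:R * - t = (p - n)%:R * t.
    by rewrite natrB ?(ltnW gt) //; ring.
  move=> h; have := small (p - n)%N; rewrite subn_gt0 gt.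
  rewrite (leq_trans (leq_subr _ _)) ?leq_addr // => /(_ isT isT).
  by rewrite h ltxx.
have -> : \sum_(k < N.+1) gamma (cis (2 * pi * k%:R / N.+1%:R)) x = 0.
  under eq_bigr => k _ do rewrite hx ?norm_cis // rootE rmorphXn /= -!exprM
    [(k * p)%N]mulnC [(k * n)%N]mulnC !exprM -exprMn -/w.
  rewrite -scaler_suml; have : (w - 1) * \sum_(i < N.+1) w ^+ i = 0.
    by rewrite -subrX1 wN subrr.
  by move=> /eqP; rewrite mulf_eq0 subr_eq0 (negPf w1) /= => /eqP ->; rewrite scale0r.
by rewrite scaler0 cnorm0.
Qed.
End GaugeAverage.

(** * Range projections and right multiplications *)

Definition gram (R : realType) (H : hilbertType R) (V : lmodType R[i]) (f : V -> H) (x y : V) :=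
  dotp (f x) (f y).

Section RangeProjection.
Variables (R : realType) (H : hilbertType R) (V : lmodType R[i]) (f : V -> H).
Hypothesis f_lin : forall (a : R[i]) x y, f (a *: x + y) = a *: f x + f y.

Lemma gram_semi_ip : semi_ip setT (gram f).
Proof.
split=> [a x y z _ _ _|x y _ _|x _]; rewrite /gram.
- by rewrite f_lin ipDl ipZl.
- exact: ipC.
- by rewrite Re_ipxx sqr_ge0.
Qed.

Lemma lin_closedT : lin_closed [set: V].
Proof. by []. Qed.

Definition range_projection (e : H -> H) : Prop :=
  [/\ bounded_op e, adj e = e, forall xi, e (e xi) = e xi, forall x, e (f x) = f x &
      forall xi, exists u, seqlim (f \o u) (e xi)].

(** For the Gram form f is isometric, so f f^* is the projection onto the closure of its range. *)
Lemma range_projection_ex : exists e, range_projection e.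
Proof.
have bnd x : setT x -> rn (f x) ^+ 2 <= 1 * re (gram f x x).
  by rewrite mul1r /gram Re_ipxx.
have fl (a : R[i]) (x y : V) : setT x -> setT y -> f (a *: x + y) = a *: f x + f y.
  by move=> _ _; exact: f_lin.
have [e be he] := representing_operator lin_closedT gram_semi_ip fl fl ler01 bnd bnd.
have lim xi : exists u, seqlim (f \o u) (e xi) by have [u _ hu] := he xi; exists u.
have orth x xi : dotp (f x) (e xi) = dotp (f x) xi.
  have [u [_ hu] lu] := he xi; apply: (seqlim_unique (seqlim_ipr (f x) lu)).
  by apply: (@seqlim_of_inv _ _ _ _ (re (gram f x x))) => n; exact: hu.
have ip_e xi eta : dotp (e xi) eta = dotp (e xi) (e eta).
  have [u lu] := lim xi; apply: (seqlim_unique (seqlim_ipl eta lu)).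
  have := seqlim_ipl (e eta) lu; congr (seqlim _ _); apply/funext => n.
  by rewrite /= orth.
have self xi eta : dotp (e xi) eta = dotp xi (e eta).
  by rewrite ip_e (ipC xi) (ip_e eta) -ipC.
exists e; split=> //.
- exact: adj_eq.
- by move=> xi; apply: ip_ext => eta; rewrite self -ip_e.
- by move=> x; apply: ip_ext => eta; rewrite self orth.
Qed.

Variable e : H -> H.
Hypothesis he : range_projection e.

Lemma range_projection_compress (t : H -> H) (k : R[i]) : bounded_op t ->
  (forall x y, dotp (t (f x)) (f y) = k * dotp (f x) (f y)) ->
  forall xi, e (t (e xi)) = k *: e xi.
Proof.
case: he => be ae ee _ lim bt ht xi; apply: ip_ext => eta.
have -> : dotp (e (t (e xi))) eta = dotp (t (e xi)) (e eta).
  by rewrite -{1}ae; rewrite (ip_adjl be).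
have -> : dotp (k *: e xi) eta = k * dotp (e xi) (e eta).
  by rewrite ipZl -{1}ee -{1}ae (ip_adjl be).
have [u lu] := lim xi; have [v lv] := lim eta.
have ht' y : dotp (t (e xi)) (f y) = k * dotp (e xi) (f y).
  apply: (seqlim_unique (seqlim_ipl (f y) (seqlim_op bt lu))).
  rewrite -ipZl; have := seqlim_ipl (f y) (seqlimZ k lu).
  by congr (seqlim _ _); apply/funext => n; rewrite /= ht ipZl.
apply: (seqlim_unique (seqlim_ipr (t (e xi)) lv)).
rewrite -ipZl; have := seqlim_ipr (k *: e xi) lv.
by congr (seqlim _ _); apply/funext => n; rewrite /= ht' ipZl.
Qed.

Lemma range_projection_comm (t : H -> H) : bounded_op t ->
  (forall x, exists y, t (f x) = f y) -> (forall x, exists y, adj t (f x) = f y) ->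
  forall xi, e (t xi) = t (e xi).
Proof.
case: he => be ae ee ef lim bt ht ht'.
have inv (r : H -> H) : bounded_op r -> (forall x, exists y, r (f x) = f y) ->
    forall xi, e (r (e xi)) = r (e xi).
  move=> br hr xi; have [u lu] := lim xi; have l1 := seqlim_op br lu.
  apply: (seqlim_unique (seqlim_op be l1)); move: l1.
  congr (seqlim _ _); apply/funext => n /=.
  by have [y ->] := hr (u n); rewrite ef.
have bt' := bounded_adj bt => xi; rewrite -(inv t) //.
apply: ip_ext => eta; have e_ip x y : dotp (e x) y = dotp x (e y).
  by rewrite -{1}ae (ip_adjl be).
by rewrite !e_ip !(ip_adjr bt) e_ip (inv _ bt' ht').
Qed.
End RangeProjection.

Section BoundedMultiplication.
Variables (R : realType) (A : cstarAlgType R) (H : hilbertType R) (pi : A -> H -> H).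
Variable Omega : H.
Hypothesis hpi : star_rep pi.
Hypothesis cyclic : closure [set pi x Omega | x in setT] = setT.

Lemma cyclic_approx xi (d : R) : 0 < d -> exists x, rn (pi x Omega - xi) < d.
Proof.
move=> d0; have : closure [set pi x Omega | x in setT] xi by rewrite cyclic.
have d0' : 0 < d%:C by rewrite ltcR.
move=> /(_ _ (nbhsx_ballx xi d%:C d0'))[_ [[x _ <-]]].
rewrite -ball_normE /= -opprB normrN norm_rn ltcR => h.
by exists x.
Qed.

Lemma cyclic_ext (t r : H -> H) : bounded_op t -> bounded_op r ->
  (forall x, t (pi x Omega) = r (pi x Omega)) -> t = r.
Proof.
move=> bt br h; apply/funext => xi.
have /choice[u hu] : forall n : nat, exists x, rn (pi x Omega - xi) < n.+1%:R^-1.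
  by move=> n; apply: cyclic_approx; rewrite invr_gt0.
have lu : seqlim (fun n => pi (u n) Omega) xi.
  apply: (@seqlim_of_inv _ _ _ _ 1) => n.
  have h0 := rn_ge0 (pi (u n) Omega - xi); have h1 := hu n.
  rewrite mul1r; have h2 : n.+1%:R^-1 <= 1 :> R by rewrite invf_le1 ?ltr0n // ler1n.
  by move: h0 h1 h2; move: (rn _) (_^-1) => a b; nra.
apply: (seqlim_unique (seqlim_op bt lu)).
by have := seqlim_op br lu; congr (seqlim _ _); apply/funext => n /=; rewrite h.
Qed.

Definition right_bounded (a : A) : Prop :=
  exists2 k : R, 0 <= k & forall x, rn (pi (x * a) Omega) ^+ 2 <= k * rn (pi x Omega) ^+ 2.

(** [representing_operator] for x Omega and x a Omega with the Gram form of the former. Left and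
    right multiplications commute, so the extension lies in the commutant. *)
Lemma right_multiplication a : right_bounded a ->
  exists2 r, commutant (range pi) r & forall x, r (pi x Omega) = pi (x * a) Omega.
Proof.
move=> [k k0 hk]; pose f1 x := pi x Omega; pose f2 x := pi (x * a) Omega.
have l1 (b : R[i]) (x y : A) : f1 (b *: x + y) = b *: f1 x + f1 y by rewrite /f1 (repL hpi).
have l2 (b : R[i]) (x y : A) : f2 (b *: x + y) = b *: f2 x + f2 y.
  by rewrite /f2 mulrDl -scalerAl (repL hpi).
have K0 : 0 <= k + 1 by lra.
have [t bt ht] : exists2 t : H -> H, bounded_op t & forall zeta : H,
    exists2 u : nat -> A, riesz_seq setT (gram f1) f1 zeta u & seqlim (f2 \o u) (t zeta).
  apply: (representing_operator (lin_closedT A) (gram_semi_ip l1) _ _ K0).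
  - by move=> *; exact: l1.
  - by move=> *; exact: l2.
  - move=> x _; rewrite /gram Re_ipxx; have := sqr_ge0 (rn (f1 x)).
    by move: (rn (f1 x) ^+ 2) => v v0; nra.
  - move=> x _; rewrite /gram Re_ipxx (le_trans (hk x)) // ler_wpM2r ?sqr_ge0 //; lra.
have hr x : t (pi x Omega) = pi (x * a) Omega.
  have [u [_ hu] lu] := ht (pi x Omega); apply: (seqlim_unique lu).
  apply: (@seqlim_of_inv _ _ _ _ k) => n.
  rewrite /= /f2 -(repB hpi) -mulrBl (le_trans (hk _)) // ler_wpM2l //.
  have := hu n (u n - x) I; rewrite /gram Re_ipxx -ipBr /f1 -(repB hpi).
  set v := pi _ Omega.
  have [->|nz] := eqVneq (rn v ^+ 2) 0; first by rewrite invr_ge0.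
  have vp : 0 < rn v ^+ 2 by rewrite lt0r nz sqr_ge0.
  have -> : rn (dotp v v) = rn v ^+ 2.
    by rewrite ipxx rn_rc ger0_norm // sqr_ge0.
  by rewrite [_ ^+ 2 ^+ 2]expr2 ler_pM2l.
exists t => //; split=> // _ [y _ <-].
apply: cyclic_ext; [exact: bounded_comp (rep_bounded hpi y)|exact: bounded_comp (rep_bounded hpi y) _|].
by move=> x /=; rewrite -(repM hpi) !hr -(repM hpi) mulrA.
Qed.

Lemma right_bounded1 : right_bounded 1.
Proof. by exists 1 => // x; rewrite mulr1 mul1r. Qed.

Lemma right_boundedM a b : right_bounded a -> right_bounded b -> right_bounded (a * b).
Proof.
move=> [k k0 hk] [l l0 hl]; exists (l * k) => [|x]; first exact: mulr_ge0.
by rewrite mulrA (le_trans (hl _)) // -mulrA ler_wpM2l.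
Qed.

Lemma right_boundedL c a b : right_bounded a -> right_bounded b -> right_bounded (c *: a + b).
Proof.
move=> [k k0 hk] [l l0 hl].
have c2 : 0 <= 2 * rn c ^+ 2 by rewrite mulr_ge0 ?sqr_ge0.
exists (2 * rn c ^+ 2 * k + 2 * l) => [|x].
  by apply: addr_ge0; apply: mulr_ge0.
rewrite mulrDr -scalerAr (repL hpi) (le_trans (rn2D_le _ _)) // rnZ exprMn.
move: (hk x) (hl x) c2; move: (rn c ^+ 2) (rn _ ^+ 2) (rn _ ^+ 2) (rn _ ^+ 2).
by move=> *; nra.
Qed.
End BoundedMultiplication.

Lemma natr_rc (R : realType) n : (n%:R : R[i]) = n%:R%:C.
Proof. by rewrite rmorph_nat. Qed.

(** Lets an identity between states, possibly composed with an endomorphism, be checked on monomials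
    only. *)
Lemma closed_matrix_coeff (R : realType) (A : cstarAlgType R) (H : hilbertType R)
    (pi1 pi2 : A -> H -> H) (xi1 eta1 xi2 eta2 : H) (k : R[i]) :
  star_rep pi1 -> star_rep pi2 ->
  closed_subspace [set x | dotp (pi1 x xi1) eta1 = k * dotp (pi2 x xi2) eta2].
Proof.
move=> h1 h2; split=> [a x y /= hx hy|].
  by rewrite (repL h1) (repL h2) !ipDl !ipZl hx hy; ring.
apply: cnorm_closedP => u l hu ul /=.
apply: (seqlim_unique (seqlim_ipl eta1 (rep_seqlim h1 xi1 ul))).
rewrite -ipZl; have := seqlim_ipl eta2 (seqlimZ k (rep_seqlim h2 xi2 ul)).
by congr (seqlim _ _); apply/funext => n /=; rewrite hu ipZl.
Qed.

(** * The KMS property of the canonical state *)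

Section KMSState.
Variables (R : realType) (A : cstarAlgType R) (s : 'I_2 -> A).
Variables (gamma : R[i] -> {lrmorphism A -> A}) (E : A -> A) (tau : A -> R[i]).
Variables (H : hilbertType R) (pi : A -> H -> H) (Omega : H).
Hypothesis hs : cuntz_generators s.
Hypothesis hgamma : gauge_action s gamma.
Hypothesis hE : gauge_average gamma E.
Hypothesis htau : tracial_state (gauge_fixed gamma) tau.
Hypothesis hpi : star_rep pi.
Hypothesis tauE : forall x, tau (E x) = dotp (pi x Omega) Omega.

Definition vec_state x := dotp (pi x Omega) Omega.
Local Notation om := vec_state.

Lemma vec_stateL a x y : om (a *: x + y) = a * om x + om y.
Proof. by rewrite /om (repL hpi) ipDl ipZl. Qed.
Lemma vec_state0 : om 0 = 0.
Proof. by rewrite /om (rep0 hpi) ip0l. Qed.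
Lemma vec_stateD x y : om (x + y) = om x + om y.
Proof. by have := vec_stateL 1 x y; rewrite scale1r mul1r. Qed.
Lemma vec_stateZ a x : om (a *: x) = a * om x.
Proof. by have := vec_stateL a x 0; rewrite vec_state0 !addr0. Qed.
Lemma vec_state_sum (I : Type) (r : seq I) (P : pred I) (F : I -> A) :
  om (\sum_(i <- r | P i) F i) = \sum_(i <- r | P i) om (F i).
Proof. exact: (big_morph om vec_stateD vec_state0). Qed.
Lemma vec_state_star x : om (star x) = Num.conj (om x).
Proof. by rewrite /om (rep_ipl hpi) starK -ipC. Qed.
Lemma vec_stateM x y : om (star x * y) = dotp (pi y Omega) (pi x Omega).
Proof. by rewrite /om (repM hpi) (rep_ipl hpi) starK. Qed.
Lemma vec_state_norm x : re (om (star x * x)) = rn (pi x Omega) ^+ 2.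
Proof. by rewrite vec_stateM Re_ipxx. Qed.

Lemma degree_gen i : degree gamma 1 0 (s i).
Proof. by move=> z z1; have [_ ->] := hgamma z1; rewrite expr1 expr0 mulr1. Qed.

Lemma degree_star p n x : degree gamma p n x -> degree gamma n p (star x).
Proof.
move=> hx z z1; have [-> _] := hgamma z1.
rewrite hx // starZ rmorphM /= !rmorphXn /= conjCK mulrC //.
Qed.

Lemma degree_sw w : degree gamma (size w) 0 (sw s w).
Proof.
elim: w => [|i w IH]; first by rewrite sw_nil; exact: degree1.
by rewrite sw_cons; exact: (degreeM (degree_gen i) IH).
Qed.

Lemma degree_monomial v w : degree gamma (size v) (size w) (sw s v * star (sw s w)).
Proof.
by have := degreeM (degree_sw v) (degree_star (degree_sw w)); rewrite addn0.
Qed.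

Lemma vec_state_fixed x : gauge_fixed gamma x -> om x = tau x.
Proof. by move=> hx; rewrite /om -tauE (average_fixed hE). Qed.

Lemma vec_state_degree p n x : degree gamma p n x -> p != n -> om x = 0.
Proof.
move=> hx pn; rewrite /om -tauE (average_degree hE hx pn) -vec_state_fixed ?vec_state0 //.
by move=> z _; exact: (raddf0 (gamma z)).
Qed.

Lemma vec_state1 : om 1 = 1.
Proof.
rewrite vec_state_fixed; first by case: htau.
by move=> z _; exact: (rmorph1 (gamma z)).
Qed.

Lemma gauge_fixedM x y : gauge_fixed gamma x -> gauge_fixed gamma y -> gauge_fixed gamma (x * y).
Proof.
move=> hx hy z z1.
have -> : gamma z (x * y) = gamma z x * gamma z y := rmorphM _ _ _.
by rewrite hx // hy.
Qed.

Lemma vec_state_trace x y : gauge_fixed gamma x -> gauge_fixed gamma y -> om (x * y) = om (y * x).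
Proof.
move=> hx hy; rewrite !vec_state_fixed; [|exact: gauge_fixedM..].
by have [_ _ _] := htau; apply.
Qed.

Lemma monomial_fixed v w : size v = size w -> gauge_fixed gamma (sw s v * star (sw s w)).
Proof. by move=> vw; apply/(degree_diag _ (size v)); rewrite {2}vw; exact: degree_monomial. Qed.

Definition monomial_weight (k : nat) := om (sw s (nseq k ord0) * star (sw s (nseq k ord0))).

Lemma monomialM v w v' w' : size w = size v' ->
  (sw s v * star (sw s w)) * (sw s v' * star (sw s w')) = (w == v')%:R *: (sw s v * star (sw s w')).
Proof.
move=> h; rewrite mulrA -(mulrA (sw s v)) (sw_star_sw hs h).
by case: (w == v'); rewrite ?mulr1 ?scale1r // mulr0 mul0r scale0r.
Qed.

(** Monomials with words of equal length are matrix units, on which a trace vanishes off the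
    diagonal and is constant along it. *)
Lemma vec_state_monomial v w : size v = size w ->
  om (sw s v * star (sw s w)) = (v == w)%:R * monomial_weight (size v).
Proof.
move=> vw; have [<-|ne] := eqVneq v w; last first.
  have -> : sw s v * star (sw s w) = (sw s v * star (sw s w)) * (sw s w * star (sw s w)).
    by rewrite monomialM // eqxx scale1r.
  rewrite vec_state_trace; [|exact: monomial_fixed..].
  by rewrite monomialM // eq_sym (negPf ne) scale0r vec_state0 mul0r.
rewrite mul1r /monomial_weight; set z := nseq _ _.
have sz : size z = size v by rewrite size_nseq.
have <- : (sw s v * star (sw s z)) * (sw s z * star (sw s v)) = sw s v * star (sw s v).
  by rewrite monomialM // eqxx scale1r.
rewrite vec_state_trace; [|exact: monomial_fixed..].
by rewrite monomialM // eqxx scale1r.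
Qed.

Lemma monomial_weightS k : monomial_weight k = 2 * monomial_weight k.+1.
Proof.
pose z : seq 'I_2 := nseq k ord0; have -> : monomial_weight k = \sum_(i < 2) om (sw s (rcons z i) * star (sw s (rcons z i))).
  rewrite -vec_state_sum /monomial_weight -/z; congr om.
  rewrite -{1}(mulr1 (sw s z)) -(gen_sum hs) mulr_sumr mulr_suml; apply: eq_bigr => i _.
  by rewrite -cats1 sw_cat sw_cons sw_nil mulr1 starM !mulrA.
under eq_bigr => i _ do rewrite vec_state_monomial // eqxx mul1r size_rcons size_nseq.
by rewrite sumr_const card_ord mulr_natl.
Qed.

(** By degree only monomials with [w] one letter longer than [v] survive; the factor 2 is the ratio
    of the weights of consecutive word lengths. *)
Lemma kms_right x i : om (x * s i) = 2 * om (s i * x).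
Proof.
move: x; apply: (monomials_span hs (Q := [set x | om (x * s i) = 2 * om (s i * x)])).
  have := closed_matrix_coeff (pi (s i) Omega) Omega Omega (pi (star (s i)) Omega) 2 hpi hpi.
  congr closed_subspace; apply/seteqP; split=> x /=; rewrite /om !(repM hpi) -?(repM hpi);
    by rewrite !(repM hpi) [dotp (pi (s i) _) _](rep_ipl hpi).
move=> v w /=; have [eq|ne] := eqVneq (size v).+1 (size w); last first.
  rewrite [LHS](@vec_state_degree (size v).+1 (size w)) //; last first.
    by have := degreeM (degree_monomial v w) (degree_gen i); rewrite addn1 addn0.
  rewrite (@vec_state_degree (size v).+1 (size w)) ?mulr0 //.
  by have := degreeM (degree_gen i) (degree_monomial v w); rewrite add1n add0n.
case: w eq => [|j w] //= [vw].
have -> : s i * (sw s v * star (sw s (j :: w))) = sw s (i :: v) * star (sw s (j :: w)).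
  by rewrite [sw s (i :: v)]sw_cons mulrA.
rewrite vec_state_monomial /= ?vw // sw_cons starM -!mulrA.
rewrite (gen_star_gen hs) eqseq_cons.
have [_|_] /= := eqVneq j i.
  by rewrite mulr1 vec_state_monomial // vw mulrCA -monomial_weightS.
by rewrite !mulr0 vec_state0 mul0r mulr0.
Qed.

Lemma kms_left x i : om (star (s i) * x) = 2 * om (x * star (s i)).
Proof.
have := kms_right (star x) i; move=> /(f_equal Num.conj).
by rewrite rmorphM /= -!vec_state_star !starM starK => ->; rewrite rmorph_nat.
Qed.

(** The KMS property turns |x s_j Omega|^2 into 2 om(x^* x s_j s_j^* ). The projection stands on the
    right and gives no bound by itself, but the sum over j is 2 |x Omega|^2 and each term is
    nonnegative. *)
Lemma right_bounded_gen i : right_bounded pi Omega (s i).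
Proof.
have key x j : om (star (x * s j) * (x * s j)) = 2 * om (star x * x * (s j * star (s j))).
  have -> : star (x * s j) * (x * s j) = star (s j) * (star x * (x * s j)).
    by rewrite starM !mulrA.
  by rewrite kms_left !mulrA.
exists 2 => // x; have : \sum_(j < 2) om (star (x * s j) * (x * s j)) = 2 * om (star x * x).
  under eq_bigr => j _ do rewrite key.
  by rewrite -mulr_sumr -vec_state_sum -mulr_sumr (gen_sum hs) mulr1.
move=> /(f_equal (@re R)); rewrite Re_sum natr_rc ReZ vec_state_norm => <-.
under eq_bigr => j _ do rewrite vec_state_norm.
by rewrite (bigD1 i) //= lerDl sumr_ge0 // => j _; exact: sqr_ge0.
Qed.

Lemma right_bounded_star_gen i : right_bounded pi Omega (star (s i)).
Proof.
exists 1 => // x; have h2 : (2 : R[i]) != 0 by rewrite pnatr_eq0.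
have : 2 * om (star (x * star (s i)) * (x * star (s i))) = om (star x * x).
  rewrite starM starK -mulrA -kms_right -!mulrA (gen_star_gen hs) eqxx mulr1 //.
move=> /(f_equal (@re R)); rewrite natr_rc ReZ !vec_state_norm mul1r.
by have := sqr_ge0 (rn (pi (x * star (s i)) Omega)); lra.
Qed.

Hypothesis cyclic : closure [set pi x Omega | x in setT] = setT.

Lemma right_bounded_monomial v w : right_bounded pi Omega (sw s v * star (sw s w)).
Proof.
apply: right_boundedM.
  elim: v => [|i v IH]; first by rewrite sw_nil; exact: right_bounded1.
  by rewrite sw_cons; apply: right_boundedM IH; exact: right_bounded_gen.
elim: w => [|i w IH]; first by rewrite sw_nil star1; exact: right_bounded1.
by rewrite sw_cons starM; apply: right_boundedM IH _; exact: right_bounded_star_gen.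
Qed.

(** Right multiplication by a monomial x sends Omega to x Omega, and the monomials span a dense
    subspace. *)
Lemma commutant_dense (zeta : H) (r : R) : 0 < r ->
  exists2 y, commutant (range pi) y & rn (y Omega - zeta) < r.
Proof.
have hstar := rep_range_star hpi.
have [[_ linC] _ _ _] := commutant_star_algebra hstar.
have lim (u : nat -> H) l : seqlim u l ->
    (forall n (r : R), 0 < r -> exists2 y, commutant (range pi) y & rn (y Omega - u n) < r) ->
    forall r : R, 0 < r -> exists2 y, commutant (range pi) y & rn (y Omega - l) < r.
  move=> lu hu {}r r0; have r2 : 0 < r / 2 by lra.
  have [N hN] := lu _ r2; have [y cy hy] := hu N _ r2; exists y => //.
  by have := rn_triangle (u N) (y Omega) l; have := hN _ (leqnn N); lra.
pose Q := [set x | forall d : R, 0 < d ->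
  exists2 y, commutant (range pi) y & rn (y Omega - pi x Omega) < d].
suff key x : Q x.
  move=> r0; have r2 : 0 < r / 2 by lra.
  have [x hx] := cyclic_approx cyclic zeta r2; have [y cy hy] := key x _ r2; exists y => //.
  by have := rn_triangle (pi x Omega) (y Omega) zeta; lra.
move: x; apply: (monomials_span hs).
- split.
    move=> a x y hx hy d d0; have a1 : 0 < 2 * (rn a + 1) by have := rn_ge0 a; lra.
    have d1 : 0 < d / (2 * (rn a + 1)) by rewrite divr_gt0.
    have d2 : 0 < d / 2 by lra.
    have [t ct ht] := hx _ d1; have [q cq hq] := hy _ d2.
    exists (a *: t + q); first exact: linC.
    rewrite ltr_pdivlMr // in ht.
    have -> : (a *: t + q) Omega - pi (a *: x + y) Omega =
        a *: (t Omega - pi x Omega) + (q Omega - pi y Omega).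
      by rewrite (repL hpi) scalerBr opprD addrACA.
    rewrite (le_lt_trans (rnD _ _)) // rnZ.
    have := rn_ge0 (t Omega - pi x Omega); have := rn_ge0 a.
    by move: ht hq; nra.
  apply: cnorm_closedP => u l hu ul.
  by apply: (lim _ _ (rep_seqlim hpi Omega ul)) => n; exact: hu.
- move=> v w d d0; have [y cy hy] := right_multiplication hpi cyclic (right_bounded_monomial v w).
  exists y => //; have := hy 1; rewrite mul1r (rep1 hpi) => ->.
  by rewrite subrr rn0.
Qed.

End KMSState.

(** * Inclusions given by endomorphisms *)

(** The isometries s_1^k s_2 have orthogonal ranges for all k; their images under rho supply the
    nu_j in N, as many as the basis requires. *)
Lemma rank_isometries (R : realType) (A : cstarAlgType R) (s : 'I_2 -> A) (k l : nat) :
  cuntz_generators s ->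
  star (s ord0 ^+ k * s ord_max) * (s ord0 ^+ l * s ord_max) = (k == l)%:R.
Proof.
move=> hs; have half (n d : nat) : star (s ord0 ^+ n * s ord_max) * (s ord0 ^+ (n + d) * s ord_max) =
    star (s ord_max) * s ord0 ^+ d * s ord_max.
  rewrite starM -!mulrA; congr (_ * _); rewrite !mulrA; congr (_ * _).
  elim: n => [|n IH]; first by rewrite expr0 star1 mul1r.
  rewrite addSn exprS exprS starM mulrA -(mulrA _ (star (s ord0))) (gen_star_gen hs).
  by rewrite eqxx mulr1.
have [lt|gt|->] := ltngtP k l; last by rewrite -{2}[l]addn0 half expr0 mulr1 (gen_star_gen hs).
  rewrite -(subnKC lt) addSnnS half exprS mulrA (gen_star_gen hs) //= mul0r mul0r //.
apply: (can_inj (@starK _ _)); rewrite star0 starM starK.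
by rewrite -(subnKC gt) addSnnS half exprS mulrA (gen_star_gen hs) //= mul0r mul0r.
Qed.

Section CuntzSubfactor.
Variables (R : realType) (A : cstarAlgType R) (s : 'I_2 -> A).
Variables (H : hilbertType R) (pi : A -> H -> H) (Omega : H) (rho : {lrmorphism A -> A}).
Hypothesis hs : cuntz_generators s.
Hypothesis hpi : star_rep pi.
Hypothesis cyclic : closure [set pi x Omega | x in setT] = setT.
Hypothesis rho_star : star_morphism rho.
Local Notation om := (vec_state pi Omega).
Hypothesis om1 : om 1 = 1.
Hypothesis M'_dense : forall (zeta : H) (r : R), 0 < r ->
  exists2 y, commutant (range pi) y & rn (y Omega - zeta) < r.

Lemma rho_rep : star_rep (pi \o rho).
Proof.
have rhoL a x y : rho (a *: x + y) = a *: rho x + rho y by exact: linearP.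
case: hpi => h1 h2 h3 h4 h5; split=> /=.
- by move=> x; exact: h1.
- by have -> : rho 1 = 1 by exact: rmorph1.
- by move=> a x y; rewrite rhoL h3.
- by move=> x y; have -> : rho (x * y) = rho x * rho y by exact: rmorphM.
- by move=> x xi eta; rewrite rho_star h5.
Qed.

Lemma cyclic_ip_ext (v w : H) : (forall y, dotp v (pi y Omega) = dotp w (pi y Omega)) -> v = w.
Proof.
move=> h; apply/eqP; rewrite -subr_eq0; apply/eqP/rn_le0/ler_addgt0Pr => d d0; rewrite add0r.
set z := v - w; have zy y : dotp z (pi y Omega) = 0 by rewrite /z ipBl h subrr.
have [y hy] := cyclic_approx cyclic z d0.
have := rn2B (pi y Omega) z; rewrite ipC zy rmorph0.
have := rn_ge0 (pi y Omega - z); have := rn_ge0 z; have := sqr_ge0 (rn (pi y Omega)).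
have -> : re (0 : R[i]) = 0 by rewrite -(ip0l (0 : H)) Re_ipxx rn0 expr0n.
by move: hy d0 ; nra.
Qed.

Variables (I : finType) (m : I -> A) (cc : 'I_2 -> I -> I -> A) (a : I -> R[i]) (c : R).
Hypothesis gen_m : forall i k, s i * m k = \sum_j m j * rho (cc i j k).
Hypothesis star_m_gen : forall i j, star (m j) * s i = \sum_k rho (cc i j k) * star (m k).
Hypothesis om_m : forall j x y, om (rho y * m j * rho x) = a j * om (rho (y * x)).
Hypothesis om_m_m : forall k l x, om (star (m l) * m k * rho x) = (l == k)%:R * om (rho x).
Hypothesis sum_a_star_m : \sum_j a j *: star (m j) = 1.
Hypothesis sum_m_star_m : \sum_j m j * star (m j) = c%:C *: 1.
Hypothesis sum_star_m_m : \sum_j star (m j) * m j = c%:C *: 1.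
Hypothesis m_central : forall j x, om (m j * x) = om (x * m j).
Hypothesis m_right : forall j, right_bounded pi Omega (star (m j)).
Hypothesis c_gt0 : 0 < c.

Let rhoM x y : rho (x * y) = rho x * rho y. Proof. exact: rmorphM. Qed.
Let rho1 : rho 1 = 1. Proof. exact: rmorph1. Qed.

Lemma star_m_central j x : om (star (m j) * x) = om (x * star (m j)).
Proof.
by rewrite -[in LHS](starK x) -starM (vec_state_star Omega hpi) -m_central -(vec_state_star Omega hpi) starM starK.
Qed.

Lemma sum_conj_a_m : \sum_j Num.conj (a j) *: m j = 1.
Proof.
rewrite -[RHS]star1 -sum_a_star_m star_sum; apply: eq_bigr => j _.
by rewrite starZ starK.
Qed.

(** The basis intertwines t with a matrix over the range of rho, and y commutes with its entries.
    Applied to the generators and their adjoints, this sends N' into M'. *)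
Lemma conj_sum_gen (t : A) (d : I -> I -> A) (y : H -> H) :
  (forall k, t * m k = \sum_j m j * rho (d j k)) ->
  (forall j, star (m j) * t = \sum_k rho (d j k) * star (m k)) ->
  commutant (range (pi \o rho)) y ->
  forall xi, conj_sum (pi \o m) y (pi t xi) = pi t (conj_sum (pi \o m) y xi).
Proof.
move=> tm mt [by_ cy] xi; rewrite !conj_sumE /=.
have yc x zeta : y (pi (rho x) zeta) = pi (rho x) (y zeta).
  by have /(f_equal (@^~ zeta)) := cy (pi (rho x)) (imageT _ _).
rewrite (op_sum _ _ _ (rep_bounded hpi t)).
under [RHS]eq_bigr => k _ do rewrite -(repM hpi) tm (rep_sum hpi).
rewrite exchange_big /=; apply: eq_bigr => j _.
rewrite (rep_star hpi) -(repM hpi) mt (rep_sum hpi) (op_sum _ _ _ by_) (op_sum _ _ _ (rep_bounded hpi _)).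
apply: eq_bigr => k _; rewrite !(repM hpi) (rep_star hpi).
by rewrite yc.
Qed.

Theorem cuntz_minimal_index :
  minimal_index (double_commutant (range (pi \o rho))) (double_commutant (range pi)) c%:E.
Proof.
have bZ (b : R[i]) (y : H -> H) : bounded_op y -> bounded_op (b *: y).
  by move=> by_; rewrite -[_ *: _]addr0; exact: bounded_lin (bounded0 H).
have hr := rho_rep; have sP := rep_range_star hpi; have sN := rep_range_star hr.
have CM : commutant (double_commutant (range pi)) = commutant (range pi).
  exact: commutant_triple.
have CN : commutant (double_commutant (range (pi \o rho))) = commutant (range (pi \o rho)).
  exact: commutant_triple.
have piM x : double_commutant (range pi) (pi x) by apply: commutant_double => //; exists x.
have /choice[r hr'] : forall j, exists r, commutant (range pi) r /\
    forall x, r (pi x Omega) = pi (x * star (m j)) Omega.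
  by move=> j; have [r ? ?] := right_multiplication hpi cyclic (m_right j); exists r.
have r_bounded j : bounded_op (r j) by case: (hr' j) => [[]].
have rE j x : r j (pi x Omega) = pi (x * star (m j)) Omega by case: (hr' j).
(* Right multiplication by m_j^* has right multiplication by m_j as adjoint because m_j centralizes
   the state. *)
have adj_r j x : adj (r j) (pi x Omega) = pi (x * m j) Omega.
  apply: cyclic_ip_ext => y; rewrite (ip_adjl (r_bounded j)) rE -!(vec_stateM Omega hpi).
  by rewrite starM starK -mulrA m_central -mulrA.
pose f x := pi (rho x) Omega.
have f_lin (b : R[i]) (x y : A) : f (b *: x + y) = b *: f x + f y.
  exact: (repL hr).
have [e he] := range_projection_ex f_lin; have [be ae ee ef _] := he.
have ip_f x y : dotp (f x) (f y) = om (rho (star y * x)).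
  by rewrite rhoM rho_star (vec_stateM Omega hpi).
have f1 : f 1 = Omega by rewrite /f rho1 (rep1 hpi).
have eO : e Omega = Omega by rewrite -f1 ef.
have N'e : commutant (range (pi \o rho)) e.
  split=> // _ [b _ <-]; apply/funext => xi /=.
  apply: (range_projection_comm he (rep_bounded hpi _)) => x.
    by exists (b * x); rewrite /f rhoM (repM hpi).
  by exists (star b * x); rewrite /f rhoM (repM hpi) rho_star (rep_star hpi).
have T0 y : commutant (range (pi \o rho)) y -> commutant (range pi) (conj_sum (pi \o m) y).
  move=> cy; apply/(commutant_rep hs hpi); split.
    by apply: bounded_conj_sum; [move=> j; exact: rep_bounded|case: cy].
  move=> i; split; first by apply: conj_sum_gen cy.
  apply: (conj_sum_gen (d := fun j k => star (cc i k j))) cy => k.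
    apply: (can_inj (@starK _ _)); rewrite starM starK star_m_gen star_sum.
    by apply: eq_bigr => j _; rewrite starM rho_star starK.
  apply: (can_inj (@starK _ _)); rewrite starM !starK gen_m star_sum.
  by apply: eq_bigr => j _; rewrite starM rho_star !starK.
have e_m_e j xi : e (pi (m j) (e xi)) = a j *: e xi.
  apply: (range_projection_compress he (rep_bounded hpi _)) => x y.
  by rewrite ip_f -om_m /f -(repM hpi) -(vec_stateM Omega hpi) -rho_star mulrA.
have e_ms_O j : e (pi (star (m j)) Omega) = Num.conj (a j) *: Omega.
  apply: ip_ext => zeta; rewrite -{1}ae (ip_adjl be) (rep_ipl hpi) starK -{1}eO -{1}ae (ip_adjl be).
  by rewrite e_m_e ipZr ipZl -(ip_adjl be) ae eO.
have orth k l xi : e (adj (r k) (r l (e xi))) = (k == l)%:R *: e xi.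
  apply: (range_projection_compress he (t := adj (r k) \o r l)).
    by apply: bounded_comp => //; exact: bounded_adj.
  move=> x y; rewrite ip_f /= (ip_adjl (r_bounded k)) /f !rE -(vec_stateM Omega hpi).
  rewrite starM starK -rho_star mulrA -star_m_central !mulrA -mulrA -rhoM om_m_m eq_sym //.
have q_id xi : \sum_j r j (e (adj (r j) xi)) = xi.
  pose q := \sum_j (r j \o e \o adj (r j)).
  have -> : \sum_j r j (e (adj (r j) xi)) = q xi by rewrite /q fct_sumE.
  have bq : bounded_op q.
    apply: bounded_sum => j; apply: bounded_comp (bounded_adj _) => //.
    exact: bounded_comp.
  rewrite -[RHS]/(id xi); congr (_ xi); apply: (cyclic_ext cyclic) => //; first exact: bounded_id.
  (* [q] fixes the vectors [pi (star x) Omega], [x] in [L], since [e] fixes [f]. *)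
  pose L := [set x | exists j z, x = m j * rho z].
  have L_sum (F : I -> A) (z : A) : span_of L ((\sum_j m j * rho (F j)) * rho z).
    have L0 : L !=set0.
      (* [I] is not empty, since 1 is a combination of the m_j and om 1 = 1. *)
      have [j _|I0] := pickP (@predT I); first by exists (m j * rho 1), j, 1.
      have := om1; rewrite -sum_conj_a_m big_pred0 // (vec_state0 Omega hpi) => /esym/eqP.
      by rewrite oner_eq0.
    rewrite mulr_suml; elim/big_ind: _ => [|u v hu hv|j _]; first exact: span0.
      by have := (span_closed L).1 1 u v hu hv; rewrite scale1r.
    by apply: span_sub; exists j, (F j * z); rewrite rhoM mulrA.
  pose Q := [set x | q (pi (star x) Omega) = pi (star x) Omega].
  suff hQ x : Q x by move=> x /=; have := hQ (star x); rewrite /Q /= starK.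
  move: x; apply: (span_all hs (L := L)).
  - have -> : 1 = (\sum_j m j * rho (Num.conj (a j) *: 1)) * rho 1; last exact: L_sum.
    rewrite rho1 mulr1 -[LHS]sum_conj_a_m; apply: eq_bigr => j _.
    by rewrite [rho _]linearZ /= rho1 -scalerAr mulr1.
  - move=> i _ [j [z ->]]; rewrite mulrA gen_m; exact: L_sum.
  - move=> i _ [j [z ->]]; rewrite mulrA.
    have -> : star (s i) * m j = \sum_k m k * rho (star (cc i j k)); last exact: L_sum.
    apply: (can_inj (@starK _ _)); rewrite starM starK star_m_gen star_sum.
    by apply: eq_bigr => k _; rewrite starM rho_star starK.
  - split=> [b x y|].
      rewrite /Q /= star_antilinear !(repL hpi) => hx hy.
      by rewrite (opP bq) hx hy.
    apply: cnorm_closedP => u l hu ul; rewrite /Q /=.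
    have l1 := rep_seqlim hpi Omega (cnorm_cvg_star ul).
    apply: (seqlim_unique (seqlim_op bq l1)); move: l1.
    by congr (seqlim _ _); apply/funext => n /=; rewrite hu.
  - move=> _ [j [z ->]]; rewrite /Q /= starM -rho_star -rE /q fct_sumE /=.
    rewrite (bigD1 j) //= big1 ?addr0 => [|k kj].
      by rewrite -[pi _ Omega]ef orth eqxx scale1r.
    by rewrite -[pi _ Omega]ef orth (negPf kj) scale0r (op0 (r_bounded k)).
pose nu (i : I) := pi (rho (s ord0 ^+ enum_rank i * s ord_max)).
apply: (@jones_minimal_index _ _ _ _ _ _ _ _ I (pi \o m) r e a c
  _ _ _ _ _ _ _ _ _ _ _ _ _ Omega _ _ _ _ _ _ nu) => //=.
- by apply: commutant_star_algebra; exact: commutant_star.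
- by apply: commutant_star_algebra; exact: commutant_star.
- by rewrite CN.
- by apply: commutant_sub; apply: commutant_sub => _ [x _ <-]; exists (rho x).
- by move=> j; rewrite CM; case: (hr' j).
- by rewrite CN.
- by move=> y; rewrite CM CN; exact: T0.
(* The sum of the m_j e m_j^* lies in M', so it is determined by its value at Omega, where e m_j^*
   Omega is a multiple of Omega. *)
- have [b0 cT] := T0 e N'e.
  suff Te : conj_sum (pi \o m) e = id by move=> xi; rewrite -[RHS]/(id xi) -Te conj_sumE.
  apply: (cyclic_ext cyclic) => //; first exact: bounded_id.
  move=> x; have := cT (pi x) (imageT _ _) => /(f_equal (@^~ Omega)) /= ->.
  congr (pi x _); rewrite conj_sumE /=.
  under eq_bigr => j _ do rewrite (rep_star hpi) e_ms_O (opZ (rep_bounded hpi _)) -(repZ hpi).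
  by rewrite -(rep_sum hpi) sum_conj_a_m (rep1 hpi).
- move=> xi; under eq_bigr => j _ do rewrite (rep_star hpi) -(repZ hpi).
  by rewrite -(rep_sum hpi) sum_a_star_m (rep1 hpi).
- move=> xi; have -> : \sum_j Num.conj (a j) *: adj (r j) xi = (\sum_j Num.conj (a j) *: adj (r j)) xi.
    by rewrite fct_sumE.
  rewrite -[RHS]/(id xi).
  congr (_ xi); apply: (cyclic_ext cyclic).
  + by apply: bounded_sum => j; apply: bZ; exact: bounded_adj.
  + exact: bounded_id.
  + move=> x; rewrite fct_sumE.
    transitivity (\sum_j pi (x * (Num.conj (a j) *: m j)) Omega).
      apply: eq_bigr => j _; rewrite -[LHS]/(Num.conj (a j) *: adj (r j) (pi x Omega)).
      by rewrite adj_r -(repZ hpi) scalerAr.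
    by rewrite -(rep_sum hpi) -mulr_sumr sum_conj_a_m mulr1.
- move=> xi; under eq_bigr => j _ do rewrite (rep_star hpi) -(repM hpi).
  by rewrite -(rep_sum hpi) sum_m_star_m (repZ hpi) (rep1 hpi).
- by rewrite CM.
- move=> zeta d d0; have [x hx] := cyclic_approx cyclic zeta d0.
  by exists (pi x).
- have := om1; rewrite /vec_state (rep1 hpi) ipxx => /(f_equal (@re R)).
  rewrite -(ipxx Omega) Re_ipxx => h; apply/eqP; rewrite -sqrp_eq1 ?rn_ge0 //; apply/eqP.
  by rewrite h.
- by move=> i; rewrite (rep_star hpi) -{1}(rep1 hpi Omega) rE mul1r.
- move=> xi; have -> : \sum_j adj (r j) (r j xi) = (\sum_j (adj (r j) \o r j)) xi by rewrite fct_sumE.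
  rewrite -[RHS]/((c%:C *: (id : H -> H)) xi).
  congr (_ xi); apply: (cyclic_ext cyclic).
  + by apply: bounded_sum => j; apply: bounded_comp => //; exact: bounded_adj.
  + exact: bZ (bounded_id H).
  + move=> x; rewrite fct_sumE.
    under eq_bigr => j _ do rewrite /= rE adj_r -mulrA.
    by rewrite -(rep_sum hpi) -mulr_sumr sum_star_m_m -scalerAr mulr1 (repZ hpi).
- by move=> i; apply: commutant_double => //; exists (s ord0 ^+ enum_rank i * s ord_max).
- move=> i j xi; rewrite (rep_star hpi) -(repM hpi) -rho_star -rhoM rank_isometries //.
  rewrite (inj_eq val_inj) (inj_eq enum_rank_inj); case: eqP => _ /=.
    by rewrite rho1 (rep1 hpi) scale1r.
  by rewrite [rho _]raddf0 (rep0 hpi) scale0r.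
Qed.

End CuntzSubfactor.

(** * Computing with monomials *)

(* A monomial [s_v s_w^*] is the pair [(v, w)], and a form is a sum of monomials. *)
Definition form : Type := seq (seq bool * seq bool).

Definition mono_mul (p q : seq bool * seq bool) : form :=
  if prefix p.2 q.1 then [:: (p.1 ++ drop (size p.2) q.1, q.2)]
  else if prefix q.1 p.2 then [:: (p.1, q.2 ++ drop (size q.1) p.2)] else [::].

Definition form_mul (f g : form) : form := flatten [seq mono_mul p q | p <- f, q <- g].

Definition form_adj (f : form) : form := [seq (p.2, p.1) | p <- f].

Definition form_unit : form := [:: ([::], [::])].

(** Inserts 1 = s_1 s_1^* + s_2 s_2^* between the two words, until the starred word has length 3. *)
Definition form_split (f : form) : form :=
  flatten [seq if (size p.2 < 3)%N then [seq (rcons p.1 b, rcons p.2 b) | b <- [:: false; true]]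
               else [:: p] | p <- f].

(* Monomials with [size w = 3] are linearly independent, so comparing expansions loses nothing
   for the short words that occur. *)
Definition form_eq (f g : form) : bool := perm_eq (iter 3 form_split f) (iter 3 form_split g).

Definition form_times (n : nat) (f : form) : form := flatten (nseq n f).

Definition form_balanced (f : form) : bool :=
  all (fun p => (size p.1 == size p.2) && (size p.1 <= 3)%N) f.

(** For balanced forms this is 8 om: a diagonal monomial with words of length k has weight 2^(-k),
    here scaled to an integer. *)
Definition form_trace (f : form) : nat :=
  sumn [seq if p.1 == p.2 then (2 ^ (3 - size p.1))%N else 0%N | p <- f].

Definition gen_form (b : bool) : form := [:: ([:: b], [::])].

(** [t] lists the words sigma(11), sigma(12), sigma(21), sigma(22), so this is u_sigma s_i. *)
Definition rho_gen (t : seq (seq bool)) (i : bool) : form :=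
  [seq (nth [::] t (2 * i + l)%N, [:: l]) | l : bool <- [:: false; true]].

Definition rho_word (t : seq (seq bool)) (v : seq bool) : form :=
  foldr (fun i => form_mul (rho_gen t i)) form_unit v.

Definition rho_form (t : seq (seq bool)) (f : form) : form :=
  flatten [seq form_mul (rho_word t p.1) (form_adj (rho_word t p.2)) | p <- f].

Section Forms.
Variables (R : realType) (A : cstarAlgType R) (s : 'I_2 -> A).
Hypothesis hs : cuntz_generators s.

Definition bit (b : bool) : 'I_2 := if b then ord_max else ord0.
Definition word (v : seq bool) : A := sw s (map bit v).
Definition mono (p : seq bool * seq bool) : A := word p.1 * star (word p.2).
Definition den (f : form) : A := \sum_(p <- f) mono p.

Lemma bit_inj : injective bit.
Proof. by move=> [] []. Qed.

Lemma bit_surj (i : 'I_2) : exists b, i = bit b.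
Proof. by case: i => [[|[|k]] hk] //; [exists false|exists true]; exact: val_inj. Qed.

Lemma word_cat v w : word (v ++ w) = word v * word w.
Proof. by rewrite /word map_cat sw_cat. Qed.

Lemma word_nil : word [::] = 1.
Proof. exact: sw_nil. Qed.

Lemma word_cons b w : word (b :: w) = s (bit b) * word w.
Proof. by rewrite /word /= sw_cons. Qed.

Lemma star_word_word v w : size v = size w -> star (word v) * word w = (v == w)%:R.
Proof.
by move=> vw; rewrite sw_star_sw // ?size_map // (inj_eq (inj_map bit_inj)).
Qed.

Lemma star_word_prefix v w : prefix v w -> star (word v) * word w = word (drop (size v) w).
Proof.
move=> /prefixP[u ->]; rewrite drop_size_cat // word_cat mulrA star_word_word //.
by rewrite eqxx mul1r.
Qed.

Lemma star_word_orth v w : ~~ prefix v w -> ~~ prefix w v -> star (word v) * word w = 0.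
Proof.
wlog le : v w / (size v <= size w)%N => [hw|].
  move=> h1 h2; have [le|/ltnW le] := leqP (size v) (size w); first exact: hw.
  by apply: (can_inj (@starK _ _)); rewrite star0 starM starK; exact: hw.
rewrite prefixE => ne _; rewrite -(cat_take_drop (size v) w) word_cat mulrA.
by rewrite star_word_word ?size_takel // eq_sym (negPf ne) mul0r.
Qed.

Lemma den_nil : den [::] = 0.
Proof. exact: big_nil. Qed.

Lemma den_cons p f : den (p :: f) = mono p + den f.
Proof. exact: big_cons. Qed.

Lemma den_cat f g : den (f ++ g) = den f + den g.
Proof. exact: big_cat. Qed.

Lemma den_flatten (fs : seq form) : den (flatten fs) = \sum_(f <- fs) den f.
Proof.
by elim: fs => [|f fs IH]; rewrite ?big_nil ?den_nil // big_cons /= den_cat IH.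
Qed.

Lemma den_unit : den form_unit = 1.
Proof. by rewrite /den big_seq1 /mono !word_nil star1 mulr1. Qed.

Lemma den_gen b : den (gen_form b) = s (bit b).
Proof. by rewrite /den big_seq1 /mono word_nil star1 mulr1 word_cons word_nil mulr1. Qed.

Lemma den_mono_mul p q : den (mono_mul p q) = mono p * mono q.
Proof.
case: p q => [v w] [v' w']; rewrite /mono_mul /mono /=.
rewrite -mulrA (mulrA (star (word w))).
have [h|h1] := boolP (prefix w v').
  by rewrite den_cons den_nil addr0 /mono /= word_cat star_word_prefix // !mulrA.
have [h|h2] := boolP (prefix v' w); last by rewrite star_word_orth // mul0r mulr0 den_nil.
rewrite den_cons den_nil addr0 /mono /= word_cat starM.
congr (_ * (_ * _)).
by apply: (can_inj (@starK _ _)); rewrite starK starM starK star_word_prefix.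
Qed.

Lemma den_mul f g : den (form_mul f g) = den f * den g.
Proof.
rewrite /form_mul den_flatten big_allpairs_dep /den mulr_suml; apply: eq_bigr => p _.
by rewrite mulr_sumr; apply: eq_bigr => q _; exact: den_mono_mul.
Qed.

Lemma den_adj f : den (form_adj f) = star (den f).
Proof.
rewrite /den big_map star_sum; apply: eq_bigr => p _.
by rewrite /mono starM starK.
Qed.

Lemma den_split f : den (form_split f) = den f.
Proof.
rewrite /form_split den_flatten big_map; apply: eq_bigr => [[v w]] _ /=.
case: ifP => _; last by rewrite den_cons den_nil addr0.
rewrite !den_cons den_nil addr0 /mono /= -!cats1 !word_cat !starM -!mulrA -mulrDr.
congr (_ * _); rewrite !mulrA -mulrDl !word_cons !word_nil !mulr1.
have := gen_sum hs; rewrite big_ord_recl big_ord1 => h.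
by rewrite -[RHS]mul1r -h; congr ((_ + _ * star _) * _); congr s; exact: val_inj.
Qed.

Lemma den_eq f g : form_eq f g -> den f = den g.
Proof.
move=> h; have splitE n : den (iter n form_split f) = den f /\ den (iter n form_split g) = den g.
  by elim: n => [|n [IH1 IH2]] //=; rewrite !den_split.
have [<- <-] := splitE 3.
exact: perm_big.
Qed.

Lemma den_times n f : den (form_times n f) = n%:R *: den f.
Proof. by rewrite /form_times den_flatten big_nseq scaler_nat -Monoid.iteropE. Qed.

Variables (t : seq (seq bool)) (rho : {lrmorphism A -> A}).
Hypothesis rho_star : star_morphism rho.
Hypothesis rho_s : forall b, rho (s (bit b)) = den (rho_gen t b).

Lemma den_rho_word v : den (rho_word t v) = rho (word v).
Proof.
elim: v => [|b v IH]; first by rewrite den_unit word_nil [RHS]rmorph1.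
rewrite den_mul -rho_s IH word_cons.
by have -> : rho (s (bit b) * word v) = rho (s (bit b)) * rho (word v) by exact: rmorphM.
Qed.

Lemma den_rho f : den (rho_form t f) = rho (den f).
Proof.
rewrite /rho_form den_flatten big_map /den [RHS]raddf_sum; apply: eq_bigr => p _.
rewrite -[LHS]/(den _) den_mul den_adj !den_rho_word -rho_star.
exact/esym/rmorphM.
Qed.
End Forms.

(* The hypotheses of [cuntz_minimal_index] for the elements [sqrt w * ms_j]; the factor 8
   clears the denominators of the state on words of length at most 3. *)
Definition certified (t : seq (seq bool)) (ms : seq form) (cc : bool -> nat -> nat -> form)
    (w c : nat) : bool :=
  let ix := iota 0 (size ms) in
  let m := nth [::] ms in
  let bits := [:: false; true] in
  [&& all (fun v => size v == 2) [seq nth [::] t k | k <- iota 0 4],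
      all form_balanced ms,
      all (fun i => all (fun k => form_eq (form_mul (gen_form i) (m k))
        (flatten [seq form_mul (m j) (rho_form t (cc i j k)) | j <- ix])) ix) bits,
      all (fun i => all (fun j => form_eq (form_mul (form_adj (m j)) (gen_form i))
        (flatten [seq form_mul (rho_form t (cc i j k)) (form_adj (m k)) | k <- ix])) ix) bits,
      all (fun i => all (fun j => all (fun b => has (fun b' =>
        form_eq (form_mul (form_adj (rho_gen t j)) (form_mul b (rho_gen t i))) b' &&
        (form_trace b' == (i == j) * form_trace b)%N) ([::] :: ms)) ms) bits) bits,
      all (fun k => all (fun l => has (fun b => form_eq (form_mul (form_adj (m l)) (m k)) b &&
        (w * form_trace b == (l == k) * 8)%N) ([::] :: ms)) ix) ix,
      form_eq (flatten [seq form_times (w * form_trace (m j)) (form_adj (m j)) | j <- ix])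
        (form_times 8 form_unit),
      form_eq (flatten [seq form_times w (form_mul (m j) (form_adj (m j))) | j <- ix])
        (form_times c form_unit) &
      form_eq (flatten [seq form_times w (form_mul (form_adj (m j)) (m j)) | j <- ix])
        (form_times c form_unit)].

(** * From certificates to minimal indices *)

Section CertifiedIndex.
Variables (R : realType) (A : cstarAlgType R) (s : 'I_2 -> A).
Variables (gamma : R[i] -> {lrmorphism A -> A}) (E : A -> A) (tau : A -> R[i]).
Variables (H : hilbertType R) (pi : A -> H -> H) (Omega : H).
Hypothesis hs : cuntz_generators s.
Hypothesis hgamma : gauge_action s gamma.
Hypothesis hE : gauge_average gamma E.
Hypothesis htau : tracial_state (gauge_fixed gamma) tau.
Hypothesis hpi : star_rep pi.
Hypothesis tauE : forall x, tau (E x) = dotp (pi x Omega) Omega.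
Hypothesis cyclic : closure [set pi x Omega | x in setT] = setT.
Local Notation om := (vec_state pi Omega).
Local Notation word := (word s).
Local Notation den := (den s).

Let kmsr := kms_right hs hgamma hE htau hpi tauE.
Let kmsl := kms_left hs hgamma hE htau hpi tauE.
Let omL := vec_stateL Omega hpi.
Let omZ := vec_stateZ Omega hpi.
Let om0 := vec_state0 Omega hpi.
Let om1 : om 1 = 1 := vec_state1 hE htau tauE.
Let two_neq0 n : (2 : R[i]) ^+ n != 0.
Proof. by rewrite expf_neq0 // pnatr_eq0. Qed.

Lemma kms_word x v : om (x * word v) = 2 ^+ size v * om (word v * x).
Proof.
elim: v x => [|b v IH] x; first by rewrite word_nil mulr1 expr0 !mul1r.
rewrite word_cons mulrA IH /= exprS mulrA kmsr !mulrA; congr (_ * _).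
by rewrite [RHS]mulrC mulrC.
Qed.

Lemma kms_star_word x v : om (star (word v) * x) = 2 ^+ size v * om (x * star (word v)).
Proof.
have := kms_word (star x) v; move=> /(f_equal Num.conj).
by rewrite rmorphM /= -!(vec_state_star Omega hpi) !starM starK rmorphXn rmorph_nat.
Qed.

(** Both powers are kept to avoid division. They cancel when the two words have equal length, so
    balanced forms centralize the state. *)
Lemma kms_mono x p : 2 ^+ size p.2 * om (x * mono s p) = 2 ^+ size p.1 * om (mono s p * x).
Proof.
by rewrite /mono mulrA -kms_star_word mulrA kms_word -mulrA.
Qed.

Lemma balanced_central f x : form_balanced f -> om (den f * x) = om (x * den f).
Proof.
elim: f => [_|p f IH] /=; first by rewrite den_nil mul0r mulr0.
move=> /andP[/andP[/eqP ep _] hf]; rewrite den_cons mulrDl mulrDr !(vec_stateD Omega hpi) IH //.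
by congr (_ + _); apply: (mulfI (two_neq0 (size p.1))); rewrite -kms_mono ep.
Qed.

Lemma om_balanced f : form_balanced f -> 8 * om (den f) = (form_trace f)%:R.
Proof.
have wt k : 2 ^+ k * monomial_weight s pi Omega k = 1.
  elim: k => [|k IH].
    by rewrite /monomial_weight /= sw_nil star1 mulr1 expr0 mul1r.
  by rewrite exprSr -mulrA -(monomial_weightS hs hgamma hE htau hpi tauE).
elim: f => [_|p f IH] /=; first by rewrite den_nil om0 mulr0.
move=> /andP[/andP[/eqP ep p3] hf]; rewrite den_cons (vec_stateD Omega hpi) mulrDr IH //.
rewrite natrD; congr (_ + _); rewrite /mono /word.
rewrite (vec_state_monomial hs hgamma hE htau hpi tauE) ?size_map //.
rewrite (inj_eq (inj_map bit_inj)); case: eqP => _; last by rewrite mul0r mulr0.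
have -> : (8 : R[i]) = 2 ^+ (3 - size p.1) * 2 ^+ size p.1.
  by rewrite -exprD subnK // -natrX.
by rewrite mul1r -mulrA wt mulr1 natrX.
Qed.

Lemma degree_mono p : degree gamma (size p.1) (size p.2) (mono s p).
Proof.
have := degree_monomial hgamma (map bit p.1) (map bit p.2).
by rewrite !size_map.
Qed.

Lemma balanced_fixed f : form_balanced f -> gauge_fixed gamma (den f).
Proof.
elim: f => [_ z _|p f IH] /=; first by rewrite den_nil; exact: (raddf0 (gamma z)).
move=> /andP[/andP[/eqP ep _] hf]; rewrite den_cons.
apply/(degree_diag gamma 0)/degreeD; last exact/(degree_diag gamma 0)/IH.
by apply/(degree_diag gamma 0)/(degree_diag gamma (size p.1)); rewrite {2}ep; exact: degree_mono.
Qed.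

Section GeneratorTable.
Variable t : seq (seq bool).
Hypothesis ht : all (fun v => size v == 2) [seq nth [::] t k | k <- iota 0 4].

Let size_t (b l : bool) : size (nth [::] t (2 * b + l)%N) = 2.
Proof.
by move: ht => /= /and5P[/eqP ? /eqP ? /eqP ? /eqP ? _]; case: b; case: l.
Qed.

(** Each term of rho(s_b) has two letters and one starred letter, net degree one, and so obeys the
    same KMS rule as a generator. *)
Lemma kms_rho_gen b x : om (x * den (rho_gen t b)) = 2 * om (den (rho_gen t b) * x).
Proof.
have key (l : bool) : om (x * mono s (nth [::] t (2 * b + l)%N, [:: l])) =
    2 * om (mono s (nth [::] t (2 * b + l)%N, [:: l]) * x).
  have := kms_mono x (nth [::] t (2 * b + l)%N, [:: l]); rewrite /= size_t expr1 => h.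
  by apply: (mulfI (two_neq0 1)); rewrite expr1 h mulrA.
rewrite /= !den_cons den_nil addr0 mulrDr (mulrDl (mono s _)) !(vec_stateD Omega hpi).
by rewrite (key false) (key true) mulrDr.
Qed.

Lemma degree_rho_gen b : degree gamma 2 1 (den (rho_gen t b)).
Proof.
have key (l : bool) : degree gamma 2 1 (mono s (nth [::] t (2 * b + l)%N, [:: l])).
  by have := degree_mono (nth [::] t (2 * b + l)%N, [:: l]); rewrite /= size_t.
by rewrite /= !den_cons den_nil addr0; apply: degreeD; [exact: (key false)|exact: (key true)].
Qed.
End GeneratorTable.

Lemma right_bounded_den f : right_bounded pi Omega (den f).
Proof.
elim: f => [|p f IH].
  by exists 0 => // x; rewrite den_nil mulr0 (rep0 hpi) rn0 expr0n mul0r.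
rewrite den_cons -[mono s p]scale1r; apply: right_boundedL => //.
exact: (right_bounded_monomial hs hgamma hE htau hpi tauE).
Qed.

Variables (rho : {lrmorphism A -> A}).
Hypothesis rho_star : star_morphism rho.
Hypothesis kms_rho : forall x i, om (x * rho (s i)) = 2 * om (rho (s i) * x).
Hypothesis degree_rho : forall i, degree gamma 2 1 (rho (s i)).

Let rhoM x y : rho (x * y) = rho x * rho y. Proof. exact: rmorphM. Qed.
Let rho1 : rho 1 = 1. Proof. exact: rmorph1. Qed.

Lemma kms_rho_star x i : om (star (rho (s i)) * x) = 2 * om (x * star (rho (s i))).
Proof.
have := kms_rho (star x) i; move=> /(f_equal Num.conj).
by rewrite rmorphM /= -!(vec_state_star Omega hpi) !starM starK rmorph_nat.
Qed.

Lemma degree_rho_sw v : degree gamma (2 * size v) (size v) (rho (sw s v)).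
Proof.
elim: v => [|i v IH]; first by rewrite sw_nil rho1; exact: degree1.
rewrite sw_cons rhoM; have := degreeM (degree_rho i) IH.
by rewrite /= mulnS.
Qed.

(** Stochastic independence of b from the range of rho; for b = 1 it says that rho preserves the
    state. *)
Definition independent (b : A) : Prop := forall x, om (b * rho x) = om b * om x.

(* By induction on the length of monomials: the KMS property moves [star (rho (s j))]
   from the right end to the left of [b]. *)
Lemma independent_family (C : set A) :
  (forall b, C b -> gauge_fixed gamma b) ->
  (forall b i j, C b -> exists2 b', C b' &
     star (rho (s j)) * b * rho (s i) = b' /\ om b' = (i == j)%:R * om b) ->
  forall b, C b -> independent b.
Proof.
move=> hfix hC b Cb x; move: x b Cb.
suff key v w b : C b -> om (b * rho (sw s v * star (sw s w))) = om b * om (sw s v * star (sw s w)).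
  move=> x b Cb; move: x; apply: (monomials_span hs (Q := [set x | om (b * rho x) = om b * om x])).
    have := closed_matrix_coeff Omega (pi (star b) Omega) Omega Omega (om b) (rho_rep hpi rho_star) hpi.
    have omE x : om (b * rho x) = dotp ((pi \o rho) x Omega) (pi (star b) Omega).
      by rewrite /vec_state (repM hpi) (rep_ipl hpi).
    by congr closed_subspace; apply/seteqP; split=> x; rewrite /= omE.
  by move=> v w; exact: key.
have [vw|ne] := eqVneq (size v) (size w); last first.
  move=> Cb; rewrite (vec_state_degree hE hpi tauE (degree_monomial hgamma v w) ne) mulr0.
  apply: (@vec_state_degree _ _ _ _ _ _ _ _ hE hpi tauE (2 * size v + size w) (size v + 2 * size w)).
    have /(degree_diag gamma 0) db := hfix _ Cb; rewrite rhoM rho_star.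
    by have := degreeM db (degreeM (degree_rho_sw v) (degree_star hgamma (degree_rho_sw w))).
  by rewrite !mul2n -!addnn -addnA eqn_add2l eqn_add2r.
elim: v w b vw => [|i v IH] [|j w] b //= vw Cb.
  by rewrite sw_nil star1 mulr1 rho1 mulr1 om1 mulr1.
have [b' Cb' [eb' ob']] := hC b i j Cb.
case: vw => vw; have IH' := IH w b' vw Cb'.
have two : (2 : R[i]) != 0 by rewrite pnatr_eq0.
apply: (mulfI two).
have [y ey] : exists y, y = sw s v * star (sw s w) by eexists.
rewrite -ey in IH'.
have e1 : sw s (i :: v) * star (sw s (j :: w)) = s i * y * star (s j).
  by rewrite !sw_cons starM ey !mulrA.
rewrite e1 !rhoM rho_star !mulrA -kms_rho_star !mulrA eb' IH' ob'.
rewrite -[RHS]mulrA [RHS]mulrCA -kmsl mulrA (gen_star_gen hs) (eq_sym j).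
by case: eqP => _; rewrite ?mul1r // !mul0r om0 mulr0.
Qed.

Lemma independent1 : independent 1.
Proof.
apply: (@independent_family [set x | x = 0 \/ x = 1]); last by right.
  by move=> b [] -> z _; [exact: (raddf0 (gamma z))|exact: (rmorph1 (gamma z))].
move=> b i j [] ->.
  by exists 0; [left|rewrite mulr0 mul0r om0 mulr0].
rewrite mulr1 -rho_star -rhoM (gen_star_gen hs) (eq_sym j).
case: eqP => _; first by exists 1; [right|rewrite rho1 mul1r].
by exists 0; [left|rewrite om0 mul0r; split=> //; exact: (raddf0 rho)].
Qed.

(** Induction on y through [span_all]: the KMS rules of rho(s_i) and of s_i carry the same factor,
    so a letter moves from the left of y to the right of x on both sides. *)
Lemma independent_sandwich b : independent b ->
  forall y x, om (rho y * b * rho x) = om b * om (y * x).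
Proof.
move=> hb; pose L := [set y | forall x, om (rho y * b * rho x) = om b * om (y * x)].
have two : (2 : R[i]) != 0 by rewrite pnatr_eq0.
apply: (span_all hs (L := L)) => //.
- by apply: span_sub => x; rewrite rho1 !mul1r.
- move=> i y hy; apply: span_sub => x; apply: (mulfI two).
  rewrite rhoM -!mulrA -kms_rho !mulrA -mulrA -rhoM hy.
  by rewrite mulrA kmsr mulrCA !mulrA.
- move=> i y hy; apply: span_sub => x; rewrite rhoM rho_star -!mulrA kms_rho_star.
  have -> : rho y * (b * rho x) * star (rho (s i)) = rho y * b * rho (x * star (s i)).
    by rewrite rhoM rho_star !mulrA.
  by rewrite hy kmsl [LHS]mulrCA -[in RHS]mulrA.
- split=> [a y z hy hz x|].
    have -> : rho (a *: y + z) = a *: rho y + rho z by exact: linearP.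
    by rewrite !mulrDl -!scalerAl !omL hy hz; ring.
  apply: cnorm_closedP => u l hu ul x.
  have [_ cl] := closed_matrix_coeff (pi (b * rho x) Omega) Omega (pi x Omega) Omega (om b)
    (rho_rep hpi rho_star) hpi.
  have omE z : om (rho z * b * rho x) = dotp ((pi \o rho) z (pi (b * rho x) Omega)) Omega.
    by rewrite /vec_state -mulrA (repM hpi).
  have omE' z : om (z * x) = dotp (pi z (pi x Omega)) Omega by rewrite /vec_state (repM hpi).
  rewrite omE omE'; apply: (cnorm_closedE cl _ ul) => n /=.
  by rewrite -omE -omE'; exact: hu.
Qed.

Variables (t : seq (seq bool)) (ms : seq form) (cc : bool -> nat -> nat -> form) (w c : nat).
Hypothesis rho_s : forall b, rho (s (bit b)) = den (rho_gen t b).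
Hypothesis c_gt0 : (0 < c)%N.

Let all_bits (P : pred bool) : all P [:: false; true] -> forall b, P b.
Proof. by move=> /= /and3P[? ? _] []. Qed.

Let all_ix (n : nat) (P : pred nat) : all P (iota 0 n) -> forall i : 'I_n, P i.
Proof. by move=> /allP h i; apply: h; rewrite mem_iota /=. Qed.

Let den_ix (n : nat) (F : nat -> form) :
  den (flatten [seq F j | j <- iota 0 n]) = \sum_(j < n) den (F j).
Proof. by rewrite den_flatten big_map -(big_mkord xpredT (fun j => den (F j))) /index_iota subn0. Qed.

Theorem certified_minimal_index : certified t ms cc w c ->
  minimal_index (double_commutant (range (pi \o rho))) (double_commutant (range pi)) c%:R%:E.
Proof.
move=> /and5P[_ hbal h1 h2 /and5P[h3 h4 h5 h6 h7]].
pose m (j : 'I_(size ms)) := den (nth [::] ms j).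
have m_mem (j : 'I_(size ms)) : nth [::] ms j \in ms by exact: mem_nth.
have m_bal (j : 'I_(size ms)) : form_balanced (nth [::] ms j) by apply: (allP hbal).
pose C := [set x | exists2 f, f \in [::] :: ms & x = den f].
have C_bal f : f \in [::] :: ms -> form_balanced f.
  by rewrite inE => /orP[/eqP -> //|]; exact: (allP hbal).
have eight : (8 : R[i]) != 0 by rewrite pnatr_eq0.
(* The certificate makes the finite set formed by 0 and the basis stable under b |-> rho(s_j)^* b
   rho(s_i), with the right means. *)
have C_ind : forall b, C b -> independent b.
  apply: independent_family => [_ [f hf ->]|_ i j [f hf ->]].
    by apply: balanced_fixed; exact: C_bal.
  have [bi ->] := bit_surj i; have [bj ->] := bit_surj j; rewrite !rho_s.
  move: hf; rewrite inE => /orP[/eqP ->|hf].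
    exists (den [::]); first by exists [::].
    by rewrite den_nil mulr0 mul0r om0 mulr0.
  have /hasP[f' hf' /andP[/(den_eq hs) e1 /eqP e2]] :=
    allP (all_bits (all_bits h3 bi) bj) _ hf.
  exists (den f'); first by exists f'.
  rewrite -e1 !(den_mul hs) den_adj !mulrA; split=> //.
  apply: (mulfI eight).
  have := om_balanced (C_bal _ hf'); rewrite -e1 !(den_mul hs) den_adj !mulrA => ->.
  by rewrite e2 natrM -[RHS]mulrA [RHS]mulrCA om_balanced ?(allP hbal) // (inj_eq bit_inj).
have Cm j : C (m j) by exists (nth [::] ms j) => //; rewrite inE m_mem orbT.
(* The factor sqrt w normalizes the basis: a diagonal matrix unit of M_2 has state 1/2, whence w = 2
   for bases of matrix units. *)
pose r : R := Num.sqrt w%:R.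
have r2 : r%:C * r%:C = w%:R by rewrite -rcM -expr2 sqr_sqrtr ?ler0n // natr_rc.
have star_r x : star (r%:C *: x) = r%:C *: star x by rewrite starZ conj_rc.
have rho_den f : den (rho_form t f) = rho (den f) by exact: den_rho.
have mean j : 8 * om (m j) = (form_trace (nth [::] ms j))%:R by exact: om_balanced.
apply: (@cuntz_minimal_index _ _ s _ _ _ _ hs hpi cyclic rho_star om1 _ _
  (fun j => r%:C *: m j) (fun i j k => den (cc (i == ord_max) j k)) (fun j => r%:C * om (m j)) c%:R).
- exact: (commutant_dense hs hgamma hE htau hpi tauE cyclic).
- move=> i k; have [b ->] := bit_surj i.
  have := den_eq hs (all_ix (all_bits h1 b) k); rewrite den_mul // den_gen den_ix => e.
  rewrite -scalerAr -/(m k) e scaler_sumr; apply: eq_bigr => j _.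
  by rewrite den_mul // rho_den -scalerAl; case: b {e}.
- move=> i j; have [b ->] := bit_surj i.
  have := den_eq hs (all_ix (all_bits h2 b) j); rewrite den_mul // den_gen den_adj den_ix => e.
  rewrite star_r -scalerAl -/(m j) e scaler_sumr; apply: eq_bigr => k _.
  by rewrite den_mul // rho_den den_adj star_r -scalerAr; case: b {e}.
- move=> j x y; rewrite -scalerAr -scalerAl omZ (independent_sandwich (C_ind _ (Cm j))).
  have := independent1 (y * x); rewrite mul1r om1 mul1r => ->.
  by rewrite mulrA.
- move=> k l x; have /hasP[f hf /andP[/(den_eq hs) e1 /eqP e2]] := all_ix (all_ix h4 k) l.
  rewrite star_r -scalerAl -scalerAr scalerA r2 -scalerAl omZ.
  have -> : star (m l) * m k = den f by rewrite -e1 (den_mul hs) den_adj.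
  rewrite C_ind; last by exists f.
  have := independent1 x; rewrite mul1r om1 mul1r => ->; rewrite mulrA; congr (_ * _).
  apply: (mulfI eight); rewrite mulrCA om_balanced ?C_bal // -natrM e2 natrM mulrC.
  by [].
- apply: (scalerI eight); have := den_eq hs h5; rewrite den_times // den_unit den_ix => <-.
  rewrite scaler_sumr; apply: eq_bigr => j _.
  rewrite den_times // den_adj star_r !scalerA natrM -mean -r2.
  by congr (_ *: _); ring.
- have := den_eq hs h6; rewrite den_times // den_unit den_ix natr_rc => <-.
  apply: eq_bigr => j _; rewrite den_times // den_mul // den_adj star_r.
  by rewrite -scalerAl -scalerAr scalerA r2.
- have := den_eq hs h7; rewrite den_times // den_unit den_ix natr_rc => <-.
  apply: eq_bigr => j _; rewrite den_times // den_mul // den_adj star_r.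
  by rewrite -scalerAl -scalerAr scalerA r2.
- by move=> j x; rewrite -scalerAl -scalerAr !omZ balanced_central.
- by move=> j; rewrite star_r -den_adj -[_ *: _]addr0 -(den_nil s); apply: right_boundedL => //;
    exact: right_bounded_den.
- by rewrite ltr0n.
Qed.

End CertifiedIndex.

(** * The permutation endomorphisms *)

(* Over F_2, each of the 24 permutations is affine in the two digits (j, l), namely
   (j + b, l + d) in the translation case, (j + l + b, l + d) in the diagonal case,
   (j + b, l + j + d) in the flip case and (l + a j + b, j + c l + d) with a c = 0 in the
   matrix case; below x = (b, d) and y = (a, c). *)
Definition flip_form (d : bool) : form :=
  if d then [:: ([:: false], [:: true]); ([:: true], [:: false])] else form_unit.

Definition unit_form (r l : bool) : form := [:: ([:: r], [:: l])].

(** With F the flip, rho(s_j) = s_(j+b) F^d and rho(F) = F, so s_i = rho(s_(i+b) F^d): rho is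
    onto. *)
Definition translation_cert (x : bool * bool) (i : bool) (_ _ : nat) : form :=
  form_mul (gen_form (i (+) x.1)) (flip_form x.2).

Definition diagonal_basis : seq form := [:: unit_form false false; unit_form true true].

(** s_i e_ll has range below e_ii, so only the row k = i occurs, and there s_i e_ll = e_ii
    rho(s_(i+l+b+d) F^d). *)
Definition diagonal_cert (x : bool * bool) (i : bool) (k l : nat) : form :=
  if k == i then form_mul (gen_form (i (+) odd l (+) x.1 (+) x.2)) (flip_form x.2) else [::].

Definition flip_basis : seq form := [:: form_unit; flip_form true].

(** Here rho(s_j) = s_(j+b) F^(j+d), hence F^p rho(s_j) = s_(j+b+p) F^(j+d). Matching this with s_i
    F^k gives j = k + d and p = i + k + b + d modulo 2. *)
Definition flip_cert (x : bool * bool) (i : bool) (j k : nat) : form :=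
  if odd j (+) odd k == i (+) x.1 (+) x.2 then gen_form (x.2 (+) odd k) else [::].

Definition matrix_basis : seq form :=
  [:: unit_form false false; unit_form false true; unit_form true false; unit_form true true].

(** q encodes the unit e_rl. The equation s_i s_r s_l^* = e_ip' rho(s_j) has the single solution j =
    r + c l + d, p' = l + a j + b modulo 2. *)
Definition matrix_cert (x y : bool * bool) (i : bool) (p q : nat) : form :=
  let r := odd q./2 in let l := odd q in
  let j := r (+) (y.2 && l) (+) x.2 in
  if (odd p./2 == i) && (odd p == l (+) (y.1 && j) (+) x.1) then gen_form j else [::].

Definition cycle_table (cs : seq (seq nat)) : seq (seq bool) :=
  [seq let k := (foldr next i.+1 cs).-1 in [:: odd k./2; odd k] | i <- iota 0 4].

Definition table_offset (t : seq (seq bool)) : bool * bool :=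
  (nth false (nth [::] t 0) 0, nth false (nth [::] t 0) 1).

(** In the matrix case the images of (1, 0) and (0, 1) exceed the image of (0, 0) by a in the first
    digit and by c in the second. *)
Definition table_slopes (t : seq (seq bool)) : bool * bool :=
  (nth false (nth [::] t 2) 0 (+) (table_offset t).1,
   nth false (nth [::] t 1) 1 (+) (table_offset t).2).

Lemma index_one_certified : all (fun cs => let t := cycle_table cs in
  certified t [:: form_unit] (translation_cert (table_offset t)) 1 1) index_one.
Proof. by vm_compute. Qed.

Lemma index_two_certified : all (fun cs => let t := cycle_table cs in
  certified t diagonal_basis (diagonal_cert (table_offset t)) 2 2 ||
  certified t flip_basis (flip_cert (table_offset t)) 1 2) index_two.
Proof. by vm_compute. Qed.

Lemma index_four_certified : all (fun cs => let t := cycle_table cs in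
  certified t matrix_basis (matrix_cert (table_offset t) (table_slopes t)) 2 4) index_four.
Proof. by vm_compute. Qed.

Lemma s_pair_word (R : realType) (A : cstarAlgType R) (s : 'I_2 -> A) (k : 'I_4) :
  s_pair s k = word s [:: odd k./2; odd k].
Proof.
rewrite /s_pair word_cons word_cons word_nil mulr1; congr (s _ * s _); apply: val_inj;
  by case: k => [[|[|[|[|k]]]] hk] //=; rewrite inordK.
Qed.

Lemma perm_unitary_gen (R : realType) (A : cstarAlgType R) (s : 'I_2 -> A) (sigma : 'S_4)
    (cs : seq (seq nat)) (b : bool) : cuntz_generators s -> has_cycles cs sigma ->
  perm_unitary s sigma * s (bit b) = den s (rho_gen (cycle_table cs) b).
Proof.
move=> hs /forallP hc; pose T k := nth [::] (cycle_table cs) k.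
have hT (k : 'I_4) : s_pair s (sigma k) = word s (T k).
  rewrite s_pair_word; congr word; rewrite /T (nth_map 0%N) ?size_iota // nth_iota // add0n.
  by have /eqP <- := hc k.
have hk (b' l : bool) (k : 'I_4) : k = (2 * b' + l)%N :> nat ->
    s_pair s (sigma k) * star (s_pair s k) * s (bit b) =
    (b' == b)%:R *: mono s (T (2 * b' + l)%N, [:: l]).
  move=> ek; rewrite hT ek s_pair_word ek.
  have [-> ->] : odd (2 * b' + l)./2 = b' /\ odd (2 * b' + l) = l by case: b' l {ek} => [] [].
  rewrite !word_cons word_nil mulr1 starM -mulrA -mulrA (gen_star_gen hs) (inj_eq bit_inj).
  rewrite /mono /= word_cons word_nil mulr1.
  by case: eqP => _; rewrite ?mulr1 ?scale1r // !mulr0 scale0r.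
rewrite /perm_unitary mulr_suml !big_ord_recl big_ord0 addr0.
rewrite (hk false false) // (hk false true) // (hk true false) // (hk true true) //.
rewrite /rho_gen /= !den_cons den_nil addr0.
by case: b {hk} => /=; rewrite ?scale1r ?scale0r ?add0r ?addr0.
Qed.

Theorem mainTheorem1 (R : realType) (O2 : cstarAlgType R) (s : 'I_2 -> O2)
  (gamma : R[i] -> {lrmorphism O2 -> O2}) (E : O2 -> O2) (tau : O2 -> R[i])
  (H : hilbertType R) (pi_omega : O2 -> H -> H) (Omega : H)
  (sigma : 'S_4) (rho : {lrmorphism O2 -> O2}) :
  cuntz_generators s ->
  gauge_action s gamma ->
  gauge_average gamma E ->
  tracial_state (gauge_fixed gamma) tau ->
  GNS_representation (tau \o E) pi_omega Omega ->
  star_morphism rho ->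
  (forall i, rho (s i) = perm_unitary s sigma * s i) ->
  let M := double_commutant (range pi_omega) in
  let N := double_commutant (range (pi_omega \o rho)) in
  [/\ has (has_cycles^~ sigma) index_one -> minimal_index N M 1%:E,
      has (has_cycles^~ sigma) index_two -> minimal_index N M 2%:R%:E &
      has (has_cycles^~ sigma) index_four -> minimal_index N M 4%:R%:E].
Proof.
move=> hs hgamma hE htau hGNS rho_star rho_s M N.
have [h1 [h2 h3 h4 h5] cyclic tauE] := hGNS.
have hpi : star_rep pi_omega by split.
have key cs ms cc w c : has_cycles cs sigma -> (0 < c)%N ->
    certified (cycle_table cs) ms cc w c -> minimal_index N M c%:R%:E.
  move=> hc c0 cert; have [ht _] := andP cert.
  have rho_gen_s b : rho (s (bit b)) = den s (rho_gen (cycle_table cs) b).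
    by rewrite rho_s; exact: perm_unitary_gen.
  apply: (certified_minimal_index hs hgamma hE htau hpi tauE cyclic rho_star _ _ rho_gen_s c0 cert).
    move=> x i; have [b ->] := bit_surj i; rewrite rho_gen_s.
    exact: (kms_rho_gen hs hgamma hE htau hpi tauE ht).
  move=> i; have [b ->] := bit_surj i; rewrite rho_gen_s.
  exact: (degree_rho_gen hgamma ht).
split=> /hasP[cs hcs hc].
- by have cert := allP index_one_certified _ hcs; exact: key cert.
- by have := allP index_two_certified _ hcs; move=> /orP[] cert; exact: key cert.
- by have cert := allP index_four_certified _ hcs; exact: key cert.
Qed.
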